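(* Let $X\subset\mathbb{P}^n$ be a closed subscheme of codimension $c\ge2$ (not necessarily ACM), let $I=I(X)$ be its saturated homogeneous ideal, $A=R/I$, with minimal free graded $R$-resolution $$\cdots\to\bigoplus_{j=1}^{b_2}R(-n_{2j})\to\bigoplus_{i=1}^{b_1}R(-n_{1i})\to R\to R/I\to0.$$ Let $Z\subset X$ be a closed subset such that $X\setminus Z\hookrightarrow\mathbb{P}^n$ is a local complete intersection. Let $L$ be a finitely generated graded $R/I$-module such that $\widetilde{L}$ is invertible on $X\setminus Z$, and put $\mathcal{N}_X(\mathcal{L}):=\mathcal{H}om_{\mathcal{O}_X}(\mathcal{I}_X/\mathcal{I}_X^2,\widetilde{L})$. Assume $\operatorname{depth}_{I(Z)}L\ge2$, $\operatorname{depth}_{I(Z)}I/I^2\ge2$ and $\max_j\{n_{2j}\}<2\cdot\min_i\{n_{1i}\}$. Then $$\operatorname{Hom}_{\mathcal{O}_X}\big(\mathcal{N}_X(\mathcal{L}),\mathcal{N}_X(\mathcal{L})\big)\cong{}_0\!\operatorname{Hom}_A(I/I^2,I/I^2)\cong K.$$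
   Context: $K$ is an algebraically closed field of characteristic $0$, $R=K[x_0,\dots,x_n]$ with its standard grading, $\mathfrak{m}=(x_0,\dots,x_n)$, $\mathbb{P}^n=\operatorname{Proj}(R)$. $\mathcal{I}_X$ is the ideal sheaf of $X$. $I(Z)$ is the saturated homogeneous ideal of $Z$, with the convention $I(Z)=\mathfrak{m}$ if $Z=\emptyset$. $\operatorname{depth}_{I(Z)}N$ is the length of a maximal $N$-regular sequence in $I(Z)$. ${}_0\!\operatorname{Hom}_A$ is the degree-$0$ part of the graded Hom module. (ACM means that $R/I(X)$ is Cohen-Macaulay.) *)

(* Defs.v *)
From HB Require Import structures.
From mathcomp Require Import all_boot all_order all_algebra.
From mathcomp Require Import boolp.
From mathcomp Require Import mpoly.
From mathcomp Require Import ring.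

Set Implicit Arguments.
Unset Strict Implicit.
Unset Printing Implicit Defensive.

Import GRing.Theory.
Local Open Scope ring_scope.
Local Open Scope quotient_scope.

Definition rscal (S B : pzRingType) (phi : {rmorphism S -> B}) (V : lmodType B) :
  Type := V.

Section ScalarChange.

Variables (S B : pzRingType) (phi : {rmorphism S -> B}) (V : lmodType B).

Local Notation W := (rscal phi V).
HB.instance Definition _ := GRing.Zmodule.copy W V.

Definition rscal_scale (a : S) (v : W) : W := phi a *: (v : V).

Lemma rscal_scaleA a b v :
  rscal_scale a (rscal_scale b v) = rscal_scale (a * b) v.
Proof. by rewrite /rscal_scale scalerA rmorphM. Qed.

Lemma rscal_scale1 : left_id 1 rscal_scale.
Proof. by move=> v; rewrite /rscal_scale rmorph1 scale1r. Qed.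

Lemma rscal_scaleDr : right_distributive rscal_scale +%R.
Proof. by move=> a u v; rewrite /rscal_scale scalerDr. Qed.

Lemma rscal_scaleDl v : {morph rscal_scale^~ v : a b / a + b}.
Proof. by move=> a b; rewrite /rscal_scale rmorphD scalerDl. Qed.

HB.instance Definition _ := GRing.Zmodule_isLmodule.Build S W
  rscal_scaleA rscal_scale1 rscal_scaleDr rscal_scaleDl.

End ScalarChange.

Section QuotientScalars.

Variables (S : comNzRingType) (J : idealr S) (V : lmodType S).
Hypothesis JV : forall a (v : V), a \in J -> a *: v = 0.

Definition qmod of (forall a (v : V), a \in J -> a *: v = 0) : Type := V.
Local Notation W := (qmod JV).
HB.instance Definition _ := GRing.Zmodule.copy W V.

Definition qmod_scale (a : {ideal_quot J}) (v : W) : W := repr a *: (v : V).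

Lemma qmod_scaleE a v : qmod_scale (\pi a) v = a *: (v : V).
Proof.
apply/eqP; rewrite -subr_eq0 /qmod_scale -scalerBl; apply/eqP/JV.
by rewrite Quotient.idealrBE reprK.
Qed.

Lemma qmod_scaleA a b v :
  qmod_scale a (qmod_scale b v) = qmod_scale (a * b) v.
Proof.
by rewrite -[a]reprK -[b]reprK -rmorphM !qmod_scaleE scalerA.
Qed.

Lemma qmod_scale1 : left_id 1 qmod_scale.
Proof. by move=> v; rewrite -(rmorph1 \pi_({ideal_quot J})) qmod_scaleE scale1r. Qed.

Lemma qmod_scaleDr : right_distributive qmod_scale +%R.
Proof. by move=> a u v; rewrite /qmod_scale scalerDr. Qed.

Lemma qmod_scaleDl v : {morph qmod_scale^~ v : a b / a + b}.
Proof.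
move=> a b; rewrite -[a]reprK -[b]reprK -rmorphD !qmod_scaleE.
exact: scalerDl.
Qed.

HB.instance Definition _ := GRing.Zmodule_isLmodule.Build {ideal_quot J} W
  qmod_scaleA qmod_scale1 qmod_scaleDr qmod_scaleDl.

End QuotientScalars.

(* The conormal module J / J^2 of an ideal J of S, as an (S / J)-module. *)
Section Conormal.

Variables (S : comNzRingType) (J : idealr S).

Record ideal_elt := IdealElt { ideal_val : S; ideal_valP : ideal_val \in J }.
HB.instance Definition _ := [isSub for ideal_val].
HB.instance Definition _ := [Choice of ideal_elt by <:].
HB.instance Definition _ := [SubChoice_isSubZmodule of ideal_elt by <:].

Definition sq_ideal (a : S) : Prop := exists s : seq (S * S),
  (forall bc, bc \in s -> bc.1 \in J /\ bc.2 \in J)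
  /\ a = \sum_(bc <- s) bc.1 * bc.2.

Definition sq_sub (a : ideal_elt) : bool := `[< sq_ideal (ideal_val a) >].

Lemma sq_ideal0 : sq_ideal 0.
Proof. by exists [::]; rewrite big_nil. Qed.

Lemma sq_idealB a b : sq_ideal a -> sq_ideal b -> sq_ideal (a - b).
Proof.
move=> [s [sJ ->]] [t [tJ ->]].
exists (s ++ [seq (- bc.1, bc.2) | bc <- t]); split.
  move=> bc; rewrite mem_cat => /orP[/sJ //|/mapP[cd /tJ[c d] ->]] /=.
  by rewrite rpredN.
rewrite big_cat big_map /= -sumrN; congr (_ + _).
by apply: eq_bigr => bc _; rewrite mulNr.
Qed.

Lemma sq_idealMl c a : sq_ideal a -> sq_ideal (c * a).
Proof.
move=> [s [sJ ->]]; exists [seq (c * bc.1, bc.2) | bc <- s]; split.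
  by move=> bc /mapP[de /sJ[d e] ->]; rewrite /= idealMr.
by rewrite big_map mulr_sumr; apply: eq_bigr => bc _; rewrite mulrA.
Qed.

Lemma sq_idealM a b : a \in J -> b \in J -> sq_ideal (a * b).
Proof.
move=> aJ bJ; exists [:: (a, b)]; rewrite big_seq1; split=> // bc.
by rewrite inE => /eqP->.
Qed.

Lemma sq_idealD a b : sq_ideal a -> sq_ideal b -> sq_ideal (a + b).
Proof.
move=> aJ bJ; rewrite -[b]opprK; apply: sq_idealB => //.
by rewrite -sub0r; apply: sq_idealB => //; exact: sq_ideal0.
Qed.

Lemma sq_sub_zmod : zmod_closed sq_sub.
Proof.
split; first exact/asboolP/sq_ideal0.
by move=> a b /asboolP aJ /asboolP bJ; exact/asboolP/sq_idealB.
Qed.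
HB.instance Definition _ := GRing.isZmodClosed.Build ideal_elt sq_sub sq_sub_zmod.

Definition sq_zmod := GRing.ZmodClosed.clone ideal_elt sq_sub _.

Definition conormal : Type := Quotient.quot sq_zmod.
HB.instance Definition _ := GRing.Zmodule.on conormal.

Definition conormal_pi (a : ideal_elt) : conormal := \pi a.

(* The class in J / J^2 of an element of J, 0 for an element outside J. *)
Definition conormal_class (a : S) : conormal := conormal_pi (insubd 0 a).

Lemma conormal_piP a b : conormal_pi a = conormal_pi b <-> sq_ideal (ideal_val a - ideal_val b).
Proof.
rewrite /conormal_pi; split; first by move/eqP; rewrite -Quotient.idealrBE => /asboolP.
by move=> h; apply/eqP; rewrite -Quotient.idealrBE; apply/asboolP.
Qed.

Lemma conormal_piB a b : conormal_pi (a - b) = conormal_pi a - conormal_pi b.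
Proof. exact: raddfB. Qed.

Lemma conormal_piD a b : conormal_pi (a + b) = conormal_pi a + conormal_pi b.
Proof. exact: raddfD. Qed.

Lemma conormal_pi0 : conormal_pi 0 = 0.
Proof. exact: raddf0. Qed.

Definition ideal_mul (c : S) (a : ideal_elt) : ideal_elt :=
  IdealElt (idealMr c (ideal_valP a)).

Definition conormal_scale (c : {ideal_quot J}) (q : conormal) : conormal :=
  conormal_pi (ideal_mul (repr c) (repr (q : Quotient.quot sq_zmod))).

Lemma conormal_scaleE c a :
  conormal_scale (\pi c) (conormal_pi a) = conormal_pi (ideal_mul c a).
Proof.
apply/conormal_piP => /=.
set c' := repr _; set a' := repr _.
have -> : c' * ideal_val a' - c * ideal_val a = (c' - c) * (ideal_val a') + c * (ideal_val a' - ideal_val a).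
  by rewrite mulrBl mulrBr addrA subrK.
apply: sq_idealD.
  by apply: sq_idealM (ideal_valP _); rewrite Quotient.idealrBE reprK.
apply: sq_idealMl; apply: (conormal_piP a' a).1.
by rewrite /conormal_pi /a' reprK.
Qed.

Lemma conormal_surj q : exists a, q = conormal_pi a.
Proof. by exists (repr (q : Quotient.quot sq_zmod)); rewrite /conormal_pi reprK. Qed.

Lemma conormal_scaleA a b q :
  conormal_scale a (conormal_scale b q) = conormal_scale (a * b) q.
Proof.
have [v ->] := conormal_surj q; rewrite -[a]reprK -[b]reprK -rmorphM.
rewrite !conormal_scaleE; congr conormal_pi.
by apply: val_inj; rewrite /= mulrA.
Qed.

Lemma conormal_scale1 : left_id 1 conormal_scale.
Proof.
move=> q; have [v ->] := conormal_surj q.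
rewrite -(rmorph1 \pi_({ideal_quot J})) conormal_scaleE; congr conormal_pi.
by apply: val_inj; rewrite /= mul1r.
Qed.

Lemma conormal_scaleDr : right_distributive conormal_scale +%R.
Proof.
move=> a p q; have [u ->] := conormal_surj p; have [v ->] := conormal_surj q.
rewrite -[a]reprK -conormal_piD !conormal_scaleE -conormal_piD.
by congr conormal_pi; apply: val_inj; rewrite /= mulrDr.
Qed.

Lemma conormal_scaleDl q : {morph conormal_scale^~ q : a b / a + b}.
Proof.
have [v ->] := conormal_surj q => a b; rewrite -[a]reprK -[b]reprK -rmorphD.
rewrite !conormal_scaleE -conormal_piD.
by congr conormal_pi; apply: val_inj; rewrite /= mulrDl.
Qed.

HB.instance Definition _ := GRing.Zmodule_isLmodule.Build {ideal_quot J} conormal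
  conormal_scaleA conormal_scale1 conormal_scaleDr conormal_scaleDl.

Lemma conormal_classB a b : a \in J -> b \in J ->
  conormal_class (a - b) = conormal_class a - conormal_class b.
Proof.
move=> aJ bJ; rewrite -conormal_piB; congr conormal_pi; apply: val_inj => /=.
by rewrite !insubdK // -topredE /= rpredB.
Qed.

Lemma conormal_classD a b : a \in J -> b \in J ->
  conormal_class (a + b) = conormal_class a + conormal_class b.
Proof.
move=> aJ bJ; rewrite -conormal_piD; congr conormal_pi; apply: val_inj => /=.
by rewrite !insubdK // -topredE /= rpredD.
Qed.

Lemma conormal_class0 : conormal_class 0 = 0.
Proof.
rewrite -conormal_pi0; congr conormal_pi; apply: val_inj.
by rewrite insubdK // -topredE /= rpred0.
Qed.

Lemma conormal_classZ c a : a \in J ->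
  \pi_({ideal_quot J}) c *: conormal_class a = conormal_class (c * a).
Proof.
move=> aJ; rewrite [LHS]conormal_scaleE; congr conormal_pi; apply: val_inj.
by rewrite /= !insubdK // -topredE /= idealMr.
Qed.

End Conormal.

(* (s_0, ..., s_{k-1}) N *)
Definition span_mod (S : pzRingType) (N : lmodType S) (s : seq S) (v : N) : Prop :=
  exists w : 'I_(size s) -> N, v = \sum_(i < size s) s`_i *: w i.

Definition regular_seq (S : pzRingType) (N : lmodType S) (s : seq S) : Prop :=
  (forall (k : nat) (v : N), (k < size s)%N ->
     span_mod (take k s) (s`_k *: v) -> span_mod (take k s) v)
  /\ exists v : N, ~ span_mod s v.

Definition depth_is (S : pzRingType) (J : S -> Prop) (N : lmodType S) (d : nat) : Prop :=
  exists s : seq S,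
    [/\ size s = d, forall a, a \in s -> J a, regular_seq N s
      & forall a, J a -> ~ regular_seq N (rcons s a)].

Definition fin_gen (S : pzRingType) (N : lmodType S) : Prop :=
  exists g : seq N, forall v, exists a : 'I_(size g) -> S, v = \sum_(i < size g) a i *: g`_i.

Definition lmod_iso (S : pzRingType) (V W : lmodType S) : Prop :=
  exists f : {linear V -> W}, bijective f.

Section Graded.

Variables (K : comNzRingType) (n : nat).
Local Notation R := {mpoly K[n.+1]}.

Definition homogeneous_ideal (I : {pred R}) : Prop :=
  forall a, a \in I -> forall d, pihomog mdeg d a \in I.

Record grading (M : lmodType R) := Grading {
  gcomp :> int -> M -> Prop;
  gcomp0 : forall d, gcomp d 0;
  gcompB : forall d u v, gcomp d u -> gcomp d v -> gcomp d (u - v);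
  gcompZ : forall (d : int) (e : nat) a u,
    a \is e.-homog -> gcomp d u -> gcomp (d + e%:Z) (a *: u);
  gcomp_sum : forall u, exists (s : seq int) (c : int -> M),
    (forall d, gcomp d (c d)) /\ u = \sum_(d <- s) c d;
  gcomp_direct : forall (s : seq int) (c : int -> M), uniq s ->
    (forall d, gcomp d (c d)) -> \sum_(d <- s) c d = 0 ->
    forall d, d \in s -> c d = 0 }.

Definition std_comp (d : int) (a : R^o) : Prop :=
  if d is Posz e then (a : R) \is e.-homog else a = 0.

Lemma std_comp_pi (d : int) (a : R) : std_comp d a ->
  forall e : nat, pihomog mdeg e a = if d == e%:Z then a else 0.
Proof.
case: d => [d|d] /= ha e; last by rewrite ha pihomog0.
rewrite eqz_nat; case: eqP => [<-|/eqP ne]; first exact: pihomog_dE.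
exact: pihomog_ne0 ne ha.
Qed.

Lemma pihomog_all0 (a : R) : (forall e, pihomog mdeg e a = 0) -> a = 0.
Proof.
move=> h; etransitivity; first exact: (@pihomog_partitionE _ _ mdeg _ a (leqnn _)).
by apply: big1 => i _; rewrite h.
Qed.

Fact std_comp0 d : std_comp d 0.
Proof. by case: d => d //=; exact: dhomog0. Qed.

Fact std_compB d u v : std_comp d u -> std_comp d v -> std_comp d (u - v).
Proof. by case: d => d /=; [exact: rpredB | move=> -> ->; rewrite subrr]. Qed.

Fact std_compZ (d : int) (e : nat) (a : R) (u : R^o) :
  a \is e.-homog -> std_comp d u -> std_comp (d + e%:Z) (a *: u).
Proof.
case: d => d ha /= hu; first by rewrite addnC; exact: dhomogM.
by rewrite hu scaler0; exact: std_comp0.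
Qed.

Fact std_comp_sum (u : R^o) : exists (s : seq int) (c : int -> R^o),
  (forall d, std_comp d (c d)) /\ u = \sum_(d <- s) c d.
Proof.
exists (map Posz (index_iota 0 (mmeasure mdeg u))).
exists (fun d => if d is Posz e then pihomog mdeg e u else 0); split.
  by case=> d //=; exact: pihomogP.
by rewrite big_map big_mkord; exact: (@pihomog_partitionE _ _ mdeg _ u (leqnn _)).
Qed.

Fact std_comp_direct (s : seq int) (c : int -> R^o) : uniq s ->
  (forall d, std_comp d (c d)) -> \sum_(d <- s) c d = 0 ->
  forall d, d \in s -> c d = 0.
Proof.
move=> us hc sum0 d ds; apply: pihomog_all0 => e.
rewrite (std_comp_pi (hc d)); case: eqP => // de.
move: (congr1 (pihomog mdeg e) sum0); rewrite raddf0 raddf_sum /=.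
rewrite (bigD1_seq d) //= (std_comp_pi (hc d)) de eqxx big1 ?addr0 // => i.
by rewrite (std_comp_pi (hc i)) => /negPf; rewrite -de => ->.
Qed.

Definition std_grading : grading R^o :=
  Grading std_comp0 std_compB std_compZ std_comp_sum std_comp_direct.

(* Homogeneous localization: the degree 0 part M_(P) of the localization of M *)
(* at the homogeneous elements outside P.                                     *)
Section HomogeneousLocalization.

Variables (M : lmodType R) (g : grading M) (P : prime_idealr R).

Definition is_frac (m : M) (f : R) : Prop :=
  exists d : nat, [/\ g d%:Z m, f \is d.-homog & f \notin P].

Record hfrac := HFrac { fnum : M; fden : R; fracP : is_frac fnum fden }.
HB.instance Definition _ := gen_eqMixin hfrac.
HB.instance Definition _ := gen_choiceMixin hfrac.

Definition frac_eq (u v : hfrac) : bool :=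
  `[< exists h : R, (exists e : nat, h \is e.-homog) /\ h \notin P /\
        h *: (fden v *: fnum u) = h *: (fden u *: fnum v) >].

Lemma frac_eq_equiv : equiv_class_of frac_eq.
Proof.
split=> [u|u v|v u w].
- apply/asboolP; exists 1; split; first by exists 0%N; exact: dhomog1.
  by rewrite idealr1.
- by apply/asboolP/asboolP => -[h [he [hP e]]]; exists h.
move=> /asboolP[h [[a ha] [hP e]]] /asboolP[k [[b kb] [kP e']]].
apply/asboolP; have [d [_ vd vP]] := fracP v.
exists (h * k * fden v); split; first by exists (a + b + d)%N; rewrite !dhomogM.
split; first by rewrite !prime_idealrM !negb_or hP kP vP.
rewrite !scalerA.
have -> : h * k * fden v * fden w = (k * fden w) * (h * fden v) by ring.
have -> : h * k * fden v * fden u = (h * fden u) * (k * fden v) by ring.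
rewrite -!scalerA in e e' *.
rewrite e -e' !scalerA; congr (_ *: _); ring.
Qed.
Canonical frac_eq_equiv_rel := EquivRelPack frac_eq_equiv.
Canonical frac_eq_encModRel := defaultEncModRel frac_eq.

Definition hloc : Type := {eq_quot frac_eq}.
HB.instance Definition _ := Choice.on hloc.

Definition hloc_pi (u : hfrac) : hloc := \pi_({eq_quot frac_eq}) u.

Lemma hloc_piP u v : hloc_pi u = hloc_pi v <-> frac_eq u v.
Proof. by split => [/eqmodP|/eqmodP]. Qed.

Definition hloc_repr (q : hloc) : hfrac := repr (q : {eq_quot frac_eq}).

Lemma hloc_reprK q : hloc_pi (hloc_repr q) = q.
Proof. exact: reprK. Qed.

Lemma hloc_surj q : exists u, q = hloc_pi u.
Proof. by exists (hloc_repr q); rewrite hloc_reprK. Qed.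

Lemma hloc_eq1 u v :
  fden v *: fnum u = fden u *: fnum v -> hloc_pi u = hloc_pi v.
Proof.
move=> e; apply/hloc_piP/asboolP; exists 1; split; last by rewrite idealr1 e.
by exists 0%N; exact: dhomog1.
Qed.

Fact hfrac0_subproof : is_frac 0 1.
Proof.
by exists 0%N; split; [exact: gcomp0 | exact: dhomog1 | rewrite idealr1].
Qed.

Fact hfracN_subproof (u : hfrac) : is_frac (- fnum u) (fden u).
Proof.
have [d [hu ud uP]] := fracP u; exists d; split=> //.
by rewrite -sub0r; apply: gcompB => //; exact: gcomp0.
Qed.

Fact hfracD_subproof (u v : hfrac) :
  is_frac (fden v *: fnum u + fden u *: fnum v) (fden u * fden v).
Proof.
have [d [hu ud uP]] := fracP u; have [e [hv ve vP]] := fracP v.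
exists (d + e)%N; split; last 1 first.
- by rewrite prime_idealrM negb_or uP vP.
- rewrite -[_ *: fnum v]opprK; apply: gcompB; first by rewrite PoszD; exact: gcompZ.
  rewrite -sub0r; apply: gcompB; first exact: gcomp0.
  by rewrite addnC PoszD; exact: gcompZ.
- exact: dhomogM.
Qed.

Definition hloc_zero : hloc := hloc_pi (HFrac hfrac0_subproof).
Definition hloc_opp (p : hloc) : hloc :=
  hloc_pi (HFrac (hfracN_subproof (hloc_repr p))).
Definition hloc_add (p q : hloc) : hloc :=
  hloc_pi (HFrac (hfracD_subproof (hloc_repr p) (hloc_repr q))).

Lemma hloc_oppE u : hloc_opp (hloc_pi u) = hloc_pi (HFrac (hfracN_subproof u)).
Proof.
rewrite /hloc_opp; move: (hloc_repr _) (hloc_reprK (hloc_pi u)) => v.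
move=> /hloc_piP/asboolP[h [he [hP e]]]; apply/hloc_piP/asboolP.
by exists h; rewrite /= !scalerN e.
Qed.

Lemma hloc_addE u v :
  hloc_add (hloc_pi u) (hloc_pi v) = hloc_pi (HFrac (hfracD_subproof u v)).
Proof.
rewrite /hloc_add.
move: (hloc_repr _) (hloc_reprK (hloc_pi u)) => u'.
move=> /hloc_piP/asboolP[h [[a ha] [hP e]]].
move: (hloc_repr _) (hloc_reprK (hloc_pi v)) => v'.
move=> /hloc_piP/asboolP[k [[b kb] [kP e']]].
apply/hloc_piP/asboolP; exists (h * k); split.
  by exists (a + b)%N; exact: dhomogM.
split; first by rewrite prime_idealrM negb_or hP.
rewrite /= !scalerDr !scalerA; rewrite !scalerA in e e'; congr (_ + _).
- have -> : h * k * (fden u * fden v) * fden v'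
          = (k * fden v * fden v') * (h * fden u) by ring.
  rewrite -scalerA e scalerA; congr (_ *: _); ring.
- have -> : h * k * (fden u * fden v) * fden u'
          = (h * fden u * fden u') * (k * fden v) by ring.
  rewrite -scalerA e' scalerA; congr (_ *: _); ring.
Qed.

Lemma hloc_addA : associative hloc_add.
Proof.
move=> p q r; have [u ->] := hloc_surj p; have [v ->] := hloc_surj q.
have [w ->] := hloc_surj r; rewrite !hloc_addE; apply: hloc_eq1 => /=.
rewrite !scalerDr !scalerA !addrA; congr (_ *: _ + _ *: _ + _ *: _); ring.
Qed.

Lemma hloc_addC : commutative hloc_add.
Proof.
move=> p q; have [u ->] := hloc_surj p; have [v ->] := hloc_surj q.
rewrite !hloc_addE; apply: hloc_eq1 => /=.
by rewrite mulrC addrC.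
Qed.

Lemma hloc_add0 : left_id hloc_zero hloc_add.
Proof.
move=> p; have [u ->] := hloc_surj p; rewrite hloc_addE; apply: hloc_eq1 => /=.
by rewrite scaler0 add0r scale1r mul1r.
Qed.

Lemma hloc_addN : left_inverse hloc_zero hloc_opp hloc_add.
Proof.
move=> p; have [u ->] := hloc_surj p; rewrite hloc_oppE hloc_addE.
by apply: hloc_eq1 => /=; rewrite scalerN addNr !scaler0.
Qed.

HB.instance Definition _ := GRing.isZmodule.Build hloc
  hloc_addA hloc_addC hloc_add0 hloc_addN.

(* The fraction m / f, with junk value 0 when it is not a fraction in M_(P). *)
Definition frac (m : M) (f : R) : hloc :=
  if pselect (is_frac m f) is left h then hloc_pi (HFrac h) else 0.

Lemma fracE m f (h : is_frac m f) : frac m f = hloc_pi (HFrac h).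
Proof. by rewrite /frac; case: pselect => // h'; exact: hloc_eq1. Qed.

Lemma frac_surj q : exists m f, is_frac m f /\ q = frac m f.
Proof.
have [[m f h] ->] := hloc_surj q; exists m, f; split=> //.
by rewrite fracE.
Qed.

End HomogeneousLocalization.

(* The local ring of projective space at P. *)
Definition stalk (P : prime_idealr R) : Type := hloc std_grading P.
HB.instance Definition _ P := GRing.Zmodule.on (stalk P).

Section StalkAction.

Variables (M : lmodType R) (g : grading M) (P : prime_idealr R).

Fact hfracZ_subproof (a : hfrac std_grading P) (u : hfrac g P) :
  is_frac g P ((fnum a : R) *: fnum u) (fden a * fden u).
Proof.
have [d [ha ad aP]] := fracP a; have [e [hu ue uP]] := fracP u.
exists (d + e)%N; split.
- by rewrite addnC PoszD; exact: gcompZ.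
- exact: dhomogM.
- by rewrite prime_idealrM negb_or aP uP.
Qed.

Definition hloc_scale (a : stalk P) (q : hloc g P) : hloc g P :=
  hloc_pi (HFrac (hfracZ_subproof (hloc_repr a) (hloc_repr q))).

Lemma hloc_scaleE a u :
  hloc_scale (hloc_pi a) (hloc_pi u) = hloc_pi (HFrac (hfracZ_subproof a u)).
Proof.
rewrite /hloc_scale.
move: (hloc_repr _) (hloc_reprK (hloc_pi a)) => a'.
move=> /hloc_piP/asboolP[h [[i hi] [hP e]]].
move: (hloc_repr _) (hloc_reprK (hloc_pi u)) => u'.
move=> /hloc_piP/asboolP[k [[j kj] [kP e']]].
apply/hloc_piP/asboolP; exists (h * k); split.
  by exists (i + j)%N; exact: dhomogM.
split; first by rewrite prime_idealrM negb_or hP.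
have {}e : h * (fden a * (fnum a' : R)) = h * (fden a' * (fnum a : R)) by exact: e.
rewrite /= !scalerA; rewrite !scalerA in e'.
have -> : h * k * (fden a * fden u) * (fnum a' : R)
        = (h * (fden a * (fnum a' : R))) * (k * fden u) by ring.
rewrite e -scalerA e' scalerA; congr (_ *: _); ring.
Qed.

End StalkAction.

Section StalkRing.

Variable P : prime_idealr R.

Fact hfrac1_subproof : is_frac std_grading P (1 : R) 1.
Proof. by exists 0%N; rewrite idealr1; split=> //; exact: dhomog1. Qed.

Definition stalk1 : stalk P := hloc_pi (HFrac hfrac1_subproof).
Definition stalk_mul (a b : stalk P) : stalk P := hloc_scale a (b : hloc _ _).

Lemma stalk_mulE (a b : hfrac std_grading P) :
  stalk_mul (hloc_pi a) (hloc_pi b) = hloc_pi (HFrac (hfracZ_subproof a b)).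
Proof. exact: hloc_scaleE. Qed.

Lemma stalk_mulA : associative stalk_mul.
Proof.
move=> p q r; have [u ->] := hloc_surj p; have [v ->] := hloc_surj q.
have [w ->] := hloc_surj r; rewrite !stalk_mulE; apply: hloc_eq1 => /=.
rewrite /GRing.scale /=; ring.
Qed.

Lemma stalk_mulC : commutative stalk_mul.
Proof.
move=> p q; have [u ->] := hloc_surj p; have [v ->] := hloc_surj q.
rewrite !stalk_mulE; apply: hloc_eq1 => /=; rewrite /GRing.scale /=; ring.
Qed.

Lemma stalk_mul1 : left_id stalk1 stalk_mul.
Proof.
move=> p; have [u ->] := hloc_surj p.
rewrite !stalk_mulE; apply: hloc_eq1 => /=; rewrite /GRing.scale /=; ring.
Qed.

Lemma stalk_mulDl : left_distributive stalk_mul +%R.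
Proof.
move=> p q r; have [u ->] := hloc_surj p; have [v ->] := hloc_surj q.
have [w ->] := hloc_surj r.
rewrite [hloc_pi u + _]hloc_addE !stalk_mulE [RHS]hloc_addE; apply: hloc_eq1 => /=.
rewrite /GRing.scale /=; ring.
Qed.

Lemma stalk_1neq0 : stalk1 != 0.
Proof.
apply/eqP => /hloc_piP/asboolP[h [_ [hP]]] /=.
rewrite scaler0 scaler0 scale1r /GRing.scale /= mulr1 => h0.
by rewrite h0 idealr0 in hP.
Qed.

HB.instance Definition _ := GRing.Zmodule_isComNzRing.Build (stalk P)
  stalk_mulA stalk_mulC stalk_mul1 stalk_mulDl stalk_1neq0.

End StalkRing.

Section StalkModule.

Variables (M : lmodType R) (g : grading M) (P : prime_idealr R).

Lemma hloc_scaleA (a b : stalk P) (q : hloc g P) :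
  hloc_scale a (hloc_scale b q) = hloc_scale (a * b) q.
Proof.
have [x ->] := hloc_surj a; have [y ->] := hloc_surj b.
have [u ->] := hloc_surj q.
rewrite [_ * _]stalk_mulE !hloc_scaleE; apply: hloc_eq1 => /=.
rewrite !scalerA; congr (_ *: _); rewrite /GRing.scale /=; ring.
Qed.

Lemma hloc_scale1 : left_id (1 : stalk P) (@hloc_scale M g P).
Proof.
move=> q; have [u ->] := hloc_surj q.
by rewrite hloc_scaleE; apply: hloc_eq1 => /=; rewrite scale1r mul1r.
Qed.

Lemma hloc_scaleDr : right_distributive (@hloc_scale M g P) +%R.
Proof.
move=> a p q; have [x ->] := hloc_surj a; have [u ->] := hloc_surj p.
have [v ->] := hloc_surj q.
rewrite [hloc_pi u + _]hloc_addE !hloc_scaleE [RHS]hloc_addE.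
apply: hloc_eq1 => /=; rewrite !scalerDr !scalerA.
congr (_ *: _ + _ *: _); ring.
Qed.

Lemma hloc_scaleDl (q : hloc g P) : {morph (@hloc_scale M g P)^~ q : a b / a + b}.
Proof.
move=> a b; have [x ->] := hloc_surj a; have [y ->] := hloc_surj b.
have [u ->] := hloc_surj q.
rewrite [hloc_pi x + _]hloc_addE !hloc_scaleE [RHS]hloc_addE.
apply: hloc_eq1 => /=; rewrite !scalerDr !scalerA -scalerDl.
congr (_ *: _); rewrite /GRing.scale /=; ring.
Qed.

HB.instance Definition _ := GRing.Zmodule_isLmodule.Build (stalk P) (hloc g P)
  hloc_scaleA hloc_scale1 hloc_scaleDr hloc_scaleDl.

End StalkModule.

Section FractionRules.

Variables (M : lmodType R) (g : grading M) (P : prime_idealr R).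

Definition sfrac (a f : R) : stalk P := frac std_grading P (a : R^o) f.

Lemma frac0 : frac g P 0 1 = 0.
Proof. by rewrite (fracE (hfrac0_subproof g P)). Qed.

Lemma fracB m f m' f' : is_frac g P m f -> is_frac g P m' f' ->
  is_frac g P (f' *: m - f *: m') (f * f') /\
  frac g P m f - frac g P m' f' = frac g P (f' *: m - f *: m') (f * f').
Proof.
move=> h h'.
have k : is_frac g P (f' *: m - f *: m') (f * f').
  have := hfracD_subproof (HFrac h) (HFrac (hfracN_subproof (HFrac h'))).
  by rewrite /= scalerN.
split=> //; rewrite (fracE h) (fracE h') (fracE k).
rewrite [- hloc_pi _]hloc_oppE [_ + _]hloc_addE; apply: hloc_eq1 => /=.
by rewrite scalerN.
Qed.

Lemma fracZ a b m f : is_frac std_grading P a b -> is_frac g P m f ->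
  is_frac g P ((a : R) *: m) (b * f) /\
  sfrac a b *: frac g P m f = frac g P ((a : R) *: m) (b * f).
Proof.
move=> h h'; have k := hfracZ_subproof (HFrac h) (HFrac h'); split=> //.
rewrite /sfrac (fracE h) (fracE h') (fracE k) [LHS]hloc_scaleE.
exact: hloc_eq1.
Qed.

End FractionRules.

Lemma sfracB P a b a' b' :
  is_frac std_grading P a b -> is_frac std_grading P a' b' ->
  is_frac std_grading P ((b' * a - b * a' : R) : R^o) (b * b') /\
  sfrac P a b - sfrac P a' b' = sfrac P (b' * a - b * a') (b * b').
Proof. exact: fracB. Qed.

Lemma sfracM P a b a' b' :
  is_frac std_grading P a b -> is_frac std_grading P a' b' ->
  is_frac std_grading P ((a * a' : R) : R^o) (b * b') /\
  sfrac P a b * sfrac P a' b' = sfrac P (a * a') (b * b').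
Proof. exact: fracZ. Qed.

Lemma sfrac1 P : sfrac P 1 1 = 1.
Proof. by rewrite /sfrac (fracE (hfrac1_subproof P)). Qed.

End Graded.

Section Geometry.

Variables (K : fieldType) (n : nat).
Local Notation R := {mpoly K[n.+1]}.

Record proj_pt := ProjPt {
  pt_set : R -> bool;
  pt_idealr : idealr_closed pt_set;
  pt_primeP : prime_idealr_closed pt_set;
  pt_homog : homogeneous_ideal pt_set;
  pt_relevant : exists i : 'I_n.+1, ~~ pt_set 'X_i }.
HB.instance Definition _ P := isIdealr.Build R (pt_set P) (pt_idealr P).
HB.instance Definition _ P := isPrimeIdealrClosed.Build R (pt_set P) (@pt_primeP P).

Definition pt_prime (P : proj_pt) : prime_idealr R :=
  PrimeIdealr.clone R (pt_set P) _.
Coercion pt_prime : proj_pt >-> prime_idealr.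

(* A nonempty closed subscheme, given by its saturated homogeneous ideal. *)
Record subscheme := Subscheme {
  sub_ideal :> idealr R;
  sub_homog : homogeneous_ideal sub_ideal;
  sub_saturated : forall a : R,
    (exists k : nat, forall m : 'X_{1..n.+1}, mdeg m = k -> 'X_[m] * a \in sub_ideal) ->
    a \in sub_ideal }.

Variable X : subscheme.

Definition coord_ring : comNzRingType := {ideal_quot X}.
Definition coord_pi : {rmorphism R -> coord_ring} := \pi_({ideal_quot X}).

Record sub_pt := SubPt {
  sub_pt_val :> proj_pt;
  sub_ptP : forall a, a \in (X : idealr R) -> a \in (sub_pt_val : prime_idealr R) }.

(* The stalk at x of the ideal sheaf of X. *)
Definition stalk_ideal (x : sub_pt) (z : stalk x) : bool :=
  `[< exists u : hfrac (std_grading K n) x,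
        (fnum u : R) \in (X : idealr R) /\ z = hloc_pi u >].

Lemma stalk_ideal_closed x : idealr_closed (@stalk_ideal x).
Proof.
split.
- by apply/asboolP; exists (HFrac (hfrac0_subproof (std_grading K n) x)); rewrite idealr0.
- apply/asboolP => -[u [uX /hloc_piP/asboolP[h [_ [hP e]]]]].
  have [d [_ ud uP]] := fracP u.
  have {}e : h * (fden u * 1) = h * (1 * (fnum u : R)) by exact: e.
  have : h * (fden u * 1) \in (x : prime_idealr R).
    by rewrite e mul1r; exact/idealMr/sub_ptP.
  by rewrite mulr1 prime_idealrM (negPf hP) (negPf uP).
- move=> a b c /asboolP[u [uX ->]] /asboolP[v [vX ->]]; apply/asboolP.
  have [w ->] := hloc_surj a.
  exists (HFrac (hfracD_subproof (HFrac (hfracZ_subproof w u)) v)); split.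
    rewrite /= /GRing.scale /=; apply: rpredD; last exact: idealMr.
    by rewrite idealMr // idealMr.
  by rewrite [_ * _]stalk_mulE [LHS]hloc_addE.
Qed.
HB.instance Definition _ (x : sub_pt) := isIdealr.Build (stalk x) (@stalk_ideal x)
  (stalk_ideal_closed x).

Definition stalk_idealr (x : sub_pt) := Idealr.clone (stalk x) (@stalk_ideal x) _.

Definition local_ring (x : sub_pt) : comNzRingType := {ideal_quot stalk_idealr x}.
Definition local_pi (x : sub_pt) : {rmorphism stalk x -> local_ring x} :=
  \pi_({ideal_quot stalk_idealr x}).

Definition is_open (U : sub_pt -> Prop) : Prop := exists S : R -> Prop,
  (forall f, S f -> exists d : nat, f \is d.-homog) /\
  forall x, U x <-> exists f, S f /\ f \notin (x : prime_idealr R).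

Definition is_closed (Z : sub_pt -> Prop) : Prop := exists S : R -> Prop,
  (forall f, S f -> exists d : nat, f \is d.-homog) /\
  forall x, Z x <-> forall f, S f -> f \in (x : prime_idealr R).

Record opens := Opens { oset :> sub_pt -> Prop; osetP : is_open oset }.

Fact openT_subproof : is_open (fun=> True).
Proof.
exists (fun f => exists i : 'I_n.+1, f = 'X_i); split.
  by move=> _ [i ->]; exists 1%N; rewrite dhomogX; apply/eqP/mdeg1.
move=> x; split=> // _; have [i iP] := pt_relevant x; exists 'X_i; split=> //.
by exists i.
Qed.
Definition openT : opens := Opens openT_subproof.

Fact openI_subproof (U V : opens) : is_open (fun x => U x /\ V x).
Proof.
have [S [Sh US]] := osetP U; have [T [Th VT]] := osetP V.
exists (fun f => exists a b, [/\ S a, T b & f = a * b]); split.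
  move=> _ [a [b [/Sh[d ad] /Th[e be] ->]]]; exists (d + e)%N; exact: dhomogM.
move=> x; split.
  move=> [/US[a [Sa ax]] /VT[b [Tb bx]]]; exists (a * b); split.
    by exists a, b.
  by rewrite prime_idealrM negb_or ax bx.
move=> [_ [[a [b [Sa Tb ->]]]]]; rewrite prime_idealrM negb_or => /andP[ax bx].
by split; [apply/US; exists a | apply/VT; exists b].
Qed.
Definition openI (U V : opens) : opens := Opens (openI_subproof U V).

Definition osub (V U : opens) : Prop := forall x, V x -> U x.

Lemma osub_refl U : osub U U. Proof. by []. Qed.

Lemma osub_trans U V W : osub W V -> osub V U -> osub W U.
Proof. by move=> h h' x /h /h'. Qed.

Definition opt (U : opens) := {x : sub_pt | U x}.
Definition opt_incl U V (h : osub V U) (x : opt V) : opt U :=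
  exist _ (sval x) (h _ (svalP x)).

(* Sections of the structure sheaf of X: germs that are locally a quotient of *)
(* two forms of the same degree.                                              *)
Definition is_osec (U : opens) (s : forall x : opt U, local_ring (sval x)) : Prop :=
  forall x : opt U, exists (V : opens) (a f : R), V (sval x) /\
    forall y : opt U, V (sval y) ->
      is_frac (std_grading K n) (sval y) (a : R^o) f /\
      s y = local_pi (sval y) (sfrac (sval y) a f).

Record osec (U : opens) := OSec {
  osec_fun :> forall x : opt U, local_ring (sval x);
  osecP : is_osec osec_fun }.

Lemma osec_ext U (s t : osec U) : (forall x, s x = t x) -> s = t.
Proof.
case: s t => [s sP] [t tP] /= st.
have e : s = t by apply: functional_extensionality_dep.
by case: t / e tP st => tP _; congr OSec; exact: Prop_irrelevance.
Qed.

HB.instance Definition _ U := gen_eqMixin (osec U).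
HB.instance Definition _ U := gen_choiceMixin (osec U).

Fact osecB_subproof U (s t : osec U) : is_osec (fun x => s x - t x).
Proof.
move=> x; have [V [a [f [Vx sV]]]] := osecP s x.
have [W [b [g [Wx tW]]]] := osecP t x.
exists (openI V W), (g * a - f * b), (f * g); split=> // y [/sV[h ->] /tW[h' ->]].
have [k e] := sfracB h h'; split=> //.
by rewrite -rmorphB e.
Qed.

Fact osecM_subproof U (s t : osec U) : is_osec (fun x => s x * t x).
Proof.
move=> x; have [V [a [f [Vx sV]]]] := osecP s x.
have [W [b [g [Wx tW]]]] := osecP t x.
exists (openI V W), (a * b), (f * g); split=> // y [/sV[h ->] /tW[h' ->]].
have [k e] := sfracM h h'; split=> //.
by rewrite -rmorphM e.
Qed.

Lemma const_frac P (c : K) : is_frac (std_grading K n) P (c%:MP : R^o) 1.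
Proof.
exists 0%N; split; last by rewrite idealr1.
  rewrite /= -[c%:MP_[n.+1]]mulr1 mul_mpolyC; exact/dhomogZ/dhomog1.
exact: dhomog1.
Qed.

Fact osec_const_subproof U (c : K) :
  is_osec (fun x : opt U => local_pi (sval x) (sfrac (sval x) c%:MP 1)).
Proof.
move=> x; exists openT, c%:MP, 1; split=> // y _; split=> //.
exact: const_frac.
Qed.

Definition osec_const U (c : K) : osec U := OSec (osec_const_subproof (U := U) c).
Arguments osec_const : clear implicits.

Lemma osec_const0 U x : osec_const U 0 x = 0.
Proof. by rewrite /= /sfrac mpolyC0 frac0 rmorph0. Qed.

Lemma osec_const1 U x : osec_const U 1 x = 1.
Proof. by rewrite /= mpolyC1 sfrac1 rmorph1. Qed.

Definition osec_sub U (s t : osec U) : osec U := OSec (osecB_subproof s t).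
Definition osec_mul U (s t : osec U) : osec U := OSec (osecM_subproof s t).
Definition osec_opp U (s : osec U) : osec U := osec_sub (osec_const U 0) s.
Definition osec_add U (s t : osec U) : osec U := osec_sub s (osec_opp t).

Lemma osec_oppE U (s : osec U) x : osec_opp s x = - s x.
Proof. by rewrite -[LHS]/(osec_const U 0 x - s x) osec_const0 sub0r. Qed.

Lemma osec_addE U (s t : osec U) x : osec_add s t x = s x + t x.
Proof. by rewrite -[LHS]/(s x - osec_opp t x) osec_oppE opprK. Qed.

Section OsecRing.
Variable U : opens.

Lemma osec_addA : associative (@osec_add U).
Proof. by move=> s t u; apply: osec_ext => x; rewrite !osec_addE addrA. Qed.
Lemma osec_addC : commutative (@osec_add U).
Proof. by move=> s t; apply: osec_ext => x; rewrite !osec_addE addrC. Qed.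
Lemma osec_add0 : left_id (osec_const U 0) (@osec_add U).
Proof. by move=> s; apply: osec_ext => x; rewrite osec_addE osec_const0 add0r. Qed.
Lemma osec_addN : left_inverse (osec_const U 0) (@osec_opp U) (@osec_add U).
Proof.
by move=> s; apply: osec_ext => x; rewrite osec_addE osec_oppE osec_const0 addNr.
Qed.
HB.instance Definition _ := GRing.isZmodule.Build (osec U)
  osec_addA osec_addC osec_add0 osec_addN.

Lemma osec_mulA : associative (@osec_mul U).
Proof. by move=> s t u; apply: osec_ext => x; exact: mulrA. Qed.
Lemma osec_mulC : commutative (@osec_mul U).
Proof. by move=> s t; apply: osec_ext => x; exact: mulrC. Qed.
Lemma osec_mul1 : left_id (osec_const U 1) (@osec_mul U).
Proof.
move=> s; apply: osec_ext => x.
by rewrite -[LHS]/(osec_const U 1 x * s x) osec_const1 mul1r.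
Qed.
Lemma osec_mulDl : left_distributive (@osec_mul U) +%R.
Proof.
move=> s t u; apply: osec_ext => x.
rewrite -[LHS]/(osec_add s t x * u x) [RHS]osec_addE osec_addE.
exact: mulrDl.
Qed.
HB.instance Definition _ := GRing.Zmodule_isComPzRing.Build (osec U)
  osec_mulA osec_mulC osec_mul1 osec_mulDl.

Lemma osecDE (s t : osec U) x : (s + t) x = s x + t x.
Proof. exact: osec_addE. Qed.
Lemma osecNE (s : osec U) x : (- s) x = - s x.
Proof. exact: osec_oppE. Qed.
Lemma osec0E x : (0 : osec U) x = 0.
Proof. exact: osec_const0. Qed.
Lemma osec1E x : (1 : osec U) x = 1.
Proof. exact: osec_const1. Qed.
Lemma osecME (s t : osec U) x : (s * t) x = s x * t x.
Proof. by []. Qed.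

Fact osec_const_zmod : zmod_morphism (osec_const U).
Proof.
move=> c d; apply: osec_ext => x; rewrite osecDE osecNE -rmorphB.
congr (local_pi _ _); have [_ ->] := sfracB (const_frac (sval x) c) (const_frac _ d).
by rewrite !mul1r mpolyCB.
Qed.

Fact osec_const_monoid : monoid_morphism (osec_const U).
Proof.
split; first by [].
move=> c d; apply: osec_ext => x; rewrite osecME -rmorphM.
congr (local_pi _ _); have [_ ->] := sfracM (const_frac (sval x) c) (const_frac _ d).
by rewrite !mul1r mpolyCM.
Qed.

HB.instance Definition _ := GRing.isZmodMorphism.Build K (osec U)
  (osec_const U) osec_const_zmod.
HB.instance Definition _ := GRing.isMonoidMorphism.Build K (osec U)
  (osec_const U) osec_const_monoid.

End OsecRing.

Fact osec_res_subproof U V (h : osub V U) (s : osec U) :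
  is_osec (fun x : opt V => s (opt_incl h x)).
Proof.
move=> x; have [W [a [f [Wx sW]]]] := osecP s (opt_incl h x).
by exists W, a, f; split=> // y Wy; exact: (sW (opt_incl h y)).
Qed.

Definition osec_res U V (h : osub V U) (s : osec U) : osec V :=
  OSec (osec_res_subproof h s).

Fact osec_res_zmod U V (h : osub V U) : zmod_morphism (osec_res h).
Proof.
move=> s t; apply: osec_ext => x; rewrite [RHS]osecDE osecNE.
by rewrite -[LHS]/((s - t) (opt_incl h x)) osecDE osecNE.
Qed.

Fact osec_res_monoid U V (h : osub V U) : monoid_morphism (osec_res h).
Proof.
split; last by move=> s t; exact: osec_ext.
by apply: osec_ext => x; rewrite osec1E -[LHS]/((1 : osec U) (opt_incl h x)) osec1E.
Qed.

HB.instance Definition _ U V (h : osub V U) :=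
  GRing.isZmodMorphism.Build (osec U) (osec V) (osec_res h) (osec_res_zmod h).
HB.instance Definition _ U V (h : osub V U) :=
  GRing.isMonoidMorphism.Build (osec U) (osec V) (osec_res h) (osec_res_monoid h).

(* O_X-modules, without the gluing axiom: it holds for all those used below,  *)
(* and it does not enter the definition of a morphism.                        *)
Record omod := OMod {
  sec :> forall U : opens, lmodType (osec U);
  res : forall U V : opens, osub V U -> sec U -> sec V;
  res_linear : forall U V (h : osub V U) a s t,
    res h (a *: s + t) = osec_res h a *: res h s + res h t;
  res_id : forall U (h : osub U U) s, res h s = s;
  res_comp : forall U V W (h : osub V U) (k : osub W V) (l : osub W U) s,
    res k (res h s) = res l s }.

Fact osec_res_linear U V (h : osub V U) (a s t : (osec U)^o) :
  osec_res h (a *: s + t) = osec_res h a *: (osec_res h s : (osec V)^o) + osec_res h t.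
Proof. by rewrite rmorphD rmorphM. Qed.

Lemma opt_eq (U : opens) (x y : opt U) : sval x = sval y -> x = y.
Proof.
case: x y => [x xU] [y yU] /= e; case: y / e yU => yU.
by congr exist; exact: Prop_irrelevance.
Qed.

Fact osec_res_id U (h : osub U U) (s : osec U) : osec_res h s = s.
Proof.
apply: osec_ext => -[x Ux]; rewrite /= /opt_incl /=.
by rewrite (Prop_irrelevance (h _ _) Ux).
Qed.

Fact osec_res_comp U V W (h : osub V U) (k : osub W V) (l : osub W U) (s : osec U) :
  osec_res k (osec_res h s) = osec_res l s.
Proof.
apply: osec_ext => -[x Wx]; rewrite /= /opt_incl /=.
by move: (h _ _) (l _ _) => p q; rewrite (Prop_irrelevance p q).
Qed.

Definition structure_sheaf : omod :=
  @OMod (fun U => (osec U)^o) osec_res osec_res_linear osec_res_id osec_res_comp.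

Section SheafHom.

Variables F G : omod.

(* Morphisms of O_X|U-modules F|U -> G|U *)
Record hom_on (U : opens) := HomOn {
  hom_fun :> forall V : opens, osub V U -> F V -> G V;
  hom_linear : forall V (h : osub V U) a s t,
    hom_fun h (a *: s + t) = a *: hom_fun h s + hom_fun h t;
  hom_natural : forall V W (h : osub V U) (k : osub W V) (l : osub W U) s,
    res k (hom_fun h s) = hom_fun l (res k s) }.

Lemma hom_ext U (f g : hom_on U) :
  (forall V (h : osub V U) s, f V h s = g V h s) -> f = g.
Proof.
case: f g => [f fl fn] [g gl gn] /= fg.
have e : f = g.
  apply: functional_extensionality_dep => V.
  apply: functional_extensionality_dep => h; exact: functional_extensionality_dep.
by case: g / e gl gn fg => gl gn _; congr HomOn; exact: Prop_irrelevance.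
Qed.

HB.instance Definition _ U := gen_eqMixin (hom_on U).
HB.instance Definition _ U := gen_choiceMixin (hom_on U).

Lemma resD (E : omod) U V (h : osub V U) (s t : E U) : res h (s + t) = res h s + res h t.
Proof. by have := res_linear h 1 s t; rewrite rmorph1 !scale1r. Qed.

Lemma res0 (E : omod) U V (h : osub V U) : res h (0 : E U) = 0.
Proof. by apply: (addrI (res h 0)); rewrite -resD !addr0. Qed.

Lemma resZ (E : omod) U V (h : osub V U) a (s : E U) :
  res h (a *: s) = osec_res h a *: res h s.
Proof. by have := res_linear h a s 0; rewrite !addr0 res0 addr0. Qed.

Section HomModule.
Variable U : opens.

Program Definition hom_zero : hom_on U := @HomOn U (fun V h s => 0) _ _.
Next Obligation. by rewrite scaler0 addr0. Qed.
Next Obligation. by rewrite res0. Qed.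

Program Definition hom_add (f g : hom_on U) : hom_on U :=
  @HomOn U (fun V h s => f V h s + g V h s) _ _.
Next Obligation. by rewrite !hom_linear scalerDr addrACA. Qed.
Next Obligation. by rewrite resD !(hom_natural _ h k l). Qed.

Program Definition hom_scale (c : osec U) (f : hom_on U) : hom_on U :=
  @HomOn U (fun V h s => osec_res h c *: f V h s) _ _.
Next Obligation. by rewrite hom_linear scalerDr !scalerA mulrC. Qed.
Next Obligation. by rewrite resZ (hom_natural _ h k l) (osec_res_comp h k l). Qed.

Definition hom_opp (f : hom_on U) : hom_on U := hom_scale (-1) f.

Lemma hom_addA : associative hom_add.
Proof. by move=> f g k; apply: hom_ext => V h s; rewrite /= addrA. Qed.
Lemma hom_addC : commutative hom_add.
Proof. by move=> f g; apply: hom_ext => V h s; rewrite /= addrC. Qed.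
Lemma hom_add0 : left_id hom_zero hom_add.
Proof. by move=> f; apply: hom_ext => V h s; rewrite /= add0r. Qed.
Lemma hom_addN : left_inverse hom_zero hom_opp hom_add.
Proof.
by move=> f; apply: hom_ext => V h s; rewrite /= rmorphN1 scaleN1r addNr.
Qed.
HB.instance Definition _ := GRing.isZmodule.Build (hom_on U)
  hom_addA hom_addC hom_add0 hom_addN.

Lemma hom_scaleA a b f : hom_scale a (hom_scale b f) = hom_scale (a * b) f.
Proof. by apply: hom_ext => V h s; rewrite /= rmorphM scalerA. Qed.
Lemma hom_scale1 : left_id 1 hom_scale.
Proof. by move=> f; apply: hom_ext => V h s; rewrite /= rmorph1 scale1r. Qed.
Lemma hom_scaleDr : right_distributive hom_scale +%R.
Proof. by move=> a f g; apply: hom_ext => V h s; rewrite /= scalerDr. Qed.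
Lemma hom_scaleDl f : {morph hom_scale^~ f : a b / a + b}.
Proof. by move=> a b; apply: hom_ext => V h s; rewrite /= rmorphD scalerDl. Qed.
HB.instance Definition _ := GRing.Zmodule_isLmodule.Build (osec U) (hom_on U)
  hom_scaleA hom_scale1 hom_scaleDr hom_scaleDl.

End HomModule.

Definition hom_res U V (h : osub V U) (f : hom_on U) : hom_on V :=
  @HomOn V (fun W k s => f W (osub_trans k h) s)
    (fun W k a s t => hom_linear f (osub_trans k h) a s t)
    (fun W Y k l m s => hom_natural f (osub_trans k h) l (osub_trans m h) s).

Fact hom_res_linear U V (h : osub V U) a s t :
  hom_res h (a *: s + t) = osec_res h a *: hom_res h s + hom_res h t.
Proof.
apply: hom_ext => W k v /=.
by rewrite -(osec_res_comp h k (osub_trans k h)).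
Qed.

Fact hom_res_id U (h : osub U U) f : hom_res h f = f.
Proof.
apply: hom_ext => W k v /=.
by rewrite (Prop_irrelevance (osub_trans k h) k).
Qed.

Fact hom_res_comp U V W (h : osub V U) (k : osub W V) (l : osub W U) f :
  hom_res k (hom_res h f) = hom_res l f.
Proof.
apply: hom_ext => Y m v /=.
by rewrite (Prop_irrelevance (osub_trans _ h) (osub_trans m l)).
Qed.

Definition sheaf_hom : omod :=
  @OMod (fun U => hom_on U) hom_res hom_res_linear hom_res_id hom_res_comp.

Definition Hom_OX : lmodType K := rscal (osec_const openT) (hom_on openT).

End SheafHom.

Definition iso_on (U : opens) (F G : omod) : Prop :=
  exists (f : hom_on F G U) (g : hom_on G F U),
    forall V (h : osub V U), cancel (f V h) (g V h) /\ cancel (g V h) (f V h).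

Definition invertible_off (Z : sub_pt -> Prop) (F : omod) : Prop :=
  forall x, ~ Z x -> exists U : opens,
    [/\ U x, forall y, U y -> ~ Z y & iso_on U F structure_sheaf].

(* Data for a sheaf of germs T x that are locally given by fractions m / f,   *)
(* with m in a subset of a module and f a form of the same degree.            *)
Record germs := Germs {
  g_stalk : forall x : sub_pt, lmodType (local_ring x);
  g_mod : lmodType R;
  g_num : int -> g_mod -> Prop;
  g_germ : forall x : sub_pt, g_mod -> R -> g_stalk x;
  g_frac := fun (x : sub_pt) m f => exists d : nat,
    [/\ g_num d m, f \is d.-homog & f \notin (x : prime_idealr R)];
  g_zero : forall x : sub_pt, g_frac x 0 1 /\ g_germ x 0 1 = 0;
  g_sub : forall (x : sub_pt) m f m' f', g_frac x m f -> g_frac x m' f' ->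
    g_frac x (f' *: m - f *: m') (f * f') /\
    g_germ x m f - g_germ x m' f' = g_germ x (f' *: m - f *: m') (f * f');
  g_scale : forall (x : sub_pt) (a b : R) m f,
    is_frac (std_grading K n) x (a : R^o) b -> g_frac x m f ->
    g_frac x (a *: m) (b * f) /\
    local_pi x (sfrac x a b) *: g_germ x m f = g_germ x (a *: m) (b * f) }.

Section GermSheaf.

Variable T : germs.

Definition is_gsec (U : opens) (s : forall x : opt U, g_stalk T (sval x)) : Prop :=
  forall x : opt U, exists (V : opens) (m : g_mod T) (f : R), V (sval x) /\
    forall y : opt U, V (sval y) ->
      g_frac (sval y) m f /\ s y = g_germ (sval y) m f.

Record gsec (U : opens) := GSec {
  gsec_fun :> forall x : opt U, g_stalk T (sval x);
  gsecP : is_gsec gsec_fun }.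

Lemma gsec_ext U (s t : gsec U) : (forall x, s x = t x) -> s = t.
Proof.
case: s t => [s sP] [t tP] /= st.
have e : s = t by apply: functional_extensionality_dep.
by case: t / e tP st => tP _; congr GSec; exact: Prop_irrelevance.
Qed.

HB.instance Definition _ U := gen_eqMixin (gsec U).
HB.instance Definition _ U := gen_choiceMixin (gsec U).

Section GsecModule.
Variable U : opens.

Fact gsec0_subproof : is_gsec (fun x : opt U => 0).
Proof.
move=> x; exists openT, 0, 1; split=> // y _.
by have [h ->] := g_zero T (sval y).
Qed.

Fact gsecB_subproof (s t : gsec U) : is_gsec (fun x => s x - t x).
Proof.
move=> x; have [V [a [f [Vx sV]]]] := gsecP s x.
have [W [b [g [Wx tW]]]] := gsecP t x.
exists (openI V W), (g *: a - f *: b), (f * g).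
split=> // y [/sV[h ->] /tW[h' ->]].
exact: g_sub.
Qed.

Fact gsecZ_subproof (c : osec U) (s : gsec U) : is_gsec (fun x => c x *: s x).
Proof.
move=> x; have [V [a [f [Vx sV]]]] := osecP c x.
have [W [b [g [Wx tW]]]] := gsecP s x.
exists (openI V W), (a *: b), (f * g).
split=> // y [/sV[h ->] /tW[h' ->]].
exact: g_scale.
Qed.

Definition gsec_zero : gsec U := GSec gsec0_subproof.
Definition gsec_sub (s t : gsec U) : gsec U := GSec (gsecB_subproof s t).
Definition gsec_opp (s : gsec U) : gsec U := gsec_sub gsec_zero s.
Definition gsec_add (s t : gsec U) : gsec U := gsec_sub s (gsec_opp t).
Definition gsec_scale (c : osec U) (s : gsec U) : gsec U :=
  GSec (gsecZ_subproof c s).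

Lemma gsec_addE s t x : gsec_add s t x = s x + t x.
Proof. by rewrite /= sub0r opprK. Qed.

Lemma gsec_addA : associative gsec_add.
Proof. by move=> s t u; apply: gsec_ext => x; rewrite !gsec_addE addrA. Qed.
Lemma gsec_addC : commutative gsec_add.
Proof. by move=> s t; apply: gsec_ext => x; rewrite !gsec_addE addrC. Qed.
Lemma gsec_add0 : left_id gsec_zero gsec_add.
Proof. by move=> s; apply: gsec_ext => x; rewrite gsec_addE add0r. Qed.
Lemma gsec_addN : left_inverse gsec_zero gsec_opp gsec_add.
Proof. by move=> s; apply: gsec_ext => x; rewrite gsec_addE /= sub0r addNr. Qed.
HB.instance Definition _ := GRing.isZmodule.Build (gsec U)
  gsec_addA gsec_addC gsec_add0 gsec_addN.

Lemma gsecDE (s t : gsec U) x : (s + t) x = s x + t x.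
Proof. exact: gsec_addE. Qed.

Lemma gsec_scaleA a b s : gsec_scale a (gsec_scale b s) = gsec_scale (a * b) s.
Proof. by apply: gsec_ext => x; rewrite /= scalerA. Qed.
Lemma gsec_scale1 : left_id 1 gsec_scale.
Proof.
move=> s; apply: gsec_ext => x.
by rewrite -[LHS]/((1 : osec U) x *: s x) osec1E scale1r.
Qed.
Lemma gsec_scaleDr : right_distributive gsec_scale +%R.
Proof.
move=> a s t; apply: gsec_ext => x.
by rewrite -[LHS]/(a x *: (s + t) x) !gsecDE scalerDr.
Qed.
Lemma gsec_scaleDl s : {morph gsec_scale^~ s : a b / a + b}.
Proof.
move=> a b; apply: gsec_ext => x.
by rewrite -[LHS]/((a + b) x *: s x) gsecDE osecDE scalerDl.
Qed.
HB.instance Definition _ := GRing.Zmodule_isLmodule.Build (osec U) (gsec U)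
  gsec_scaleA gsec_scale1 gsec_scaleDr gsec_scaleDl.

Lemma gsecZE (a : osec U) (s : gsec U) x : (a *: s) x = a x *: s x.
Proof. by []. Qed.

End GsecModule.

Fact gsec_res_subproof U V (h : osub V U) (s : gsec U) :
  is_gsec (fun x : opt V => s (opt_incl h x)).
Proof.
move=> x; have [W [a [f [Wx sW]]]] := gsecP s (opt_incl h x).
by exists W, a, f; split=> // y Wy; exact: (sW (opt_incl h y)).
Qed.

Definition gsec_res U V (h : osub V U) (s : gsec U) : gsec V :=
  GSec (gsec_res_subproof h s).

Fact gsec_res_linear U V (h : osub V U) a (s t : gsec U) :
  gsec_res h (a *: s + t) = osec_res h a *: gsec_res h s + gsec_res h t.
Proof.
apply: gsec_ext => x; rewrite [RHS]gsecDE.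
by rewrite -[LHS]/((a *: s + t) (opt_incl h x)) gsecDE.
Qed.

Fact gsec_res_id U (h : osub U U) (s : gsec U) : gsec_res h s = s.
Proof.
apply: gsec_ext => -[x Ux]; rewrite /= /opt_incl /=.
by rewrite (Prop_irrelevance (h _ _) Ux).
Qed.

Fact gsec_res_comp U V W (h : osub V U) (k : osub W V) (l : osub W U) (s : gsec U) :
  gsec_res k (gsec_res h s) = gsec_res l s.
Proof.
apply: gsec_ext => -[x Wx]; rewrite /= /opt_incl /=.
by move: (h _ _) (l _ _) => p q; rewrite (Prop_irrelevance p q).
Qed.

Definition germ_sheaf : omod :=
  @OMod (fun U => gsec U) gsec_res gsec_res_linear gsec_res_id gsec_res_comp.

End GermSheaf.

Lemma stalk_idealP (x : sub_pt) (a f : R) :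
  is_frac (std_grading K n) x (a : R^o) f -> a \in (X : idealr R) ->
  sfrac x a f \in stalk_idealr x.
Proof.
by move=> h aX; apply/asboolP; exists (HFrac h); split=> //; exact: fracE.
Qed.

(* The conormal sheaf I_X / I_X^2: its stalk at x is J / J^2 for J the stalk  *)
(* of I_X, and its local sections are the classes of the local sections a / f *)
(* of I_X, with a in the ideal of X.                                          *)
Section ConormalSheaf.

Let num (d : int) (a : R^o) : Prop := std_comp d a /\ (a : R) \in (X : idealr R).
Let germ (x : sub_pt) (a : R^o) (f : R) : conormal (stalk_idealr x) :=
  conormal_class _ (sfrac x a f).
Let cfrac (x : sub_pt) (m : R^o) (f : R) : Prop := exists d : nat,
  [/\ num d m, f \is d.-homog & f \notin (x : prime_idealr R)].

Let cfracP x m f : cfrac x m f <->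
  is_frac (std_grading K n) x m f /\ (m : R) \in (X : idealr R).
Proof.
split; first by move=> [d [[md mX] fd fx]]; split=> //; exists d.
by move=> [[d [md fd fx]] mX]; exists d.
Qed.

Fact conormal_zero (x : sub_pt) : cfrac x 0 1 /\ germ x 0 1 = 0.
Proof.
split; first by apply/cfracP; split; [exact: hfrac0_subproof | exact: idealr0].
by rewrite /germ /sfrac frac0 conormal_class0.
Qed.

Fact conormal_sub (x : sub_pt) (m : R^o) f (m' : R^o) f' :
  cfrac x m f -> cfrac x m' f' -> cfrac x (f' *: m - f *: m') (f * f') /\
  germ x m f - germ x m' f' = germ x (f' *: m - f *: m') (f * f').
Proof.
move=> /cfracP[h mX] /cfracP[h' mX']; have [k e] := sfracB h h'; split.
  by apply/cfracP; split=> //; apply: rpredB; exact: idealMr.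
by rewrite /germ -e conormal_classB //; exact: stalk_idealP.
Qed.

Fact conormal_frac_scale (x : sub_pt) (a b : R) (m : R^o) f :
  is_frac (std_grading K n) x (a : R^o) b -> cfrac x m f ->
  cfrac x (a *: m) (b * f) /\
  local_pi x (sfrac x a b) *: germ x m f = germ x (a *: m) (b * f).
Proof.
move=> h /cfracP[h' mX]; have [k e] := sfracM h h'; split.
  by apply/cfracP; split=> //; exact: idealMr.
by rewrite /germ -e -conormal_classZ //; exact: stalk_idealP.
Qed.

Definition conormal_sheaf : omod :=
  germ_sheaf (Germs (g_stalk := fun x => conormal (stalk_idealr x))
    conormal_zero conormal_sub conormal_frac_scale).

End ConormalSheaf.

(* The sheaf on X associated with a graded module over the coordinate ring.   *)
Section Tilde.

Variables (L : lmodType coord_ring) (g : grading (rscal coord_pi L)).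

Fact stalk_ideal_kills (x : sub_pt) (a : stalk x) (v : hloc g x) :
  a \in stalk_idealr x -> a *: v = 0.
Proof.
move=> /asboolP[u [uX ->]]; have [w ->] := hloc_surj v.
rewrite [LHS]hloc_scaleE; apply: hloc_eq1 => /=.
rewrite scaler0 scale1r -[LHS]/(coord_pi (fnum u) *: (fnum w : L)).
suff -> : coord_pi (fnum u) = 0 by rewrite scale0r.
rewrite -(rmorph0 coord_pi); apply/eqP; rewrite /= -Quotient.idealrBE.
by rewrite subr0.
Qed.

Definition tilde_stalk (x : sub_pt) : lmodType (local_ring x) :=
  qmod (stalk_ideal_kills (x := x)).

Fact tilde_zero (x : sub_pt) :
  is_frac g x 0 1 /\ (frac g x 0 1 : tilde_stalk x) = 0.
Proof. by split; [exact: hfrac0_subproof | exact: frac0]. Qed.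

Fact tilde_scale (x : sub_pt) (a b : R) m f :
  is_frac (std_grading K n) x (a : R^o) b -> is_frac g x m f ->
  is_frac g x (a *: m) (b * f) /\
  local_pi x (sfrac x a b) *: (frac g x m f : tilde_stalk x)
    = frac g x (a *: m) (b * f).
Proof.
move=> h h'; have [k e] := fracZ h h'; split=> //.
by rewrite [LHS]qmod_scaleE.
Qed.

Definition tilde : omod :=
  germ_sheaf (Germs (g_stalk := tilde_stalk) tilde_zero
    (fun x m f m' f' => @fracB K n _ g x m f m' f') tilde_scale).

End Tilde.

Section ConormalGrading.

Local Notation C := (rscal coord_pi (conormal X)).

Definition conormal_comp (d : int) (q : C) : Prop := exists a : R,
  [/\ a \in (X : idealr R), std_comp d a & q = conormal_class X a].

Fact conormal_comp0 d : conormal_comp d 0.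
Proof.
exists 0; rewrite idealr0 conormal_class0; split=> //; exact: std_comp0.
Qed.

Fact conormal_compB d u v :
  conormal_comp d u -> conormal_comp d v -> conormal_comp d (u - v).
Proof.
move=> [a [aX ad ->]] [b [bX bd ->]]; exists (a - b); split.
- exact: rpredB.
- exact: std_compB.
- by rewrite conormal_classB.
Qed.

Fact conormal_compZ (d : int) (e : nat) (a : R) (u : C) :
  a \is e.-homog -> conormal_comp d u -> conormal_comp (d + e%:Z) (a *: u).
Proof.
move=> ae [b [bX bd ->]]; exists (a * b); split; first exact: idealMr.
  exact: (@std_compZ K n d e a b).
by rewrite [LHS]conormal_classZ.
Qed.

Lemma conormal_class_sum (I : Type) (s : seq I) (F : I -> R) :
  (forall i, F i \in (X : idealr R)) ->
  conormal_class X (\sum_(i <- s) F i) = \sum_(i <- s) conormal_class X (F i).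
Proof.
move=> FX; elim: s => [|i s IHs]; first by rewrite !big_nil conormal_class0.
by rewrite !big_cons -IHs conormal_classD // rpred_sum.
Qed.

Fact conormal_comp_sum (u : C) : exists (s : seq int) (c : int -> C),
  (forall d, conormal_comp d (c d)) /\ u = \sum_(d <- s) c d.
Proof.
have [[a aX] ->] := conormal_surj (u : conormal X).
have [s [c [hc ac]]] := std_comp_sum (a : R^o).
pose b (d : int) : R := if d is Posz e then pihomog mdeg e a else 0.
have bX d : b d \in (X : idealr R).
  by case: d => d; [exact: sub_homog | exact: idealr0].
exists (map Posz (index_iota 0 (mmeasure mdeg a))), (fun d => conormal_class X (b d)).
split.
  move=> d; exists (b d); split=> //.
  by case: d => d //=; exact: pihomogP.
rewrite -[RHS](conormal_class_sum _ bX) big_map big_mkord.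
rewrite -(@pihomog_partitionE _ _ mdeg _ a (leqnn _)).
by congr conormal_pi; apply: val_inj; rewrite insubdK.
Qed.

Lemma sq_ideal_sum (I : Type) (s : seq I) (F : I -> R) :
  (forall i, sq_ideal X (F i)) -> sq_ideal X (\sum_(i <- s) F i).
Proof.
move=> h; elim/big_rec: _ => [|i a _ ha]; first exact: sq_ideal0.
exact: sq_idealD.
Qed.

Lemma sq_ideal_homog (a : R) e : sq_ideal X a -> sq_ideal X (pihomog mdeg e a).
Proof.
move=> [s [sX ->]]; rewrite raddf_sum /= big_seq.
elim/big_rec: _ => [|[b c] v /sX/=[bX cX] hv]; first exact: sq_ideal0.
apply: sq_idealD hv.
rewrite (@pihomog_partitionE _ _ mdeg _ b (leqnn _)).
rewrite (@pihomog_partitionE _ _ mdeg _ c (leqnn _)).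
rewrite mulr_suml raddf_sum /=; apply: sq_ideal_sum => i.
rewrite mulr_sumr raddf_sum /=; apply: sq_ideal_sum => j.
have hij : pihomog mdeg i b * pihomog mdeg j c \is (i + j).-homog.
  by apply: dhomogM; exact: pihomogP.
have [<-|/eqP ne] := eqVneq (i + j)%N e.
  by rewrite pihomog_dE //; apply: sq_idealM; exact: sub_homog.
by rewrite (pihomog_ne0 _ hij); [exact: sq_ideal0 | exact/eqP].
Qed.

Fact conormal_comp_direct (s : seq int) (c : int -> C) : uniq s ->
  (forall d, conormal_comp d (c d)) -> \sum_(d <- s) c d = 0 ->
  forall d, d \in s -> c d = 0.
Proof.
move=> us /choice[b hb] sum0 d ds.
have bX i : b i \in (X : idealr R) by have [] := hb i.
have [_ bd cd] := hb d; rewrite cd.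
suff : sq_ideal X (b d).
  move=> h; rewrite -conormal_class0; apply/conormal_piP.
  by rewrite !insubdK ?idealr0 // ?subr0 // -topredE /= idealr0.
have : sq_ideal X (\sum_(i <- s) b i).
  have : conormal_class X (\sum_(i <- s) b i) = conormal_class X 0.
    rewrite conormal_class_sum // conormal_class0 -[RHS]sum0.
    by apply: eq_bigr => i _; have [_ _ ->] := hb i.
  move/conormal_piP; rewrite !insubdK ?subr0 //; first by rewrite -topredE /= idealr0.
  by rewrite -topredE /= rpred_sum.
case: d ds bd cd => [e|e] ds bd cd; last by move=> _; rewrite bd; exact: sq_ideal0.
move/(sq_ideal_homog e); rewrite raddf_sum /= (bigD1_seq (Posz e)) //=.
rewrite (std_comp_pi bd) eqxx big1 ?addr0 // => i /negPf ie.
by have [_ bi _] := hb i; rewrite (std_comp_pi bi) ie.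
Qed.

Definition conormal_grading : grading C :=
  Grading conormal_comp0 conormal_compB conormal_compZ conormal_comp_sum
    conormal_comp_direct.

End ConormalGrading.

Section GradedHom.

Variables (M N : lmodType coord_ring).
Variables (gM : grading (rscal coord_pi M)) (gN : grading (rscal coord_pi N)).

Record ghom0 := GHom0 {
  ghom_fun :> M -> N;
  ghom_linear : forall a u v, ghom_fun (a *: u + v) = a *: ghom_fun u + ghom_fun v;
  ghom_degree : forall d u, gM d u -> gN d (ghom_fun u) }.

Lemma ghom_ext (f g : ghom0) : (forall u, f u = g u) -> f = g.
Proof.
case: f g => [f fl fd] [g gl gd] /= fg.
have e : f = g by apply: functional_extensionality_dep.
by case: g / e gl gd fg => gl gd _; congr GHom0; exact: Prop_irrelevance.
Qed.

HB.instance Definition _ := gen_eqMixin ghom0.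
HB.instance Definition _ := gen_choiceMixin ghom0.

Program Definition ghom_zero : ghom0 := @GHom0 (fun=> 0) _ _.
Next Obligation. by rewrite scaler0 addr0. Qed.
Next Obligation. exact: gcomp0. Qed.

Program Definition ghom_sub (f g : ghom0) : ghom0 := @GHom0 (fun u => f u - g u) _ _.
Next Obligation. by rewrite !ghom_linear scalerBr opprD addrACA. Qed.
Next Obligation. by apply: gcompB; exact: ghom_degree. Qed.

Program Definition ghom_scale (c : K) (f : ghom0) : ghom0 :=
  @GHom0 (fun u => coord_pi c%:MP *: f u) _ _.
Next Obligation. by rewrite ghom_linear scalerDr !scalerA mulrC. Qed.
Next Obligation.
rewrite -[d]addr0; apply: (@gcompZ _ _ _ gN d 0 c%:MP (f u)).
  rewrite -[c%:MP_[n.+1]]mulr1 mul_mpolyC; exact/dhomogZ/dhomog1.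
exact: ghom_degree.
Qed.

Definition ghom_opp f := ghom_sub ghom_zero f.
Definition ghom_add f g := ghom_sub f (ghom_opp g).

Lemma ghom_addE f g u : ghom_add f g u = f u + g u.
Proof. by rewrite /= sub0r opprK. Qed.

Lemma ghom_addA : associative ghom_add.
Proof. by move=> f g h; apply: ghom_ext => u; rewrite !ghom_addE addrA. Qed.
Lemma ghom_addC : commutative ghom_add.
Proof. by move=> f g; apply: ghom_ext => u; rewrite !ghom_addE addrC. Qed.
Lemma ghom_add0 : left_id ghom_zero ghom_add.
Proof. by move=> f; apply: ghom_ext => u; rewrite ghom_addE add0r. Qed.
Lemma ghom_addN : left_inverse ghom_zero ghom_opp ghom_add.
Proof. by move=> f; apply: ghom_ext => u; rewrite ghom_addE /= sub0r addNr. Qed.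
HB.instance Definition _ := GRing.isZmodule.Build ghom0
  ghom_addA ghom_addC ghom_add0 ghom_addN.

Lemma ghomDE (f g : ghom0) u : (f + g) u = f u + g u.
Proof. exact: ghom_addE. Qed.

Lemma ghom_scaleA a b f : ghom_scale a (ghom_scale b f) = ghom_scale (a * b) f.
Proof. by apply: ghom_ext => u; rewrite /= scalerA -rmorphM -mpolyCM. Qed.
Lemma ghom_scale1 : left_id 1 ghom_scale.
Proof. by move=> f; apply: ghom_ext => u; rewrite /= mpolyC1 rmorph1 scale1r. Qed.
Lemma ghom_scaleDr : right_distributive ghom_scale +%R.
Proof.
move=> a f g; apply: ghom_ext => u.
by rewrite ghomDE -[LHS]/(coord_pi a%:MP *: (f + g) u) ghomDE scalerDr.
Qed.
Lemma ghom_scaleDl f : {morph ghom_scale^~ f : a b / a + b}.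
Proof.
move=> a b; apply: ghom_ext => u.
by rewrite ghomDE /= mpolyCD rmorphD scalerDl.
Qed.
HB.instance Definition _ := GRing.Zmodule_isLmodule.Build K ghom0
  ghom_scaleA ghom_scale1 ghom_scaleDr ghom_scaleDl.

End GradedHom.

(* k is the length of some chain of irreducible closed subsets of projective  *)
(* space starting at the closure of P.                                        *)
Definition chain_at (P : proj_pt) (k : nat) : Prop := exists q : nat -> proj_pt,
  q k = P /\ forall i, (i < k)%N ->
    (forall a, pt_set (q i) a -> pt_set (q i.+1) a) /\
    exists a, pt_set (q i.+1) a && ~~ pt_set (q i) a.

(* codim(X, P^n): the minimum over x in X of the maximal length of a chain.   *)
Definition codim_is (c : nat) : Prop :=
  (forall x : sub_pt, chain_at x c) /\ exists x : sub_pt, ~ chain_at x c.+1.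

(* The open complement of Z in X is a local complete intersection in P^n.     *)
Definition lci_off (Z : sub_pt -> Prop) : Prop :=
  forall x : sub_pt, ~ Z x -> exists s : seq (stalk x),
    regular_seq (stalk x)^o s /\
    forall z : stalk x, z \in stalk_idealr x <-> span_mod s (z : (stalk x)^o).

(* The first conjunct only matters when Z is empty.                           *)
Definition ideal_of (Z : sub_pt -> Prop) (f : R) : Prop :=
  f@_0%MM = 0 /\ forall x, Z x -> f \in (x : prime_idealr R).

Definition depth_ge (J : R -> Prop) (N : lmodType coord_ring) (k : nat) : Prop :=
  exists d, depth_is J (rscal coord_pi N) d /\ (k <= d)%N.

(* A minimal free graded resolution ... -> F_2 -> F_1 -> R -> R / I -> 0, with *)
(* F_{k+1} the direct sum of the R(- fr_shift k i). Maps act on row vectors.   *)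
Record min_free_res := MinFreeRes {
  fr_rank : nat -> nat;
  fr_shift : forall k, 'I_(fr_rank k) -> int;
  fr_gen : 'cV[R]_(fr_rank 0);
  fr_map : forall k, 'M[R]_(fr_rank k.+1, fr_rank k);
  fr_gen_homog : forall i, std_comp (fr_shift i) (fr_gen i 0);
  fr_map_homog : forall k i j,
    std_comp (fr_shift i - fr_shift j) (fr_map k i j);
  fr_gen_ideal : forall a : R, a \in (X : idealr R) <->
    exists v : 'rV[R]_(fr_rank 0), a = (v *m fr_gen) 0 0;
  fr_exact0 : forall v : 'rV[R]_(fr_rank 0), v *m fr_gen = 0 <->
    exists w : 'rV[R]_(fr_rank 1), v = w *m fr_map 0;
  fr_exact : forall k (v : 'rV[R]_(fr_rank k.+1)), v *m fr_map k = 0 <->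
    exists w : 'rV[R]_(fr_rank k.+2), v = w *m fr_map k.+1;
  fr_gen_min : forall i, (fr_gen i 0)@_0%MM = 0;
  fr_map_min : forall k i j, (fr_map k i j)@_0%MM = 0 }.

End Geometry.

Arguments conormal_sheaf {K n} X.
Arguments conormal_grading {K n} X.
Arguments coord_ring {K n} X.
Arguments coord_pi {K n} X.
Arguments codim_is {K n} X c.
Arguments min_free_res {K n} X.

(* N_X(L) *)
Definition twisted_normal_sheaf (K : fieldType) (n : nat) (X : subscheme K n)
    (L : lmodType (coord_ring X)) (gL : grading (rscal (coord_pi X) L)) : omod X :=
  sheaf_hom (conormal_sheaf X) (tilde gL).

(* Main.v *)
(* Both spaces are shown to consist of the scalars K.

   Graded endomorphisms of I / I^2.  Let f_i be the minimal generators of I, of degree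
   n_1i, and let phi be a graded endomorphism.  Lift phi(f_i) to h_i in I of degree n_1i.
   Every relation sum_i w_i f_i = 0 yields sum_i w_i h_i in I^2, of degree some n_2j; as I^2
   vanishes in degrees below 2 min n_1i, the sum is 0, so f_i |-> h_i extends to an
   endomorphism Phi of I.  Then a Phi(b) = b Phi(a) for all a, b in I.  In the least degree
   of I, Phi has an eigenvector a, since K is algebraically closed, and Phi(a) = k a forces
   Phi = k.

   Endomorphisms psi of N_X(L) = Hom(C, L~), where C is the conormal sheaf.  Outside Z the
   sheaf C is locally free, because I_X is generated by a regular sequence, and L~ is
   invertible, so locally psi is dual to a unique endomorphism chi of C.  Because
   depth_{I(Z)} I / I^2 >= 2, the sections chi(f_i) outside Z come from elements of
   I / I^2: by compactness finitely many fractions h / g describe chi(f_i), and a Cech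
   argument with the regular sequence glues them.  So chi comes from a graded endomorphism
   of I / I^2 and is a scalar.  Sections of L~ are determined outside Z, since I(Z) contains
   a regular element on L, so psi is the same scalar. *)

From HB Require Import structures.
Require Import Defs.
From mathcomp Require Import all_boot all_order all_algebra.
From mathcomp Require Import boolp mpoly ring zify.
From mathcomp Require classical_sets.

Set Implicit Arguments.
Unset Strict Implicit.
Unset Printing Implicit Defensive.

Import Order.TTheory GRing.Theory Num.Theory.
Local Open Scope ring_scope.

(** * Graded ideals and the projective Nullstellensatz *)

Section HomogeneousComponents.

Variables (K : fieldType) (n : nat).
Local Notation R := {mpoly K[n.+1]}.
Implicit Types (a b : R) (d e : nat).

(** The endomorphism chi is never built as a morphism of sheaves, since it is known only outside Z.
    It is replaced by the relation [dual_image psi e e'], that is psi(eps)(e) = eps(e') for all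
    local morphisms eps from C to L~, which makes sense over every open set. Outside Z a local dual
    basis gives existence and uniqueness of e'. Across Z neither is available at first; the relation
    gets there because its two sides are sections of L~, so that it need only be tested where a
    regular element of I(Z) is nonzero. Points are homogeneous primes, and each passage from a
    condition at every point to one power of an element is the Nullstellensatz, applied to a colon
    ideal, an annihilator or an ideal generated by denominators. The rule a Phi(b) = b Phi(a) is
    linearity over R, both sides being Phi(ab); the eigenvector a then cancels because R is a
    domain. *)

Lemma pihomogMl e d a b : a \is e.-homog ->
  pihomog mdeg (e + d) (a * b) = a * pihomog mdeg d b.
Proof.
move=> ae; rewrite {1}(@pihomog_partitionE _ _ mdeg _ b (leqnn _)).
rewrite [in RHS](@pihomog_partitionE _ _ mdeg _ b (leqnn _)).
rewrite mulr_sumr !raddf_sum mulr_sumr; apply: eq_bigr => i _ /=.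
have hi := pihomogP mdeg i b; have hai := dhomogM ae hi.
have [<-|ne] := eqVneq (nat_of_ord i) d; first by rewrite (pihomog_dE hai) (pihomog_dE hi).
by rewrite (pihomog_ne0 _ hai) ?eqn_add2l // (pihomog_ne0 ne hi) mulr0.
Qed.

Lemma pihomogMl_lt e d a b : a \is e.-homog -> (d < e)%N ->
  pihomog mdeg d (a * b) = 0.
Proof.
move=> ae de; rewrite (@pihomog_partitionE _ _ mdeg _ b (leqnn _)).
rewrite mulr_sumr raddf_sum big1 // => i _ /=.
have hi := pihomogP mdeg i b; rewrite (pihomog_ne0 _ (dhomogM ae hi)) //.
by rewrite gtn_eqF // ltn_addr.
Qed.

Lemma linear_form_homogX (l : R) k : l \is 1.-homog -> l ^+ k \is k.-homog.
Proof. by move=> l1; rewrite -{2}[k]mul1n; exact: dhomogMn. Qed.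

(** Ideals are [Prop]-valued here and may be the unit ideal, unlike [idealr]: colon ideals,
    annihilators and ideals generated by denominators are all of this kind. *)
Definition graded_ideal (J : R -> Prop) : Prop :=
  [/\ J 0, forall a b, J a -> J b -> J (a + b), forall c a, J a -> J (c * a)
    & forall a d, J a -> J (pihomog mdeg d a)].

Lemma graded_ideal_sum J (T : Type) (s : seq T) (P : pred T) (F : T -> R) :
  graded_ideal J -> (forall i, P i -> J (F i)) -> J (\sum_(i <- s | P i) F i).
Proof. by move=> [J0 JD _ _] JF; elim/big_rec: _ => // i a /JF; exact: JD. Qed.

Lemma graded_ideal_add1 J e a : graded_ideal J -> a \is e.-homog ->
  graded_ideal (fun u => exists v c, J v /\ u = v + c * a).
Proof.
move=> [J0 JD JM Jh] ae; split.
- by exists 0, 0; rewrite mul0r addr0.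
- move=> _ _ [v [c [Jv ->]]] [w [d [Jw ->]]]; exists (v + w), (c + d).
  by split; [exact: JD | rewrite mulrDl addrACA].
- move=> t _ [v [c [Jv ->]]]; exists (t * v), (t * c).
  by split; [exact: JM | rewrite mulrDr mulrA].
move=> _ d [v [c [Jv ->]]]; rewrite raddfD /= [c * a]mulrC.
have [de|ed] := ltnP d e.
  by exists (pihomog mdeg d v), 0; split; [exact: Jh | rewrite (pihomogMl_lt _ ae) // mul0r addr0].
exists (pihomog mdeg d v), (pihomog mdeg (d - e) c); split; first exact: Jh.
by rewrite -{2}(subnKC ed) pihomogMl // mulrC.
Qed.

Lemma graded_ideal_top J a : graded_ideal J -> ~ J a ->
  exists d, ~ J (pihomog mdeg d a) /\ forall i, (d < i)%N -> J (pihomog mdeg i a).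
Proof.
move=> gJ; have [J0 _ _ _] := gJ; move=> Ja.
have big i : (mmeasure mdeg a <= i)%N -> pihomog mdeg i a = 0.
  move=> le_i; rewrite [a in LHS](@pihomog_partitionE _ _ mdeg _ a (leqnn _)).
  rewrite raddf_sum big1 // => j _ /=.
  by rewrite (pihomog_ne0 _ (pihomogP mdeg j a)) // ltn_eqF // (leq_trans (ltn_ord j)).
pose p d := ~~ `[< J (pihomog mdeg d a) >].
have exp : exists d, p d.
  apply: contra_notP Ja => /forallNP np.
  rewrite (@pihomog_partitionE _ _ mdeg _ a (leqnn _)).
  by apply: (graded_ideal_sum _ gJ) => i _; apply/asboolP; have /negP/negPn := np i.
have ubp d : p d -> (d <= mmeasure mdeg a)%N.
  by move=> pd; rewrite leqNgt; apply: contra pd => /ltnW/big->; apply/asboolP.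
exists (ex_maxn exp ubp); case: ex_maxnP => d pd dmax; split.
  by move/negP: pd => pd h; apply: pd; apply/asboolP.
by move=> i di; apply: contrapT => npi; move: di; rewrite ltnNge dmax //; exact/asboolPn.
Qed.

(** Take the highest components of a and b outside J, of degrees d and e. In degree d + e of ab
    every other product has a factor in J, so the product of these two lies in J. Hence primality
    can be tested on forms. *)
Lemma graded_prime J : graded_ideal J ->
  (forall d e a b, a \is d.-homog -> b \is e.-homog -> J (a * b) -> J a \/ J b) ->
  forall a b, J (a * b) -> J a \/ J b.
Proof.
move=> gJ hJ a b Jab; have [J0 JD JM Jh] := gJ.
apply: contrapT => /not_orP[/(graded_ideal_top gJ)[d [nd gd]]
                            /(graded_ideal_top gJ)[e [ne ge]]].
have [] // := hJ d e _ _ (pihomogP mdeg d a) (pihomogP mdeg e b).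
(* [N] only has to exceed [d], [e] and both measures, so that [d] and [e] index summands of the two
   decompositions. *)
pose N := (mmeasure mdeg a + mmeasure mdeg b + d + e).+1.
have hd : (d < N)%N by rewrite /N; lia.
have he : (e < N)%N by rewrite /N; lia.
have := Jh _ (d + e)%N Jab.
have ha : (mmeasure mdeg a <= N)%N by rewrite /N; lia.
have hb : (mmeasure mdeg b <= N)%N by rewrite /N; lia.
rewrite {1}(pihomog_partitionE ha) {1}(pihomog_partitionE hb).
rewrite mulr_suml raddf_sum /= (bigD1 (Ordinal hd)) //= mulr_sumr raddf_sum /=.
rewrite (bigD1 (Ordinal he)) //= pihomog_dE; last by apply: dhomogM; exact: pihomogP.
set u := _ * _; set v := \sum_(i < N | _) _; set w := \sum_(i < N | _) _.
have term i j : (i, j) != (d, e) ->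
    J (pihomog mdeg (d + e) (pihomog mdeg i a * pihomog mdeg j b)).
  move=> ij; have [/gd Ji|id] := ltnP d i; first by apply: Jh; rewrite mulrC; exact: JM.
  have [/ge Jj|je] := ltnP e j; first by apply: Jh; exact: JM.
  rewrite (pihomog_ne0 _ (dhomogM (pihomogP mdeg i a) (pihomogP mdeg j b))) //.
  apply: contra ij => /eqP ij; rewrite xpair_eqE; apply/andP.
  by split; apply/eqP; lia.
have Jv : J v.
  apply: (graded_ideal_sum _ gJ) => j nj; apply: term.
  by rewrite xpair_eqE eqxx.
have Jw : J w.
  apply: (graded_ideal_sum _ gJ) => i ni.
  rewrite mulr_sumr raddf_sum; apply: (graded_ideal_sum _ gJ) => j _; apply: term.
  by rewrite xpair_eqE negb_and ni.
move=> Juvw; have -> : u = (u + v + w) + (-1) * (v + w) by ring.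
by apply: (JD) => //; apply: JM; exact: JD.
Qed.


(** Zorn's lemma for the graded ideals that contain J and no power of r; the exponent 0 makes them
    proper. *)
Lemma maximal_graded_ideal J r : graded_ideal J -> (forall N, ~ J (r ^+ N)) ->
  exists B, [/\ graded_ideal B, forall a, J a -> B a, forall N, ~ B (r ^+ N)
    & forall B', graded_ideal B' -> (forall a, B a -> B' a) ->
        (forall N, ~ B' (r ^+ N)) -> forall a, B' a -> B a].
Proof.
move=> gJ Jr.
pose ok (B : R -> Prop) :=
  [/\ graded_ideal B, forall a, J a -> B a & forall N, ~ B (r ^+ N)].
pose le (B B' : {B | ok B}) := `[< forall a, sval B a -> sval B' a >].
have okJ : ok J by split.
have [|||F totF|[B [gB JB Br]] maxB] := @classical_sets.Zorn {B | ok B} le.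
- by move=> B; apply/asboolP.
- by move=> B C D /asboolP BC /asboolP CD; apply/asboolP => a /BC /CD.
- move=> [B oB] [C oC] /asboolP /= BC /asboolP /= CB.
  have e : B = C by apply: funext => a; apply: propext; split; [exact: BC|exact: CB].
  by case: C / e oC {BC CB} => oC; rewrite (Prop_irrelevance oB oC).
- have [[B0 FB0]|/forallNP noF] := pselect (exists B, F B); last first.
    (* The empty chain is bounded by [J] itself. *)
    by exists (exist _ J okJ) => B /noF.
  pose U (a : R) := exists B, F B /\ sval B a.
  have okU : ok U.
    split; last 2 first.
    + by move=> a Ja; exists B0; split=> //; have [_ JB _] := svalP B0; exact: JB.
    + by move=> N [B [_]]; have [_ _] := svalP B; apply.
    split.
    + by exists B0; split=> //; have [[]] := svalP B0.
    + move=> a b [B [FB Ba]] [C [FC Cb]].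
      have [/asboolP BC|/asboolP CB] := totF _ _ FB FC.
        by exists C; split=> //; have [[_ CD _ _] _ _] := svalP C; apply: CD; first exact: BC.
      by exists B; split=> //; have [[_ BD _ _] _ _] := svalP B; apply: BD; last exact: CB.
    + move=> c a [B [FB Ba]]; exists B; split=> //.
      by have [[_ _ BM _] _ _] := svalP B; exact: BM.
    + move=> a d [B [FB Ba]]; exists B; split=> //.
      by have [[_ _ _ Bh] _ _] := svalP B; exact: Bh.
  by exists (exist _ U okU) => B FB; apply/asboolP => a Ba; exists B.
exists B; split=> // C gC BC Cr a Ca.
have okC : ok C by split=> // b /JB /BC.
have e := maxB (exist _ C okC); have {e} := e _.
by move=> /(_ _)/(congr1 sval)/= <- //; apply/asboolP.
Qed.

(** A graded ideal maximal among those avoiding the powers of r is prime: adding either of two forms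
    a, b outside it captures a power of r, and the product of these powers falls back into the ideal
    as soon as ab lies there. *)
Lemma pt_avoiding J r : graded_ideal J -> r@_0%MM = 0 ->
  (forall N, ~ J (r ^+ N)) ->
  exists P : proj_pt K n, (forall a, J a -> a \in (P : prime_idealr R)) /\
    r \notin (P : prime_idealr R).
Proof.
move=> gJ r0 Jr; have [B [gB JB Br maxB]] := maximal_graded_ideal gJ Jr.
have [B0 BD BM Bh] := gB.
have primeB : forall a b, B (a * b) -> B a \/ B b.
  apply: graded_prime => // d e a b ad be Bab.
  apply: contrapT => /not_orP[Ba Bb].
  have ext f c : f \is c.-homog -> ~ B f ->
      exists N v t, B v /\ r ^+ N = v + t * f.
    move=> fc Bf; apply: contrapT => /forallNP no; apply: Bf.
    have gf := graded_ideal_add1 gB fc.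
    apply: (maxB _ gf) => [u Bu|N [v [t [Bv e1]]]|].
    - by exists u, 0; rewrite mul0r addr0.
    - by apply: (no N); exists v, t.
    - by exists 0, 1; rewrite mul1r add0r.
  have [N [v [t [Bv eN]]]] := ext _ _ ad Ba.
  have [M [w [s [Bw eM]]]] := ext _ _ be Bb.
  apply: (Br (N + M)%N); rewrite exprD eN eM.
  have -> : (v + t * a) * (w + s * b) = (w + s * b) * v + (t * a * w + (t * s) * (a * b)).
    by ring.
  by apply: (BD); [exact: BM | apply: (BD); exact: BM].
pose S (a : R) : bool := `[< B a >].
have S1 : idealr_closed S.
  split; first exact/asboolP.
    by apply/asboolP; have := Br 0%N; rewrite expr0.
  move=> a u v /asboolP Bu /asboolP Bv; apply/asboolP; apply: (BD) => //.
  exact: BM.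
have S2 : prime_idealr_closed S.
  by move=> u v /asboolP/primeB[Bu|Bv]; apply/orP; [left|right]; apply/asboolP.
have S3 : homogeneous_ideal S.
  by move=> a /asboolP Ba d; apply/asboolP; exact: Bh.
(* Some variable is missed: having no constant term, [r] lies in the ideal of all variables. *)
have S4 : exists i : 'I_n.+1, ~~ S 'X_i.
  apply: contrapT => /forallNP all0; apply: (Br 1%N); rewrite expr1.
  rewrite [r]mpolyE big_seq; apply: (graded_ideal_sum _ gB) => m mr.
  have [m0|/eqP m0] := eqVneq m 0%MM.
    by rewrite m0 r0 scale0r.
  have [i mi] : exists i, (0 < m i)%N.
    apply: contrapT => /forallNP no; apply: m0; apply/mnmP => i; rewrite mnm0E.
    by apply/eqP; rewrite -leqn0 leqNgt; apply/negP/no.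
  have -> : m = (U_(i) + (m - U_(i)))%MM by rewrite addmC submK // lep1mP -lt0n.
  rewrite mpolyXD -mul_mpolyC mulrCA mulrC; apply: BM.
  by have /negP/negPn/asboolP := all0 i.
exists (ProjPt S1 S2 S3 S4); split; first by move=> a Ja; apply/asboolP; exact: JB.
by apply/asboolP; have := Br 1%N; rewrite expr1.
Qed.

End HomogeneousComponents.

Section Nullstellensatz.

Variables (K : fieldType) (n : nat) (X : subscheme K n).
Local Notation R := {mpoly K[n.+1]}.

(** With homogeneous primes as points the field is arbitrary, and r need not be a form. A nonzero
    constant term would spoil the case where J is the irrelevant ideal, which no point contains. *)
Lemma projective_nullstellensatz (J : R -> Prop) r : graded_ideal J ->
  (forall a, a \in (X : idealr R) -> J a) -> r@_0%MM = 0 ->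
  (forall x : sub_pt X, (forall a, J a -> a \in (x : prime_idealr R)) ->
     r \in (x : prime_idealr R)) ->
  exists N, J (r ^+ N).
Proof.
move=> gJ XJ r0 hJ; apply: contrapT => /forallNP no.
have [P [JP rP]] := pt_avoiding gJ r0 no.
have PX a : a \in (X : idealr R) -> a \in (P : prime_idealr R) by move/XJ/JP.
by have := hJ (SubPt PX) JP; rewrite /= (negPf rP).
Qed.

End Nullstellensatz.

(** * Minimal generators and graded endomorphisms of the ideal *)

Section MinimalGenerators.

Variables (K : fieldType) (n : nat) (X : subscheme K n) (F : min_free_res X).
Local Notation R := {mpoly K[n.+1]}.
Local Notation b := (fr_rank F 0).
Local Notation I := (X : idealr R).

Definition gen (i : 'I_b) : R := fr_gen F i 0.
Definition gdeg (i : 'I_b) : nat := `|fr_shift i|%N.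
Definition syz (l : 'I_(fr_rank F 1)) (i : 'I_b) : R := fr_map F 0 l i.

Lemma dhomog0_const (a : R) : a \is 0.-homog -> a = (a@_0%MM)%:MP.
Proof.
move=> a0; apply/mpolyP => m; rewrite mcoeffC.
have [->|m0] := eqVneq m 0%MM; first by rewrite mulr1.
by rewrite mulr0 (dhomog_nemf_coeff a0) // mdeg_eq0.
Qed.

Lemma gen_in i : gen i \in I.
Proof.
apply/(fr_gen_ideal F _); exists (delta_mx 0 i).
by rewrite -rowE mxE.
Qed.

Lemma gen_span (a : R) : a \in I <-> exists c : 'I_b -> R, a = \sum_i c i * gen i.
Proof.
rewrite (fr_gen_ideal F _); split=> [[v ->]|[c ->]].
  by exists (v 0); rewrite mxE.
exists (\row_i c i); rewrite mxE; apply: eq_bigr => i _; by rewrite mxE.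
Qed.

Lemma gen_syz (c : 'I_b -> R) : \sum_i c i * gen i = 0 ->
  exists v, forall i, c i = \sum_l v l * syz l i.
Proof.
move=> c0; have /(@fr_exact0 _ _ _ F _)[w cw] : (\row_i c i) *m fr_gen F = 0.
  apply/rowP => j; rewrite ord1 !mxE -[RHS]c0; apply: eq_bigr => i _.
  by rewrite mxE.
exists (w 0) => i; have := congr1 (fun M : 'rV_b => M 0 i) cw.
by rewrite !mxE.
Qed.

Lemma syz_gen l : \sum_i syz l i * gen i = 0.
Proof.
have /(@fr_exact0 _ _ _ F _) : exists w, row l (fr_map F 0) = w *m fr_map F 0.
  by exists (delta_mx 0 l); rewrite rowE.
move=> /(congr1 (fun M : 'M_1 => M 0 0)); rewrite !mxE => e.
by rewrite -[RHS]e; apply: eq_bigr => i _; rewrite mxE.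
Qed.

(** Minimality of the resolution. It makes the generators nonzero, and those of least degree
    linearly independent over K. *)
Lemma syz_coeff0 (c : 'I_b -> R) i : \sum_i c i * gen i = 0 -> (c i)@_0%MM = 0.
Proof.
move=> /gen_syz[v ->]; rewrite raddf_sum big1 //= => l _.
by rewrite (mcoeff0_is_multiplicative _ _).1 fr_map_min mulr0.
Qed.

Lemma gen_neq0 i : gen i != 0.
Proof.
apply/eqP => gi0; have := @syz_coeff0 (fun j => (j == i)%:R) i.
rewrite (bigD1 i) //= gi0 mulr0 add0r big1 => [|j /negPf->]; last by rewrite mul0r.
by move=> /(_ erefl); rewrite eqxx mcoeff1 eqxx => /eqP; rewrite oner_eq0.
Qed.

Lemma fr_shiftE i : fr_shift i = gdeg i :> int.
Proof.
rewrite /gdeg; have := @fr_gen_homog _ _ _ F i; have := gen_neq0 i; rewrite /gen.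
by case: (fr_shift i) => //= k /eqP.
Qed.

Lemma gen_homog i : gen i \is (gdeg i).-homog.
Proof. by have := @fr_gen_homog _ _ _ F i; rewrite fr_shiftE. Qed.

Lemma gdeg_gt0 i : (0 < gdeg i)%N.
Proof.
rewrite lt0n; apply/eqP => i0; have := gen_homog i; rewrite i0 => /dhomog0_const.
by have := gen_neq0 i; rewrite {2}/gen fr_gen_min mpolyC0 => /eqP.
Qed.

(** Subtraction is truncated, so the first conjunct says too little when [e < gdeg i]; the second
    records that a form of negative degree is zero. *)
Lemma syz_homog l i (e : nat) : fr_shift l = e :> int ->
  syz l i \is (e - gdeg i).-homog /\ ((e < gdeg i)%N -> syz l i = 0).
Proof.
move=> le; have := @fr_map_homog _ _ _ F 0%N l i; rewrite le fr_shiftE /syz.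
have [ei|ie] := ltnP e (gdeg i).
  have -> : (e%:Z - (gdeg i)%:Z = Negz (gdeg i - e).-1) by lia.
  by move=> /= ->; split=> //; exact: dhomog0.
by have -> : (e%:Z - (gdeg i)%:Z = Posz (e - gdeg i)) by lia.
Qed.

Lemma syz_neg l i (e : nat) : fr_shift l = Negz e :> int -> syz l i = 0.
Proof.
move=> le; have := @fr_map_homog _ _ _ F 0%N l i; rewrite le fr_shiftE /syz.
by have -> : (Negz e - (gdeg i)%:Z = Negz (gdeg i + e)) by lia.
Qed.

Lemma gen_span_homog (a : R) d : a \in I -> a \is d.-homog ->
  exists c : 'I_b -> R, a = \sum_i c i * gen i /\
    forall i, c i \is (d - gdeg i).-homog /\ ((d < gdeg i)%N -> c i = 0).
Proof.
move=> /gen_span[c ac] ad.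
exists (fun i => if (d < gdeg i)%N then 0 else pihomog mdeg (d - gdeg i) (c i)).
split; last first.
  by move=> i; case: ifP => // _; split=> //; [exact: dhomog0|exact: pihomogP].
rewrite -[LHS](pihomog_dE ad) ac raddf_sum; apply: eq_bigr => i _ /=.
rewrite mulrC; case: ltnP => di.
  by rewrite (pihomogMl_lt _ (gen_homog i)) // mul0r.
by rewrite -{1}(subnKC di) (pihomogMl _ _ (gen_homog i)) mulrC.
Qed.

Section LowDegree.

Variable m : nat.
Hypothesis le_gdeg : forall i, (m <= gdeg i)%N.

Lemma ideal_low (a : R) d : a \in I -> (d < m)%N -> pihomog mdeg d a = 0.
Proof.
move=> /gen_span[c ->] dm; rewrite raddf_sum big1 // => i _ /=.
by rewrite mulrC (pihomogMl_lt _ (gen_homog i)) // (leq_trans dm).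
Qed.

Lemma sq_ideal_low (a : R) d : sq_ideal X a -> (d < 2 * m)%N -> pihomog mdeg d a = 0.
Proof.
move=> [s [sX ->]] dm; rewrite raddf_sum big_seq big1 //= => -[u v] /sX[/= uX vX].
have [c ->] := (gen_span u).1 uX.
rewrite mulr_suml raddf_sum big1 // => i _ /=.
rewrite -mulrA mulrCA; have [di|id] := ltnP d (gdeg i).
  by rewrite (pihomogMl_lt _ (gen_homog i)).
rewrite -(subnKC id) (pihomogMl _ _ (gen_homog i)) ideal_low ?mulr0 //.
  exact: idealMr.
have := le_gdeg i; lia.
Qed.

End LowDegree.

Hypothesis shift_lt : forall (l : 'I_(fr_rank F 1)) (i : 'I_b),
  fr_shift l < 2 * fr_shift i.

Lemma min_gdeg (i0 : 'I_b) : exists i, forall j, (gdeg i <= gdeg j)%N.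
Proof. by case: (@arg_minnP _ i0 predT gdeg isT) => i _ hi; exists i => j; exact: hi. Qed.

(** It keeps I / I^2 from being zero, so that a multiple of an identity endomorphism vanishes only
    for the scalar 0. *)
Lemma gen_notin_sq i : (forall j, (gdeg i <= gdeg j)%N) -> ~ sq_ideal X (gen i).
Proof.
move=> hi /(sq_ideal_low hi)/(_ (_ : (gdeg i < _)%N)).
have := gdeg_gt0 i => i0 /(_ _); rewrite pihomog_dE ?gen_homog // => h.
by have /eqP := gen_neq0 i; apply; apply: h; lia.
Qed.

Lemma syz_lift (h : 'I_b -> R) : (forall i, h i \is (gdeg i).-homog) ->
  (forall l, sq_ideal X (\sum_i syz l i * h i)) ->
  forall l, \sum_i syz l i * h i = 0.
Proof.
move=> hh hX l; case le : (fr_shift l) => [e|e]; last first.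
  by apply: big1 => i _; rewrite (syz_neg i le) mul0r.
have [i0|noi] := pickP 'I_b; last by apply: big1 => i; have := noi i.
have [i hi] := min_gdeg i0.
have ei : (e < 2 * gdeg i)%N by have := shift_lt l i; rewrite le fr_shiftE; lia.
rewrite -[RHS](sq_ideal_low hi (hX l) ei) pihomog_dE //; apply: rpred_sum => j _.
have [sh s0] := syz_homog j le.
have [ej|je] := ltnP e (gdeg j); first by rewrite s0 // mul0r dhomog0.
by rewrite -(subnK je); exact: dhomogM.
Qed.

End MinimalGenerators.

Section Eigenvector.

Variables (K : closedFieldType) (n : nat) (X : subscheme K n) (F : min_free_res X).
Local Notation R := {mpoly K[n.+1]}.
Local Notation b := (fr_rank F 0).
Local Notation I := (X : idealr R).
Local Notation gen := (@gen K n X F).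
Local Notation gdeg := (@gdeg K n X F).
Local Notation syz := (@syz K n X F).

Lemma closed_eigenvector p (M : 'M[K]_p) : (0 < p)%N ->
  exists k (v : 'rV_p), v != 0 /\ v *m M = k *: v.
Proof.
move=> p0; have /closed_rootP[k] : size (char_poly M) != 1%N.
  by rewrite size_char_poly eqSS -lt0n.
by rewrite -eigenvalue_root_char => /eigenvalueP[v vM v0]; exists k, v.
Qed.

Hypothesis shift_lt : forall (l : 'I_(fr_rank F 1)) (i : 'I_b),
  fr_shift l < 2 * fr_shift i.

(* [h] lifts to an endomorphism of the ideal [I], so [f_j h_i = f_i h_j]; an
   eigenvector in the least degree of [I] then makes it a homothety. *)
Lemma graded_endo_scalar (h : 'I_b -> R) :
  (forall i, h i \in I) -> (forall i, h i \is (gdeg i).-homog) ->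
  (forall l, sq_ideal X (\sum_i syz l i * h i)) ->
  exists k : K, forall i, h i = k *: gen i.
Proof.
move=> hX hh hsyz; have hs := syz_lift shift_lt hh hsyz.
have hrel (c : 'I_b -> R) : \sum_i c i * gen i = 0 -> \sum_i c i * h i = 0.
  move=> /gen_syz[v cv].
  transitivity (\sum_l v l * \sum_i syz l i * h i).
    under eq_bigr => i _ do rewrite cv mulr_suml.
    rewrite exchange_big /=; apply: eq_bigr => l _; rewrite mulr_sumr.
    by apply: eq_bigr => i _; rewrite mulrA.
  by apply: big1 => l _; rewrite hs mulr0.
have comm i j : gen i * h j = gen j * h i.
  apply/eqP; rewrite -subr_eq0; apply/eqP.
  (* The Koszul relation between the generators [i] and [j]. *)
  have := hrel (fun k => gen i *+ (k == j) - gen j *+ (k == i)).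
  have E (g : 'I_b -> R) :
      \sum_k (gen i *+ (k == j) - gen j *+ (k == i)) * g k = gen i * g j - gen j * g i.
    under eq_bigr => k _ do rewrite mulrBl !mulrnAl.
    rewrite sumrB; congr (_ - _).
      by rewrite (bigD1 j) //= eqxx big1 ?addr0 // => k /negPf->.
    by rewrite (bigD1 i) //= eqxx big1 ?addr0 // => k /negPf->.
  rewrite !E => -> //; by rewrite mulrC subrr.
have [i0 _|noi] := pickP 'I_b; last by exists 0 => i; have := noi i.
have [i1 hmin] := min_gdeg i0.
(* The generators indexed by [S] span the least graded piece of I over K; the lift preserves this
   piece, with matrix [M]. *)
pose S := [set i | gdeg i == gdeg i1].
have S0 : (0 < #|S|)%N by apply/card_gt0P; exists i1; rewrite inE.
have /choice[c hc] : forall i, exists c : 'I_b -> R, h i = \sum_j c j * gen j /\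
    forall j, c j \is (gdeg i - gdeg j).-homog /\ ((gdeg i < gdeg j)%N -> c j = 0).
  by move=> i; apply: gen_span_homog.
have hS i : i \in S -> h i = \sum_(j in S) ((c i j)@_0%MM) *: gen j.
  rewrite inE => /eqP iS; have [hi ci] := hc i.
  rewrite hi (bigID (mem S)) /= [X in _ + X]big1 ?addr0.
    apply: eq_bigr => j; rewrite inE => /eqP jS; have [cj _] := ci j.
    by rewrite -mul_mpolyC -dhomog0_const //; move: cj; rewrite iS jS subnn.
  move=> j; rewrite inE => jS; have [_ ->] := ci j; first by rewrite mul0r.
  by rewrite iS ltn_neqAle eq_sym jS hmin.
pose M := \matrix_(k < #|S|, l < #|S|) (c (enum_val k) (enum_val l))@_0%MM.
have [k [v [v0 vM]]] := closed_eigenvector M S0.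
pose a := \sum_l v 0 l *: gen (enum_val l).
have ha : \sum_l v 0 l *: h (enum_val l) = k *: a.
  transitivity (\sum_l \sum_j (v 0 l * M l j) *: gen (enum_val j)).
    apply: eq_bigr => l _; rewrite hS ?enum_valP // big_enum_val scaler_sumr /=.
    by apply: eq_bigr => j _; rewrite scalerA mxE.
  rewrite exchange_big scaler_sumr /=; apply: eq_bigr => j _.
  rewrite -scaler_suml scalerA; congr (_ *: _).
  by have := congr1 (fun w : 'rV_ _ => w 0 j) vM; rewrite !mxE.
(* If [a] were 0, the entries of [v] would be constant coefficients of a relation, and these vanish
   by minimality. *)
have a0 : a != 0.
  apply: contra v0 => /eqP a0; apply/eqP/rowP => l; rewrite mxE.
  pose e (i : 'I_b) : R := \sum_(l' | enum_val l' == i) (v 0 l')%:MP.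
  have : \sum_i e i * gen i = 0.
    rewrite -[RHS]a0 /a; under eq_bigr => i _ do rewrite /e mulr_suml.
    rewrite (exchange_big_dep predT) //=; apply: eq_bigr => l' _.
    by rewrite (big_pred1 (enum_val l')) ?mul_mpolyC // => i; rewrite eq_sym.
  move=> /(syz_coeff0 (enum_val l)); rewrite /e (big_pred1 l).
    by rewrite mcoeffC eqxx mulr1.
  by move=> l'; rewrite (inj_eq enum_val_inj).
(* With Phi the lift: a Phi(f_j) = f_j Phi(a) = k a f_j, and [a] cancels. *)
exists k => j; apply: (mulfI a0).
rewrite -scalerAr mulrC scalerAl -ha mulr_suml mulr_sumr; apply: eq_bigr => l _.
by rewrite -scalerAr -scalerAl mulrC comm mulrC.
Qed.

End Eigenvector.

(** * Regular sequences and Cech gluing *)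

Section RegularSequences.

(** Coefficients indexed by [nat] can be shared between prefixes of different lengths. *)
Lemma span_mod_takeP (S : pzRingType) (N : lmodType S) (s : seq S) k (v : N) :
  (k <= size s)%N ->
  span_mod (take k s) v <-> exists w : nat -> N, v = \sum_(i < k) s`_i *: w i.
Proof.
move=> ks; have e := size_takel ks; split=> [[w ->]|[w ->]].
  pose w' i := if insub i is Some j then w j else 0.
  exists w'; transitivity (\sum_(0 <= i < size (take k s)) s`_i *: w' i).
    rewrite big_mkord; apply: eq_bigr => i _; rewrite /w' valK nth_take //.
    by rewrite -[X in (_ < X)%N]e.
  by rewrite e big_mkord.
exists (fun i => w i); transitivity (\sum_(0 <= i < size (take k s)) s`_i *: w i).
  by rewrite e big_mkord.
rewrite big_mkord; apply: eq_bigr => i _; rewrite nth_take //.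
by rewrite -[X in (_ < X)%N]e.
Qed.

(* A regular sequence is quasi-regular in degree 1. *)
Lemma regular_seq_free (S : comNzRingType) (s : seq S) (a : nat -> S) :
  regular_seq S^o s -> \sum_(i < size s) a i * s`_i = 0 ->
  forall i, (i < size s)%N -> exists w : nat -> S, a i = \sum_(j < size s) w j * s`_j.
Proof.
move=> [reg _]; suff H k : (k <= size s)%N -> forall a : nat -> S,
    \sum_(i < k) a i * s`_i = 0 ->
    forall i, (i < k)%N -> exists w : nat -> S, a i = \sum_(j < k) w j * s`_j.
  exact: H.
elim: k => // k IHk ks {}a; rewrite big_ord_recr /= => sum0.
(* Regularity puts the last coefficient into the ideal of the earlier elements; substituting it
   leaves a shorter relation, with coefficients a_i + b_i s_k. *)
have [b ak] : exists b : nat -> S, a k = \sum_(j < k) b j * s`_j.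
  have [|b ->] := (@span_mod_takeP S S^o s k (a k) (ltnW ks)).1.
    apply: reg => //; apply/(span_mod_takeP _ (ltnW ks)).
    exists (fun i => - a i); move/eqP: sum0; rewrite addrC addr_eq0 => /eqP sum0.
    rewrite -[LHS]/(s`_k * a k) mulrC sum0 -sumrN; apply: eq_bigr => i _.
    by rewrite -[RHS]/(s`_i * - a i) mulrN mulrC.
  by exists b; apply: eq_bigr => i _; rewrite mulrC.
have sum0' : \sum_(i < k) (a i + b i * s`_k) * s`_i = 0.
  rewrite -[RHS]sum0 ak mulr_suml -big_split; apply: eq_bigr => i _ /=; ring.
move=> i; rewrite ltnS leq_eqVlt => /orP[/eqP->|ik].
  exists (fun j => if (j < k)%N then b j else 0).
  by rewrite big_ord_recr /= ltnn mul0r addr0 ak; apply: eq_bigr => j _; rewrite ltn_ord.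
have [w aw] := IHk (ltnW ks) (fun i => a i + b i * s`_k) sum0' i ik.
exists (fun j => if (j < k)%N then w j else - b i).
rewrite big_ord_recr /= ltnn mulNr; apply/eqP; rewrite eq_sym subr_eq eq_sym; apply/eqP.
by rewrite aw; apply: eq_bigr => j _; rewrite ltn_ord.
Qed.

Lemma regular_pair (S : comNzRingType) (N : lmodType S) (J : S -> Prop) d :
  depth_is J N d -> (2 <= d)%N -> exists s0 s1, [/\ J s0, J s1,
    forall v : N, s0 *: v = 0 -> v = 0 &
    forall v w : N, s1 *: v = s0 *: w -> exists u, v = s0 *: u].
Proof.
move=> [[|s0 [|s1 s]] [<- // sJ [reg _] _]] _.
exists s0, s1; split; try by apply: sJ; rewrite !inE eqxx ?orbT.
  move=> v v0; have [|w ->] := (@span_mod_takeP S N (s0 :: s1 :: s) 0 v isT).1.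
    by apply: (reg 0%N) => //=; rewrite v0; exists (fun=> 0); rewrite big_ord0.
  by rewrite big_ord0.
move=> v w vw; have [|u ->] := (@span_mod_takeP S N (s0 :: s1 :: s) 1 v isT).1.
  apply: (reg 1%N) => //; apply/(@span_mod_takeP S N (s0 :: s1 :: s) 1 _ isT).
  by exists (fun=> w); rewrite big_ord1.
by exists (u 0%N); rewrite big_ord1.
Qed.

Lemma regular_pow0 (S : comNzRingType) (N : lmodType S) s0 k :
  (forall v : N, s0 *: v = 0 -> v = 0) -> forall v : N, s0 ^+ k *: v = 0 -> v = 0.
Proof.
move=> h; elim: k => [|k IHk] v; first by rewrite expr0 scale1r.
by rewrite exprS -scalerA => /h/IHk.
Qed.

(** The Nullstellensatz only yields powers of s0 and s1, so these have to be regular too. Powers of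
    s1 are treated first; then the factors s0 are split off and cancelled one at a time. *)
Lemma regular_pow (S : comNzRingType) (N : lmodType S) s0 s1 k l :
  (forall v : N, s0 *: v = 0 -> v = 0) ->
  (forall v w : N, s1 *: v = s0 *: w -> exists u, v = s0 *: u) ->
  forall v w : N, s1 ^+ l *: v = s0 ^+ k *: w -> exists u, v = s0 ^+ k *: u.
Proof.
move=> h0 h1.
have {}h1 m (v w : N) : s1 ^+ m *: v = s0 *: w -> exists u, v = s0 *: u.
  elim: m v w => [|m IHm] v w; first by rewrite expr0 scale1r => ->; exists w.
  by rewrite exprSr -scalerA => /IHm[u] /h1.
elim: k => [|k IHk] v w; first by exists v; rewrite expr0 scale1r.
rewrite exprS -scalerA => e; have [u vu] := h1 _ _ _ e.
have /IHk[u' uu'] : s1 ^+ l *: u = s0 ^+ k *: w.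
  apply/eqP; rewrite -subr_eq0; apply/eqP/h0; rewrite scalerBr -e vu !scalerA.
  by rewrite mulrC subrr.
by exists u'; rewrite vu uu' scalerA -exprS.
Qed.

End RegularSequences.

Section ConormalElements.

Variables (K : fieldType) (n : nat) (X : subscheme K n).
Local Notation R := {mpoly K[n.+1]}.
Local Notation I := (X : idealr R).
Local Notation N := (rscal (coord_pi X) (conormal X)).

Lemma conormal_class_surj (J : idealr R) (q : conormal J) :
  exists2 a, a \in J & q = conormal_class J a.
Proof.
have [[a aJ] ->] := conormal_surj q; exists a => //.
by congr conormal_pi; apply: val_inj; rewrite insubdK.
Qed.

Lemma conormal_class_eq0 (a : R) : a \in I -> (conormal_class X a = 0) <-> sq_ideal X a.
Proof.
move=> aX; rewrite -(conormal_class0 X) conormal_piP !insubdK ?subr0 //.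
by rewrite -topredE /= idealr0.
Qed.

Lemma conormal_class_eq (a b : R) : a \in I -> b \in I ->
  (conormal_class X a = conormal_class X b) <-> sq_ideal X (a - b).
Proof. by move=> aX bX; rewrite conormal_piP !insubdK. Qed.

Lemma rscal_conormalZ (r a : R) : a \in I ->
  r *: (conormal_class X a : N) = conormal_class X (r * a).
Proof. exact: conormal_classZ. Qed.

Lemma sq_ideal_graded : graded_ideal (sq_ideal X).
Proof.
split; [exact: sq_ideal0|exact: sq_idealD|exact: sq_idealMl|].
move=> a d; exact: sq_ideal_homog.
Qed.

(* Depth at least 2 makes the cocycle [h_k / g_k] of fractions a global element. *)
Lemma cech_glue (s0 s1 : R) (m : nat) (g h u v : 'I_m -> R) k l :
  (forall x : N, s0 *: x = 0 -> x = 0) ->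
  (forall x y : N, s1 *: x = s0 *: y -> exists z, x = s0 *: z) ->
  (forall i, h i \in I) ->
  (forall i j, sq_ideal X (g j * h i - g i * h j)) ->
  s0 ^+ k - \sum_i u i * g i \in I -> s1 ^+ l - \sum_i v i * g i \in I ->
  exists2 b, b \in I & forall i, sq_ideal X (g i * b - h i).
Proof.
move=> reg0 reg1 hI comp us vs.
(* [b0] and [b1] stand for s0^k and s1^l times the element sought: by [E] below, g_j b0 = s0^k h_j
   and g_j b1 = s1^l h_j modulo I^2. *)
pose b0 := \sum_i u i * h i; pose b1 := \sum_i v i * h i.
have b0I : b0 \in I by apply: rpred_sum => i _; exact: idealMr.
have b1I : b1 \in I by apply: rpred_sum => i _; exact: idealMr.
have E (t : R) (w : 'I_m -> R) j : t - \sum_i w i * g i \in I ->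
    sq_ideal X (g j * (\sum_i w i * h i) - t * h j).
  move=> tI; have -> : g j * (\sum_i w i * h i) - t * h j =
    (\sum_i w i * (g j * h i - g i * h j)) - (t - \sum_i w i * g i) * h j.
    rewrite mulrBl mulr_suml mulr_sumr opprB addrA; congr (_ - _).
    rewrite -big_split; apply: eq_bigr => i _ /=; ring.
  apply: sq_idealB; last exact: sq_idealM.
  by apply: (graded_ideal_sum _ sq_ideal_graded) => i _; exact: sq_idealMl.
have E0 j := E _ _ j us; have E1 j := E _ _ j vs.
(* Since s1^l b0 and s0^k b1 have the same class, the regular pair makes the class of [b0] divisible
   by s0^k; the quotient is the glued element. *)
have e01 : s1 ^+ l *: (conormal_class X b0 : N) = s0 ^+ k *: (conormal_class X b1 : N).
  rewrite !rscal_conormalZ //; apply/conormal_class_eq; rewrite ?idealMr //.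
  have -> : s1 ^+ l * b0 - s0 ^+ k * b1 = (s1 ^+ l - \sum_i v i * g i) * b0
      + \sum_j v j * (g j * b0 - s0 ^+ k * h j).
    rewrite mulrBl -addrA; congr (_ + _).
    rewrite mulr_suml -sumrN -big_split mulr_sumr -sumrN; apply: eq_bigr => i _ /=; ring.
  apply: sq_idealD; first exact: sq_idealM.
  by apply: (graded_ideal_sum _ sq_ideal_graded) => i _; exact: sq_idealMl.
have [z] := regular_pow reg0 reg1 e01; have [b bI ->] := conormal_class_surj z.
rewrite rscal_conormalZ // conormal_class_eq ?idealMr // => b0b.
exists b => // i; apply/conormal_class_eq0; first by rewrite rpredB ?idealMr.
apply: (@regular_pow0 _ N s0 k reg0).
rewrite rscal_conormalZ; last by rewrite rpredB ?idealMr.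
apply/conormal_class_eq0; first by rewrite idealMr // rpredB ?idealMr.
have -> : s0 ^+ k * (g i * b - h i) =
  (g i * b0 - s0 ^+ k * h i) - g i * (b0 - s0 ^+ k * b) by ring.
by apply: sq_idealB => //; exact: sq_idealMl.
Qed.

End ConormalElements.

(** * Germs of the structure sheaf and of the conormal sheaf *)

Section Stalks.

Variables (K : fieldType) (n : nat) (X : subscheme K n).
Local Notation R := {mpoly K[n.+1]}.
Local Notation I := (X : idealr R).
Implicit Types (x y : sub_pt X) (a b f g h : R).

Definition homog_form (f : R) : Prop := exists d, f \is d.-homog.

Lemma homog_formI d f : f \is d.-homog -> homog_form f.
Proof. by exists d. Qed.

Definition sfracP x a f : Prop := is_frac (std_grading K n) x (a : R^o) f.

Lemma sfracPI x a f d : a \is d.-homog -> f \is d.-homog ->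
  f \notin (x : prime_idealr R) -> sfracP x a f.
Proof. by exists d. Qed.

Lemma notin_pt_neq0 x f : f \notin (x : prime_idealr R) -> f != 0.
Proof. by apply: contraNneq => ->; exact: idealr0. Qed.

Lemma notin_ptM x f g : (f * g \notin (x : prime_idealr R)) =
  (f \notin (x : prime_idealr R)) && (g \notin (x : prime_idealr R)).
Proof. by rewrite prime_idealrM negb_or. Qed.

Lemma notin_ptX x f k : f \notin (x : prime_idealr R) -> f ^+ k \notin (x : prime_idealr R).
Proof.
move=> fx; elim: k => [|k IHk]; first by rewrite expr0 idealr1.
by rewrite exprS notin_ptM fx.
Qed.

(** The auxiliary multiplier in the equality of fractions cancels, R being a domain. *)
Lemma sfrac_eq x a f b g : sfracP x a f -> sfracP x b g ->
  (sfrac x a f = sfrac x b g) <-> g * a = f * b.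
Proof.
move=> h h'; rewrite /sfrac (fracE h) (fracE h'); split=> [/hloc_piP/asboolP|e].
  move=> [t [_ [tx e]]]; apply: (mulfI (notin_pt_neq0 tx)); exact: e.
exact: hloc_eq1.
Qed.

Lemma sfrac_surj x (z : stalk x) : exists a f, sfracP x a f /\ z = sfrac x a f.
Proof. by have [a [f [h ->]]] := frac_surj (z : hloc _ _); exists a, f. Qed.

Lemma stalk_idealE x (z : stalk x) : z \in stalk_idealr x ->
  exists a f, [/\ sfracP x a f, a \in I & z = sfrac x a f].
Proof.
move=> /asboolP[[a f h] [aI ->]]; exists a, f; split=> //.
by rewrite /sfrac (fracE h).
Qed.

Lemma sfracMP x a f b g : sfracP x a f -> sfracP x b g -> sfracP x (a * b) (f * g).
Proof. by move=> h h'; have [] := sfracM h h'. Qed.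

Lemma sfracME x a f b g : sfracP x a f -> sfracP x b g ->
  sfrac x a f * sfrac x b g = sfrac x (a * b) (f * g).
Proof. by move=> h h'; have [] := sfracM h h'. Qed.

Lemma sfracBP x a f b g : sfracP x a f -> sfracP x b g ->
  sfracP x (g * a - f * b) (f * g).
Proof. by move=> h h'; have [] := sfracB h h'. Qed.

Lemma sfracBE x a f b g : sfracP x a f -> sfracP x b g ->
  sfrac x a f - sfrac x b g = sfrac x (g * a - f * b) (f * g).
Proof. by move=> h h'; have [] := sfracB h h'. Qed.

Lemma sfrac0P x : sfracP x 0 1.
Proof. exact: hfrac0_subproof. Qed.

Lemma sfrac0 x : sfrac x 0 1 = 0.
Proof. exact: frac0. Qed.

Lemma sfracNP x a f : sfracP x a f -> sfracP x (- a) f.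
Proof.
by move=> h; have := sfracBP (sfrac0P x) h; rewrite mulr0 sub0r !mul1r.
Qed.

Lemma sfracNE x a f : sfracP x a f -> - sfrac x a f = sfrac x (- a) f.
Proof.
by move=> h; rewrite -sub0r -sfrac0 (sfracBE (sfrac0P x) h) mulr0 sub0r !mul1r.
Qed.

Lemma sfracDP x a f b g : sfracP x a f -> sfracP x b g ->
  sfracP x (g * a + f * b) (f * g).
Proof.
by move=> h h'; have := sfracBP h (sfracNP h'); rewrite mulrN opprK.
Qed.

Lemma sfracDE x a f b g : sfracP x a f -> sfracP x b g ->
  sfrac x a f + sfrac x b g = sfrac x (g * a + f * b) (f * g).
Proof.
move=> h h'; rewrite -[sfrac x b g]opprK (sfracNE h') (sfracBE h (sfracNP h')).
by rewrite mulrN opprK.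
Qed.

Lemma sfrac_sum x (J : Type) (s : seq J) (a : J -> R) f :
  (forall i, sfracP x (a i) f) -> f \notin (x : prime_idealr R) -> homog_form f ->
  sfracP x (\sum_(i <- s) a i) f /\
  \sum_(i <- s) sfrac x (a i) f = sfrac x (\sum_(i <- s) a i) f.
Proof.
move=> ha fx [d fd].
have h0 : sfracP x 0 f by apply: sfracPI (dhomog0 _ _ d) fd fx.
elim: s => [|i s [IH1 IH2]].
  by rewrite !big_nil; split=> //; rewrite -(sfrac0 x); apply/(sfrac_eq (sfrac0P x) h0); ring.
have h := sfracDP (ha i) IH1.
have h' : sfracP x (a i + \sum_(j <- s) a j) f.
  have [e [ae fe _]] := ha i; have [e' [be fe' _]] := IH1.
  have e'e := dhomog_uniq (notin_pt_neq0 fx) fe' fe; subst e'.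
  by exists e; split=> //; exact: rpredD.
rewrite !big_cons; split=> //; rewrite IH2 (sfracDE (ha i) IH1).
by apply/(sfrac_eq h h'); ring.
Qed.

(* The fraction [a / f] as a germ of the structure sheaf of [X], resp. (for [a] in
   the ideal of [X]) of the conormal sheaf. *)
Definition ogerm x a f : local_ring x := local_pi x (sfrac x a f).
Definition cgerm x a f : conormal (stalk_idealr x) := conormal_class _ (sfrac x a f).

Lemma ogerm_surj x (z : local_ring x) : exists a f, sfracP x a f /\ z = ogerm x a f.
Proof.
have [a [f [h e]]] := sfrac_surj (repr z); exists a, f; split=> //.
by rewrite /ogerm -e /= reprK.
Qed.

Lemma ogerm_eq0 x a f : sfracP x a f ->
  (ogerm x a f = 0) <-> exists h, [/\ homog_form h, h \notin (x : prime_idealr R) & h * a \in I].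
Proof.
move=> hf; rewrite /ogerm -(rmorph0 (local_pi x)).
have -> : (local_pi x (sfrac x a f) = local_pi x 0) <-> sfrac x a f \in stalk_idealr x.
  by split=> [/eqP|?]; last apply/eqP; rewrite /= -Quotient.idealrBE subr0.
have [d [ad fd fx]] := hf; split.
  move=> /stalk_idealE[b [g [hg bI /(sfrac_eq hf hg) e]]].
  have [k [_ gk gx]] := hg; exists g; split=> //; first by exists k.
  by rewrite e; exact: idealMr.
move=> [h [[k hk] hx haI]].
have hf' : sfracP x (h * a) (h * f).
  by exists (k + d)%N; split; [exact: dhomogM|exact: dhomogM|rewrite notin_ptM hx].
have -> : sfrac x a f = sfrac x (h * a) (h * f) by apply/(sfrac_eq hf hf'); ring.
exact: stalk_idealP.
Qed.

Lemma ogermB x a f b g : sfracP x a f -> sfracP x b g ->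
  ogerm x a f - ogerm x b g = ogerm x (g * a - f * b) (f * g).
Proof. by move=> h h'; rewrite /ogerm -rmorphB (sfracBE h h'). Qed.

Lemma ogermD x a f b g : sfracP x a f -> sfracP x b g ->
  ogerm x a f + ogerm x b g = ogerm x (g * a + f * b) (f * g).
Proof. by move=> h h'; rewrite /ogerm -rmorphD (sfracDE h h'). Qed.

Lemma ogermM x a f b g : sfracP x a f -> sfracP x b g ->
  ogerm x a f * ogerm x b g = ogerm x (a * b) (f * g).
Proof. by move=> h h'; rewrite /ogerm -rmorphM (sfracME h h'). Qed.

Lemma ogerm_eq x a f b g h : sfracP x a f -> sfracP x b g ->
  homog_form h -> h \notin (x : prime_idealr R) -> h * (g * a - f * b) \in I ->
  ogerm x a f = ogerm x b g.
Proof.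
move=> ha hb hh hx hI; apply/eqP; rewrite -subr_eq0 (ogermB ha hb); apply/eqP.
by apply/(ogerm_eq0 (sfracBP ha hb)); exists h.
Qed.

Lemma cgermB x a f b g : sfracP x a f -> a \in I -> sfracP x b g -> b \in I ->
  cgerm x a f - cgerm x b g = cgerm x (g * a - f * b) (f * g).
Proof.
move=> h aI h' bI; rewrite /cgerm -(sfracBE h h') conormal_classB //; exact: stalk_idealP.
Qed.

Lemma cgermD x a f b g : sfracP x a f -> a \in I -> sfracP x b g -> b \in I ->
  cgerm x a f + cgerm x b g = cgerm x (g * a + f * b) (f * g).
Proof.
move=> h aI h' bI; rewrite /cgerm -(sfracDE h h') conormal_classD //; exact: stalk_idealP.
Qed.

Lemma cgermZ x u v a f : sfracP x u v -> sfracP x a f -> a \in I ->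
  ogerm x u v *: cgerm x a f = cgerm x (u * a) (v * f).
Proof.
move=> h h' aI; rewrite /cgerm -(sfracME h h') -conormal_classZ //; exact: stalk_idealP.
Qed.

Lemma cgerm_surj x (q : conormal (stalk_idealr x)) :
  exists a f, [/\ sfracP x a f, a \in I & q = cgerm x a f].
Proof.
have [[z zJ] ->] := conormal_surj q; have [a [f [h aI e]]] := stalk_idealE zJ.
exists a, f; split=> //; rewrite /cgerm -e; congr conormal_pi; apply: val_inj.
by rewrite insubdK.
Qed.

Lemma cgerm_sum x (J : Type) (s : seq J) (a : J -> R) f :
  (forall i, sfracP x (a i) f) -> (forall i, a i \in I) ->
  f \notin (x : prime_idealr R) -> homog_form f ->
  \sum_(i <- s) cgerm x (a i) f = cgerm x (\sum_(i <- s) a i) f.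
Proof.
move=> ha aI fx fh; rewrite /cgerm; have [_ <-] := sfrac_sum s ha fx fh.
have hJ i : sfrac x (a i) f \in stalk_idealr x by apply: stalk_idealP (ha i) (aI i).
elim: s => [|i s IH]; first by rewrite !big_nil conormal_class0.
by rewrite !big_cons IH -conormal_classD // rpred_sum.
Qed.

Lemma sq_stalkE x (z : stalk x) : sq_ideal (stalk_idealr x) z ->
  exists a f, [/\ sfracP x a f, sq_ideal X a & z = sfrac x a f].
Proof.
move=> [s [sJ ->]]; elim: s sJ => [|[u v] s IHs] sJ.
  by exists 0, 1; rewrite big_nil sfrac0; split; [exact: sfrac0P|exact: sq_ideal0|].
have [|b [g [hb bI e]]] := IHs; first by move=> bc bcs; apply: sJ; rewrite inE bcs orbT.
have [/= uJ vJ] := sJ _ (mem_head _ _).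
have [a [f [ha aI eu]]] := stalk_idealE uJ.
have [a' [f' [ha' aI' ev]]] := stalk_idealE vJ.
exists (g * (a * a') + f * f' * b), (f * f' * g); split.
- exact: sfracDP (sfracMP ha ha') hb.
- by apply: sq_idealD; apply: sq_idealMl => //; exact: sq_idealM.
by rewrite big_cons e /= eu ev (sfracME ha ha') (sfracDE (sfracMP ha ha') hb).
Qed.

End Stalks.

Section ConormalGerms.

Variables (K : fieldType) (n : nat) (X : subscheme K n) (F : min_free_res X).
Local Notation R := {mpoly K[n.+1]}.
Local Notation I := (X : idealr R).
Local Notation gen := (@gen K n X F).
Local Notation gdeg := (@gdeg K n X F).
Implicit Types (x y : sub_pt X) (a b f g h : R).

(** This serves to write a fraction with numerator in I^2 as a sum of products of two germs of the
    ideal sheaf: each summand must split into homogeneous factors, so that both can be brought to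
    degree 0. *)
Lemma sq_gen_homog a d : sq_ideal X a -> a \is d.-homog ->
  exists c : 'I_(fr_rank F 0) -> R, [/\ a = \sum_i c i * gen i, forall i, c i \in I &
    forall i, c i \is (d - gdeg i).-homog /\ ((d < gdeg i)%N -> c i = 0)].
Proof.
move=> asq ad.
have [c [ac cI]] : exists c : 'I_(fr_rank F 0) -> R, a = \sum_i c i * gen i /\ forall i, c i \in I.
  case: asq {ad} => s [sX ->]; elim: s sX => [|[u v] s IHs] sX.
    exists (fun=> 0); rewrite big_nil; split=> [|i]; last exact: idealr0.
    by rewrite big1 // => i _; rewrite mul0r.
  have [|c [e cI]] := IHs; first by move=> bc bcs; apply: sX; rewrite inE bcs orbT.
  have [/= uX vX] := sX _ (mem_head _ _).
  have [c' uc'] := (gen_span F u).1 uX.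
  exists (fun i => v * c' i + c i); split; last first.
    by move=> i; apply: rpredD => //; rewrite mulrC idealMr.
  rewrite big_cons e uc' /= mulr_suml -big_split; apply: eq_bigr => i _ /=; ring.
exists (fun i => if (d < gdeg i)%N then 0 else pihomog mdeg (d - gdeg i) (c i)).
split.
- rewrite -[LHS](pihomog_dE ad) ac raddf_sum; apply: eq_bigr => i _ /=.
  rewrite mulrC; case: ltnP => di.
    by rewrite (pihomogMl_lt _ (gen_homog i)) // mul0r.
  by rewrite -{1}(subnKC di) (pihomogMl _ _ (gen_homog i)) mulrC.
- by move=> i; case: ifP => _; [exact: idealr0|apply: sub_homog].
by move=> i; case: ifP => // _; split=> //; [exact: dhomog0|exact: pihomogP].
Qed.

(** Powers of such a form are the denominators that turn any form into a germ of degree 0 at x. *)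
Lemma pt_linear_form x : exists2 l : R, l \is 1.-homog & l \notin (x : prime_idealr R).
Proof.
have [i ix] := pt_relevant x; exists 'X_i => //.
by rewrite dhomogX; apply/eqP/mdeg1.
Qed.

Lemma cgerm_eq0 x a f : sfracP x a f -> a \in I ->
  (cgerm x a f = 0) <->
  exists h, [/\ homog_form h, h \notin (x : prime_idealr R) & sq_ideal X (h * a)].
Proof.
move=> hf aI; have [d [ad fd fx]] := hf; have aJ := stalk_idealP hf aI.
rewrite /cgerm -(conormal_class0 (stalk_idealr x)) conormal_piP.
rewrite !insubdK ?subr0 //; last by rewrite -topredE /= idealr0.
split.
  move=> /sq_stalkE[b [g [hg bsq /(sfrac_eq hf hg) e]]].
  have [k [_ gk gx]] := hg; exists g; split=> //; first by exists k.
  by rewrite e; exact: sq_idealMl.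
move=> [h [[k hk] hx hsq]].
have had := dhomogM hk ad; have hfd := dhomogM hk fd.
have hfx : h * f \notin (x : prime_idealr R) by rewrite notin_ptM hx.
have [c [ac cI ch]] := sq_gen_homog hsq had.
have [l l1 lx] := pt_linear_form x.
have ld i : l ^+ gdeg i \is (gdeg i).-homog by exact: linear_form_homogX.
have h1 i : sfracP x (gen i) (l ^+ gdeg i).
  by apply: sfracPI (gen_homog i) (ld i) _; exact: notin_ptX.
have h2 i : sfracP x (c i * l ^+ gdeg i) (h * f).
  apply: sfracPI _ hfd hfx; have [ci c0] := ch i.
  have [di|id] := ltnP (k + d) (gdeg i); first by rewrite c0 // mul0r dhomog0.
  by rewrite -(subnK id); exact: dhomogM.
have h3 i : sfracP x (c i * gen i) (h * f).
  apply: sfracPI _ hfd hfx; have [ci c0] := ch i.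
  have [di|id] := ltnP (k + d) (gdeg i); first by rewrite c0 // mul0r dhomog0.
  by rewrite -(subnK id); apply: dhomogM => //; exact: gen_homog.
have hf' : sfracP x (h * a) (h * f) by apply: sfracPI had hfd hfx.
have -> : sfrac x a f = sfrac x (h * a) (h * f) by apply/(sfrac_eq hf hf'); ring.
rewrite ac; have [_ <-] := sfrac_sum (index_enum _) h3 hfx (homog_formI hfd).
elim/big_rec: _ => [|i z _ hz]; first exact: sq_ideal0.
apply: sq_idealD => //.
have -> : sfrac x (c i * gen i) (h * f)
        = sfrac x (c i * l ^+ gdeg i) (h * f) * sfrac x (gen i) (l ^+ gdeg i).
  rewrite (sfracME (h2 i) (h1 i)); apply/(sfrac_eq (h3 i) (sfracMP (h2 i) (h1 i))); ring.
apply: sq_idealM; first by apply: stalk_idealP (h2 i) _; rewrite mulrC idealMr.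
by apply: stalk_idealP (h1 i) _; exact: gen_in.
Qed.

Lemma cgerm_eq x a f b g : sfracP x a f -> a \in I -> sfracP x b g -> b \in I ->
  (cgerm x a f = cgerm x b g) <->
  exists h, [/\ homog_form h, h \notin (x : prime_idealr R) &
    sq_ideal X (h * (g * a - f * b))].
Proof.
move=> ha aI hb bI; rewrite -(cgerm_eq0 (sfracBP ha hb)); last first.
  by rewrite rpredB // idealMr.
rewrite -(cgermB ha aI hb bI); split=> [->|/eqP]; first by rewrite subrr.
by rewrite subr_eq0 => /eqP.
Qed.

End ConormalGerms.

(** * Local dual bases of the conormal sheaf *)

Section LocalFrames.

Variables (K : fieldType) (n : nat) (X : subscheme K n) (F : min_free_res X).
Local Notation R := {mpoly K[n.+1]}.
Local Notation I := (X : idealr R).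
Local Notation b := (fr_rank F 0).
Local Notation gen := (@gen K n X F).
Local Notation gdeg := (@gdeg K n X F).
Local Notation syz := (@syz K n X F).
Implicit Types (x y : sub_pt X) (a f g h : R).

(* [p] represents an [R]-linear map [I -> R / I] that is homogeneous of degree [e]. *)
Definition conormal_form (e : nat) (p : R -> R) : Prop :=
  [/\ forall a a', a \in I -> a' \in I -> p (a + a') - (p a + p a') \in I,
      forall r a, a \in I -> p (r * a) - r * p a \in I &
      forall a d, a \in I -> a \is d.-homog -> p a \is (d + e).-homog].

(** Membership is assumed only after c is given, so that [choice] yields one coefficient function on
    all of R, homogeneous on the forms of I. *)
Lemma gen_coeffs_ex (a : R) : exists c : 'I_b -> R, a \in I ->
  a = \sum_i c i * gen i /\
  forall d, a \is d.-homog -> forall i,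
    c i \is (d - gdeg i).-homog /\ ((d < gdeg i)%N -> c i = 0).
Proof.
have [aI|/negP aI] := boolP (a \in I); last by exists (fun=> 0).
(* 0 is homogeneous of every degree, which forces zero coefficients. *)
have [->|a0] := eqVneq a 0.
  exists (fun=> 0); split; first by rewrite big1 // => i _; rewrite mul0r.
  by move=> d _ i; rewrite dhomog0.
have [[d ad]|noh] := pselect (exists d, a \is d.-homog).
  have [c [ac ch]] := gen_span_homog F aI ad; exists c => _; split=> // d' ad'.
  by rewrite (dhomog_uniq a0 ad' ad).
have [c ac] := (gen_span F a).1 aI; exists c => _; split=> // d ad.
by case: noh; exists d.
Qed.

(** Values on the generators that kill the syzygies modulo I define a map from I to R / I. The
    coefficients of an element are picked arbitrarily, so [p] is linear only modulo I; [pE] says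
    that other coefficients give the same value modulo I. *)
Lemma conormal_form_of (e : nat) (P : 'I_b -> R) :
  (forall i, P i \is (gdeg i + e).-homog) ->
  (forall l, \sum_i syz l i * P i \in I) ->
  exists p, conormal_form e p /\
    forall c : 'I_b -> R, p (\sum_i c i * gen i) - \sum_i c i * P i \in I.
Proof.
move=> hP PI; have /choice[c hc] := gen_coeffs_ex.
pose p a := \sum_i c a i * P i.
have pE (d : 'I_b -> R) : p (\sum_i d i * gen i) - \sum_i d i * P i \in I.
  have /hc[] : \sum_i d i * gen i \in I by apply/(gen_span F); exists d.
  rewrite /p; move: (c _) => c' e1 _.
  have /gen_syz[v hv] : \sum_i (c' i - d i) * gen i = 0.
    under eq_bigr => i _ do rewrite mulrBl.
    by rewrite sumrB -e1 subrr.
  have -> : \sum_i c' i * P i - \sum_i d i * P i = \sum_l v l * \sum_i syz l i * P i.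
    rewrite -sumrB; transitivity (\sum_i \sum_l v l * (syz l i * P i)).
      apply: eq_bigr => i _; rewrite -mulrBl hv mulr_suml.
      by apply: eq_bigr => l _; rewrite mulrA.
    by rewrite exchange_big; apply: eq_bigr => l _; rewrite mulr_sumr.
  by apply: rpred_sum => l _; apply: idealMr.
exists p; split=> //; split.
- move=> a a' /(gen_span F)[d ad] /(gen_span F)[d' ad'].
  have := pE (fun i => d i + d' i); have := pE d; have := pE d'.
  have E (g : 'I_b -> R) : \sum_i (d i + d' i) * g i = \sum_i d i * g i + \sum_i d' i * g i.
    by rewrite -big_split; apply: eq_bigr => i _; rewrite mulrDl.
  rewrite !E -ad -ad' /= => h1 h2 h3.
  set u := \sum_i _ in h2 h3; set v := \sum_i _ in h1 h3.
  have -> : p (a + a') - (p a + p a') = p (a + a') - (u + v) - (p a - u) - (p a' - v) by ring.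
  by apply: rpredB => //; apply: rpredB.
- move=> r a /(gen_span F)[d ad].
  have := pE (fun i => r * d i); have := pE d.
  have E (g : 'I_b -> R) : \sum_i r * d i * g i = r * \sum_i d i * g i.
    by rewrite mulr_sumr; apply: eq_bigr => i _; rewrite mulrA.
  rewrite !E -ad => h1 h2; set u := \sum_i _ in h1 h2.
  have -> : p (r * a) - r * p a = p (r * a) - r * u - r * (p a - u) by ring.
  by rewrite rpredB // idealMr.
move=> a d aI ad; apply: rpred_sum => i _; have [_ /(_ d ad i)[ci c0]] := hc a aI.
have [di|id] := ltnP d (gdeg i); first by rewrite c0 // mul0r dhomog0.
by rewrite -(subnK id) -addnA; exact: dhomogM.
Qed.

Lemma homog_form_prod x (T : Type) (s : seq T) (P : pred T) (g : T -> R) :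
  (forall t, homog_form (g t)) -> (forall t, g t \notin (x : prime_idealr R)) ->
  homog_form (\prod_(t <- s | P t) g t) /\
  \prod_(t <- s | P t) g t \notin (x : prime_idealr R).
Proof.
move=> gh gx; elim/big_rec: _ => [|t h _ [[e he] hx]].
  by split; [exists 0%N; exact: dhomog1|rewrite idealr1].
have [d gd] := gh t; split; first by exists (d + e)%N; exact: dhomogM.
by rewrite notin_ptM gx.
Qed.

Lemma common_denom x (T : finType) (u g : T -> R) :
  (forall t, sfracP x (u t) (g t)) ->
  exists (q : R) (d : nat) (w : T -> R), [/\ q \is d.-homog, q \notin (x : prime_idealr R),
    forall t, u t * w t \is d.-homog &
    forall t, sfrac x (u t) (g t) = sfrac x (u t * w t) q].
Proof.
move=> hu; have gh t : homog_form (g t) by have [d []] := hu t; exists d.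
have gx t : g t \notin (x : prime_idealr R) by have [d []] := hu t.
have [[d qd] qx] := homog_form_prod (index_enum T) predT gh gx.
exists (\prod_t g t), d, (fun t => \prod_(t' | t' != t) g t'); split=> //.
  move=> t; have [[e we] _] := homog_form_prod (index_enum T) (fun t' => t' != t) gh gx.
  have [k [uk gk _]] := hu t.
  have qE : \prod_t' g t' = g t * \prod_(t' | t' != t) g t' by rewrite (bigD1 t).
  have := dhomogM gk we; rewrite -qE; move=> /(dhomog_uniq (notin_pt_neq0 qx) qd) ->.
  exact: dhomogM.
move=> t; have [[e we] wx] := homog_form_prod (index_enum T) (fun t' => t' != t) gh gx.
have hw := sfracPI we we wx.
have qE : \prod_t' g t' = g t * \prod_(t' | t' != t) g t' by rewrite (bigD1 t).
rewrite qE; apply/(sfrac_eq (hu t) (sfracMP (hu t) hw)); ring.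
Qed.

(* A local dual basis of the conormal module: on the locus where [Q q] is a unit,
   the class of [a] is the sum of the [p_j(a) / Q] times [sg_j / q]. *)
Definition is_frame x (r : nat) (Q q : R) (e d : nat) (sg : 'I_r -> R) (p : 'I_r -> R -> R) :=
  [/\ Q \is e.-homog /\ Q \notin (x : prime_idealr R),
      q \is d.-homog /\ q \notin (x : prime_idealr R),
      forall j, sg j \in I /\ sg j \is d.-homog,
      forall j, conormal_form e (p j) &
      forall a, a \in I -> sq_ideal X (Q * q * a - \sum_j p j a * sg j)].

(** Write f_i / l^(deg f_i) as the sum of the (P_ij / Q) s_j. The coordinate p_j should send f_i to
    l^(deg f_i) P_ij, but this respects the syzygies only near x: there a syzygy gives a relation
    among the s_j, whose coefficients lie in the stalk of I because the sequence is regular. A form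
    [HH] nonzero at x then multiplies all of them into I. *)
Lemma lci_frame x (s : seq (stalk x)) :
  regular_seq (stalk x)^o s ->
  (forall z : stalk x, z \in stalk_idealr x <-> span_mod s (z : (stalk x)^o)) ->
  exists r Q q e d (sg : 'I_r -> R) p, is_frame x Q q e d sg p.
Proof.
move=> reg sJ; set r := size s.
have spanJ (w : nat -> stalk x) : \sum_(j < r) w j * s`_j \in stalk_idealr x.
  by apply/sJ; exists (fun j => w j); apply: eq_bigr => j _; rewrite mulrC.
have sjJ (j : 'I_r) : s`_j \in stalk_idealr x.
  have := spanJ (fun k => (k == j)%:R); rewrite (bigD1 j) //= eqxx mul1r big1 ?addr0 //.
  by move=> k /negPf kj; rewrite -val_eqE in kj; rewrite kj mul0r.
have /choice[sf hsf] : forall j : 'I_r, exists u : R * R,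
    [/\ sfracP x u.1 u.2, u.1 \in I & s`_j = sfrac x u.1 u.2].
  by move=> j; have [a [f h]] := stalk_idealE (sjJ j); exists (a, f).
have hsf1 j : sfracP x (sf j).1 (sf j).2 by have [] := hsf j.
have [q [d [w [qd qx sgd sgE]]]] := common_denom hsf1.
pose sg (j : 'I_r) : R := (sf j).1 * w j.
have sgI j : sg j \in I by have [_ h _] := hsf j; rewrite /sg mulrC idealMr.
have sE (j : 'I_r) : s`_j = sfrac x (sg j) q by have [_ _ ->] := hsf j; rewrite sgE.
have hs j : sfracP x (sg j) q := sfracPI (sgd j) qd qx.
have [l l1 lx] := pt_linear_form x.
have ld k : l ^+ k \is k.-homog by exact: linear_form_homogX.
have lkx k : l ^+ k \notin (x : prime_idealr R) := notin_ptX k lx.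
have hgen i : sfracP x (gen i) (l ^+ gdeg i) := sfracPI (gen_homog i) (ld _) (lkx _).
have /choice[z hz] : forall i, exists z : nat -> stalk x,
    sfrac x (gen i) (l ^+ gdeg i) = \sum_(j < r) z j * s`_j.
  move=> i; have /sJ[z ->] := stalk_idealP (hgen i) (gen_in i).
  exists (fun k => if insub k is Some j then z j else 0).
  by apply: eq_bigr => j _; rewrite valK mulrC.
have /choice[zf hzf] : forall t : 'I_b * 'I_r, exists u : R * R,
    sfracP x u.1 u.2 /\ z t.1 t.2 = sfrac x u.1 u.2.
  by move=> t; have [a [f h]] := sfrac_surj (z t.1 t.2); exists (a, f).
have hzf1 t : sfracP x (zf t).1 (zf t).2 by have [] := hzf t.
have [Q [e [w' [Qe Qx Ph PE]]]] := common_denom hzf1.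
pose P i (j : 'I_r) : R := (zf (i, j)).1 * w' (i, j).
have {}Ph i j : P i j \is e.-homog := Ph (i, j).
have {}PE i (j : 'I_r) : z i j = sfrac x (P i j) Q by have [_ ->] := hzf (i, j); rewrite PE.
have hP i j : sfracP x (P i j) Q := sfracPI (Ph i j) Qe Qx.
have Qqh := dhomogM Qe qd.
have Qqx : Q * q \notin (x : prime_idealr R) by rewrite notin_ptM Qx.
have genE i : Q * q * gen i = l ^+ gdeg i * \sum_j P i j * sg j.
  have [h1 h2] : sfracP x (\sum_(j < r) P i j * sg j) (Q * q) /\
      \sum_(j < r) sfrac x (P i j * sg j) (Q * q) = sfrac x (\sum_(j < r) P i j * sg j) (Q * q).
    apply: sfrac_sum => //; last exact: homog_formI Qqh.
    by move=> j; apply: sfracMP.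
  apply/(sfrac_eq (hgen i) h1); rewrite -h2 hz; apply: eq_bigr => j _.
  by rewrite PE sE sfracME.
(* The value on the [k]-th syzygy of the [j]-th coordinate before its correction by [HH]. *)
pose u k (j : 'I_r) : R := \sum_i syz k i * (l ^+ gdeg i * P i j).
have u_sum k : \sum_j u k j * sg j = 0.
  transitivity (\sum_i syz k i * (Q * q * gen i)).
    under eq_bigr => j _ do rewrite mulr_suml.
    rewrite exchange_big; apply: eq_bigr => i _ /=.
    rewrite genE !mulr_sumr; apply: eq_bigr => j _; ring.
  transitivity (Q * q * \sum_i syz k i * gen i); last by rewrite syz_gen mulr0.
  rewrite mulr_sumr; apply: eq_bigr => i _; ring.
(* By [regular_seq_free] the fraction with numerator u_kj vanishes as a germ on X, and a form [H]
   witnesses it. *)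
have /choice[H hH] : forall t : 'I_(fr_rank F 1) * 'I_r, exists h : R,
    [/\ homog_form h, h \notin (x : prime_idealr R) & h * u t.1 t.2 \in I].
  move=> [k j] /=; case ke : (fr_shift k) => [m|m]; last first.
    exists 1; rewrite idealr1; split=> //; first by exists 0%N; exact: dhomog1.
    rewrite /u big1 ?mulr0 ?idealr0 // => i _; by rewrite (syz_neg i ke) mul0r.
  have uh j' : u k j' \is (m + e).-homog.
    apply: rpred_sum => i _; have [sh s0] := syz_homog i ke.
    have [mi|im] := ltnP m (gdeg i); first by rewrite s0 // mul0r dhomog0.
    by rewrite -(subnK im) -addnA; apply: dhomogM => //; exact: dhomogM.
  have Dh : l ^+ m * Q \is (m + e).-homog := dhomogM (ld m) Qe.
  have Dx : l ^+ m * Q \notin (x : prime_idealr R) by rewrite notin_ptM lkx.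
  have hu j' : sfracP x (u k j') (l ^+ m * Q) := sfracPI (uh j') Dh Dx.
  have Eh : l ^+ m * Q * q \is (m + e + d).-homog := dhomogM Dh qd.
  have Ex : l ^+ m * Q * q \notin (x : prime_idealr R) by rewrite notin_ptM Dx.
  pose a i := if insub i is Some j' then sfrac x (u k j') (l ^+ m * Q) else 0.
  have sum0 : \sum_(i < size s) a i * s`_i = 0.
    have [h1 h2] := sfrac_sum (index_enum 'I_r) (fun j' => sfracMP (hu j') (hs j'))
      Ex (homog_formI Eh).
    transitivity (sfrac x (\sum_(j' < r) u k j' * sg j') (l ^+ m * Q * q)).
      rewrite -h2; apply: eq_bigr => j' _; rewrite /a valK sE sfracME //.
    rewrite u_sum -(sfrac0 x).
    by apply/(sfrac_eq _ (sfrac0P x)); [rewrite -(u_sum k)|ring].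
  have [v] := regular_seq_free reg sum0 (ltn_ord j); rewrite /a valK => av.
  have : ogerm x (u k j) (l ^+ m * Q) = 0.
    rewrite /ogerm -(rmorph0 (local_pi x)); apply/eqP; rewrite /= -Quotient.idealrBE subr0.
    by rewrite av; exact: spanJ.
  by move=> /(ogerm_eq0 (hu j))[h []]; exists h.
have Hh t : homog_form (H t) by have [] := hH t.
have Hx t : H t \notin (x : prime_idealr R) by have [] := hH t.
have [[m Hm] Hxx] := homog_form_prod (index_enum _) predT Hh Hx.
set HH := \prod_(t <- _ | _) _ in Hm Hxx.
have /choice[p hp] : forall j, exists p, conormal_form (m + e) p /\
    forall c : 'I_b -> R, p (\sum_i c i * gen i) - \sum_i c i * (HH * (l ^+ gdeg i * P i j)) \in I.
  move=> j; apply: conormal_form_of => [i|k].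
    by rewrite addnCA; apply: dhomogM => //; exact: dhomogM.
  have -> : \sum_i syz k i * (HH * (l ^+ gdeg i * P i j)) = HH * u k j.
    rewrite /u mulr_sumr; apply: eq_bigr => i _; ring.
  rewrite /HH (bigD1 (k, j)) //= mulrAC mulrC; apply: idealMr.
  by have [_ _] := hH (k, j).
exists r, (HH * Q), q, (m + e)%N, d, sg, p; split=> //.
- by rewrite notin_ptM Hxx; split=> //; exact: dhomogM.
- by move=> j; split=> //; exact: sgd.
- by move=> j; have [] := hp j.
move=> a /(gen_span F)[c ->].
(* The difference is a sum of errors of the [p j], which lie in I, times the elements [sg j] of
   I. *)
have -> : HH * Q * q * (\sum_i c i * gen i) - \sum_j p j (\sum_i c i * gen i) * sg j =
   - \sum_j (p j (\sum_i c i * gen i) - \sum_i c i * (HH * (l ^+ gdeg i * P i j))) * sg j.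
  have -> (A B : 'I_r -> R) : \sum_j (A j - B j) * sg j = \sum_j A j * sg j - \sum_j B j * sg j.
    by rewrite -sumrB; apply: eq_bigr => j _; rewrite mulrBl.
  rewrite opprB; congr (_ - _).
  transitivity (\sum_i \sum_j c i * (HH * (l ^+ gdeg i * P i j)) * sg j).
    rewrite mulr_sumr; apply: eq_bigr => i _.
    transitivity (c i * HH * (Q * q * gen i)); first by ring.
    rewrite genE !mulr_sumr; apply: eq_bigr => j _; ring.
  by rewrite exchange_big; apply: eq_bigr => j _; rewrite mulr_suml.
rewrite -sub0r; apply: sq_idealB; first exact: sq_ideal0.
apply: (graded_ideal_sum _ (sq_ideal_graded X)) => j _; apply: sq_idealM => //.
by have [_] := hp j; apply.
Qed.

End LocalFrames.

(** * Duality between endomorphisms *)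

Section SheafMorphisms.

Variables (K : fieldType) (n : nat) (X : subscheme K n).

Section Basics.

Variables (A B : omod X) (U : opens X) (f : hom_on A B U).

Lemma hom_irr V (h k : osub V U) s : f V h s = f V k s.
Proof. by rewrite (Prop_irrelevance h k). Qed.

Lemma homD V (h : osub V U) s t : f V h (s + t) = f V h s + f V h t.
Proof. by have := hom_linear f h 1 s t; rewrite !scale1r. Qed.

Lemma hom0 V (h : osub V U) : f V h 0 = 0.
Proof. by apply: (addrI (f V h 0)); rewrite -homD !addr0. Qed.

Lemma homZ V (h : osub V U) a s : f V h (a *: s) = a *: f V h s.
Proof. by have := hom_linear f h a s 0; rewrite !addr0 hom0 addr0. Qed.

Lemma hom_sum V (h : osub V U) (J : Type) (r : seq J) (s : J -> A V) :
  f V h (\sum_(i <- r) s i) = \sum_(i <- r) f V h (s i).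
Proof.
by elim: r => [|i r IH]; rewrite ?big_nil ?hom0 // !big_cons homD IH.
Qed.

Lemma res_sum V (h : osub V U) (J : Type) (r : seq J) (s : J -> A U) :
  res h (\sum_(i <- r) s i) = \sum_(i <- r) res h (s i).
Proof.
elim: r => [|i r IH]; first by rewrite !big_nil res0.
by rewrite !big_cons resD IH.
Qed.

End Basics.

Lemma hom_sum_fun (A B : omod X) U V (h : osub V U) (J : Type) (r : seq J)
  (f : J -> hom_on A B U) s :
  (\sum_(i <- r) f i) V h s = \sum_(i <- r) f i V h s.
Proof. by elim: r => [|i r IH]; rewrite ?big_nil // !big_cons -IH. Qed.

Program Definition hom_comp (A B C : omod X) U (g : hom_on B C U) (f : hom_on A B U) :
  hom_on A C U := @HomOn K n X A C U (fun V h s => g V h (f V h s)) _ _.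
Next Obligation. by rewrite !hom_linear. Qed.
Next Obligation. by rewrite (hom_natural g h k l) (hom_natural f h k l). Qed.

Definition hom_id (A : omod X) (U : opens X) : hom_on A A U :=
  @HomOn K n X A A U (fun V h s => s) (fun _ _ _ _ _ => erefl) (fun _ _ _ _ _ _ => erefl).

Section Transport.

Variables (C G : omod X).
Local Notation H := (sheaf_hom C G).
Variable psi : hom_on H H (openT X).

Definition osubT (W : opens X) : osub W (openT X) := fun _ _ => I.
Arguments osubT : clear implicits.

(* [e'] is the image of [e] under the endomorphism of [C] dual to [psi]. *)
Definition dual_image (W : opens X) (e e' : C W) : Prop :=
  forall (W' : opens X) (h : osub W' W) (eps : hom_on C G W'),
    (psi W' (osubT W') eps : hom_on C G W') W' (@osub_refl K n X W') (res h e)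
    = eps W' (@osub_refl K n X W') (res h e').

Lemma dual_image_res W V (h : osub V W) e e' :
  dual_image e e' -> dual_image (res h e) (res h e').
Proof.
move=> he W' k eps; rewrite !(res_comp h k (osub_trans k h)); exact: he.
Qed.

Lemma dual_image_linear W a (e1 e1' e2 e2' : C W) :
  dual_image e1 e1' -> dual_image e2 e2' -> dual_image (a *: e1 + e2) (a *: e1' + e2').
Proof. by move=> h1 h2 W' h eps; rewrite !resD !resZ !homD !homZ h1 h2. Qed.

Lemma dual_image0 W : dual_image (0 : C W) 0.
Proof. by move=> W' h eps; rewrite !res0 !hom0. Qed.

Lemma dual_imageZ W a (e e' : C W) : dual_image e e' -> dual_image (a *: e) (a *: e').
Proof.
move=> h; rewrite -[a *: e]addr0 -[a *: e']addr0.
by apply: dual_image_linear => //; exact: dual_image0.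
Qed.

Lemma dual_image_sum W (J : Type) (r : seq J) (e e' : J -> C W) :
  (forall i, dual_image (e i) (e' i)) ->
  dual_image (\sum_(i <- r) e i) (\sum_(i <- r) e' i).
Proof.
move=> h; elim: r => [|i r IH]; first by rewrite !big_nil; exact: dual_image0.
rewrite !big_cons -[e i]scale1r -[e' i]scale1r; exact: dual_image_linear.
Qed.

Section DualBasis.

Local Notation O := (structure_sheaf X).
Variables (V : opens X) (r : nat) (e : 'I_r -> C V) (p : 'I_r -> hom_on C O V).
Hypothesis dual_basis : forall W (h : osub W V) (s : C W),
  s = \sum_j (p j W h s : osec W) *: res h (e j).
Variables (al : hom_on G O V) (be : hom_on O G V).
Hypothesis albe : forall W (h : osub W V), cancel (al W h) (be W h) /\ cancel (be W h) (al W h).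

Let eps j : hom_on C G V := hom_comp be (p j).

(** The coordinates p_j, followed by the trivialization of G, are morphisms eps_j to G that separate
    the sections of C, and eps_j(s) = psi(eps_j)(0) = 0. *)
Lemma dual_image_unique W (h : osub W V) (s : C W) : dual_image 0 s -> s = 0.
Proof.
move=> hs; rewrite (dual_basis h s) big1 // => j _.
suff -> : p j W h s = 0 by rewrite scale0r.
have [_ bea] := albe h; apply: (can_inj bea); rewrite hom0.
have := hs W (@osub_refl _ _ _ W) (hom_res h (eps j)).
rewrite res0 hom0 res_id => e0; rewrite [RHS]e0 /=.
set k := osub_trans _ _; by rewrite (hom_irr be h k) (hom_irr (p j) h k).
Qed.

(** The transpose of psi in the dual basis: s' is the sum of the psi(eps_j)(s) e_j, where [al] reads
    sections of G as functions. *)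
Lemma dual_image_exists W (h : osub W V) (s : C W) : exists s', dual_image s s'.
Proof.
pose t j : G W := (psi V (osubT V) (eps j) : hom_on C G V) W h s.
exists (\sum_j (al W h (t j) : osec W) *: res h (e j)) => W' k ep.
pose kh := osub_trans k h; pose id' := @osub_refl K n X W'.
pose c j : osec W' := al W' kh (ep W' id' (res kh (e j))).
have [albeK bealK] := albe kh.
have beZ (a : osec W') (u : O W') : be W' kh (a *: u) = a *: be W' kh u by exact: homZ.
(* The eps_j generate the morphisms to G: the coordinates of [ep] are its values on the [e j]. *)
have E1 : ep = \sum_j c j *: (hom_res kh (eps j) : H W').
  apply: hom_ext => Y m u; rewrite hom_sum_fun.
  have my := osub_trans m kh.
  rewrite {1}(dual_basis my u) hom_sum; apply: eq_bigr => j _.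
  rewrite homZ /=.
  have -> : res my (e j) = res m (res kh (e j)) by rewrite (res_comp kh m my).
  rewrite -(hom_natural ep id' m m) (hom_irr be _ my) (hom_irr (p j) _ my).
  rewrite -[ep W' id' _]albeK -/(c j).
  rewrite (hom_natural be kh m my) -!homZ; congr (be Y my _).
  by rewrite (homZ (p j)); exact: mulrC.
have E2 : psi W' (osubT W') ep = \sum_j c j *: (hom_res kh (psi V (osubT V) (eps j)) : H W').
  rewrite {1}E1 hom_sum; apply: eq_bigr => j _; rewrite homZ; congr (_ *: _).
  by rewrite -(hom_natural psi (osubT V) kh (osubT W')).
rewrite E2 hom_sum_fun res_sum hom_sum; apply: eq_bigr => j _.
rewrite resZ homZ (res_comp h k kh) /= osec_res_id.
have -> : osec_res k (al W h (t j)) = al W' kh (res k (t j)).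
  exact: (hom_natural al h k kh).
have -> : (psi V (osubT V) (eps j) : hom_on C G V) W' (osub_trans (osub_refl (U:=W')) kh) (res k s)
   = res k (t j).
  by rewrite /t (hom_natural _ h k (osub_trans (osub_refl (U:=W')) kh)).
(* Each side is the image under [be] of a product of the same two functions, in opposite orders. *)
rewrite -[res k (t j) in LHS]albeK -[ep W' _ _]albeK -/(c j) -!beZ; congr (be W' kh _).
exact: mulrC.
Qed.

End DualBasis.

End Transport.

End SheafMorphisms.
Arguments osubT {K n X} W.

(** * Sections given by fractions *)

Section GermSections.

Variables (K : fieldType) (n : nat) (X : subscheme K n).
Local Notation R := {mpoly K[n.+1]}.

Fact basic_open_subproof (f : R) : homog_form f ->
  is_open (fun x : sub_pt X => f \notin (x : prime_idealr R)).
Proof.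
move=> fh; exists (fun g => g = f); split=> [_ -> //|x].
by split=> [fx|[g [->]] //]; exists f.
Qed.

Definition basic_open (f : R) (fh : homog_form f) : opens X := Opens (basic_open_subproof fh).

(** The linear factor in the witness kills the constant term, as the Nullstellensatz demands. *)
Lemma open_basic (U : opens X) (x : sub_pt X) : U x ->
  exists f, [/\ homog_form f, f@_0%MM = 0, f \notin (x : prime_idealr R) &
    forall y : sub_pt X, f \notin (y : prime_idealr R) -> U y].
Proof.
have [S [Sh US]] := osetP U; move=> /US[f [Sf fx]].
have [l l1 lx] := pt_linear_form x; have [d fd] := Sh f Sf.
exists (l * f); split.
- by exists (1 + d)%N; exact: dhomogM.
- have m0 : mdeg (0%MM : 'X_{1..n.+1}) != 1%N by rewrite mdeg0.
  by rewrite (mcoeff0_is_multiplicative _ _).1 (dhomog_nemf_coeff l1 m0) mul0r.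
- by rewrite notin_ptM lx.
by move=> y; rewrite notin_ptM => /andP[_ fy]; apply/US; exists f.
Qed.

Lemma osubIl (U V : opens X) : osub (openI U V) U. Proof. by move=> x []. Qed.
Lemma osubIr (U V : opens X) : osub (openI U V) V. Proof. by move=> x []. Qed.

Section Fractions.

Variable T : germs X.

Fact gfrac_subproof (U : opens X) m f : (forall y, U y -> g_frac (g := T) y m f) ->
  is_gsec (fun y : opt U => g_germ (sval y) m f).
Proof. by move=> h x; exists U, m, f; split=> [|y Uy]; [exact: svalP|split=> //; exact: h]. Qed.

Definition gfrac (U : opens X) m f (h : forall y, U y -> g_frac (g := T) y m f) : gsec T U :=
  GSec (gfrac_subproof h).

Lemma gsec_local (U : opens X) (s : gsec T U) (x : sub_pt X) : U x ->
  exists (V : opens X) (h : osub V U) m f (H : forall y, V y -> g_frac (g := T) y m f),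
    V x /\ gsec_res h s = gfrac H.
Proof.
move=> Ux; have [V [m [f [Vx sV]]]] := gsecP s (exist _ x Ux).
have H y : openI U V y -> g_frac (g := T) y m f.
  by move=> [Uy Vy]; have [] := sV (exist _ y Uy) Vy.
exists (openI U V), (@osubIl U V), m, f, H; split; first by split.
apply: gsec_ext => -[y [Uy Vy]] /=; rewrite /opt_incl /=.
by have [_ <-] := sV (exist _ y Uy) Vy; rewrite (Prop_irrelevance (osubIl _) Uy).
Qed.

Lemma gsec_cover (U : opens X) (s t : gsec T U) :
  (forall x, U x -> exists (V : opens X) (h : osub V U), V x /\ gsec_res h s = gsec_res h t) ->
  s = t.
Proof.
move=> st; apply: gsec_ext => -[x Ux]; have [V [h [Vx e]]] := st x Ux.
have := congr1 (fun s' : gsec T V => s' (exist _ x Vx)) e; rewrite /= /opt_incl /=.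
by rewrite (Prop_irrelevance (h _ _) Ux).
Qed.

Lemma gsecBE (U : opens X) (s t : gsec T U) x : (s - t) x = s x - t x.
Proof. by rewrite gsecDE -[(- t) x]/(0 - t x) sub0r. Qed.

Lemma gsec_sumE (U : opens X) (J : Type) (r : seq J) (s : J -> gsec T U) x :
  (\sum_(i <- r) s i) x = \sum_(i <- r) s i x.
Proof.
elim: r => [|i r IH]; first by rewrite !big_nil.
by rewrite !big_cons gsecDE IH.
Qed.

End Fractions.

Fact ofrac_subproof (U : opens X) a f : (forall y, U y -> sfracP y a f) ->
  is_osec (fun y : opt U => ogerm (sval y) a f).
Proof. by move=> h x; exists U, a, f; split=> [|y Uy]; [exact: svalP|split=> //; exact: h]. Qed.

Definition ofrac (U : opens X) a f (h : forall y, U y -> sfracP y a f) : osec U :=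
  OSec (ofrac_subproof h).

End GermSections.

Section ConormalSections.

Variables (K : fieldType) (n : nat) (X : subscheme K n).
Local Notation R := {mpoly K[n.+1]}.
Local Notation I := (X : idealr R).
Local Notation C := (conormal_sheaf X).
Local Notation O := (structure_sheaf X).

Definition conormal_germs : germs X :=
  Germs (g_stalk := fun x => conormal (stalk_idealr x))
    (@conormal_zero K n X) (@conormal_sub K n X) (@conormal_frac_scale K n X).

Definition cfracP (x : sub_pt X) (a f : R) : Prop := sfracP x a f /\ a \in I.

Lemma conormal_g_frac (x : sub_pt X) a f :
  g_frac (g := conormal_germs) x a f <-> cfracP x a f.
Proof.
split=> [[d [[ad aI] fd fx]]|[[d [ad fd fx]] aI]]; last by exists d.
by split=> //; exists d.
Qed.

Definition csec (U : opens X) a f (h : forall y, U y -> cfracP y a f) : C U :=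
  gfrac (T := conormal_germs) (fun y Uy => (conormal_g_frac y a f).2 (h y Uy)).

Lemma csecE (U : opens X) a f (h : forall y, U y -> cfracP y a f) (y : opt U) :
  (csec h : gsec conormal_germs U) y = cgerm (sval y) a f.
Proof. by []. Qed.

Lemma csec_res (U V : opens X) (k : osub V U) a f (h : forall y, U y -> cfracP y a f)
  (h' : forall y, V y -> cfracP y a f) : res k (csec h) = csec h'.
Proof. exact: gsec_ext. Qed.

Lemma csec_local (U : opens X) (s : C U) (x : sub_pt X) : U x ->
  exists (V : opens X) (h : osub V U) a f (H : forall y, V y -> cfracP y a f),
    V x /\ res h s = csec H.
Proof.
move=> /(gsec_local (s : gsec conormal_germs U))[V [h [a [f [H [Vx e]]]]]].
exists V, h, a, f, (fun y Vy => (conormal_g_frac y a f).1 (H y Vy)); split=> //.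
by rewrite [LHS]e; apply: gsec_ext.
Qed.

Section FormMorphism.

Variables (F : min_free_res X) (e : nat) (p : R -> R) (Q : R).
Hypotheses (hp : conormal_form X e p) (Qe : Q \is e.-homog).

(** Modulo I, p(bc) equals b p(c), and b lies in I. So p factors through I / I^2. *)
Lemma conormal_form_sq a : sq_ideal X a -> p a \in I.
Proof.
have [hD hZ _] := hp; move=> [s [sX ->]].
elim: s sX => [|[b c] s IHs] sX.
  rewrite big_nil; have := hZ 0 0 (idealr0 _); rewrite !mul0r subr0; exact.
rewrite big_cons /=; have [/= bX cX] := sX _ (mem_head _ _).
have sX' bc : bc \in s -> bc.1 \in I /\ bc.2 \in I.
  by move=> bcs; apply: sX; rewrite inE bcs orbT.
have sI : \sum_(bc <- s) bc.1 * bc.2 \in I.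
  by rewrite big_seq; apply: rpred_sum => bc /sX'[_]; exact: idealMr.
have h1 := hD _ _ (idealMr b cX) sI; have h2 := hZ b c cX.
set t := \sum_(_ <- _) _ in h1 *; have h3 : p t \in I := IHs sX'.
have -> : p (b * c + t) =
  (p (b * c + t) - (p (b * c) + p t)) + (p (b * c) - b * p c) + p t + p c * b by ring.
by apply: rpredD; [apply: rpredD => //; exact: rpredD|exact: idealMr].
Qed.

Lemma form_sfracP (y : sub_pt X) a f : Q \notin (y : prime_idealr R) ->
  cfracP y a f -> sfracP y (p a) (Q * f).
Proof.
move=> Qy [[d [ad fd fy]] aI]; have [_ _ hh] := hp.
apply: sfracPI (hh _ _ aI ad) _ _; first by rewrite addnC; exact: dhomogM.
by rewrite notin_ptM Qy.
Qed.

Lemma form_comb a b u v : a \in I -> b \in I ->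
  p (u * a - v * b) - (u * p a - v * p b) \in I.
Proof.
have [hD hZ _] := hp => aI bI.
have h1 := hD _ _ (idealMr u aI) (idealMr (- v) bI).
have h2 := hZ u a aI; have h3 := hZ (- v) b bI.
have -> : u * a - v * b = u * a + - v * b by ring.
set t := p (u * a + - v * b) in h1 *.
have -> : t - (u * p a - v * p b) =
  (t - (p (u * a) + p (- v * b))) + (p (u * a) - u * p a) + (p (- v * b) - - v * p b) by ring.
by apply: rpredD => //; exact: rpredD.
Qed.

Lemma form_germ_eq (y : sub_pt X) a f b g : Q \notin (y : prime_idealr R) ->
  cfracP y a f -> cfracP y b g -> cgerm y a f = cgerm y b g ->
  ogerm y (p a) (Q * f) = ogerm y (p b) (Q * g).
Proof.
move=> Qy ha hb; have [hfa aI] := ha; have [hgb bI] := hb.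
move=> /(cgerm_eq F hfa aI hgb bI)[h [hh hy hsq]].
apply: (ogerm_eq (form_sfracP Qy ha) (form_sfracP Qy hb) hh hy).
have h1 := conormal_form_sq hsq; have h2 := form_comb (h * g) (h * f) aI bI.
have e1 : h * (g * a - f * b) = h * g * a - h * f * b by ring.
rewrite e1 in h1.
have -> : h * (Q * g * p a - Q * f * p b) =
   Q * (p (h * g * a - h * f * b) - (p (h * g * a - h * f * b) - (h * g * p a - h * f * p b))).
  by ring.
by apply/idealMr/rpredB.
Qed.

(** The germ a / f goes to p(a) / (Q f), the degree of Q compensating that of p. The representative
    is arbitrary, harmlessly so by [form_germ_eq] where Q is nonzero; 0 is a default value. *)
Definition form_stalk (y : sub_pt X) (q : conormal (stalk_idealr y)) : local_ring y :=
  if pselect (exists u : R * R, cfracP y u.1 u.2 /\ q = cgerm y u.1 u.2) is left h then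
    ogerm y (p (sval (cid h)).1) (Q * (sval (cid h)).2)
  else 0.

Lemma form_stalkE (y : sub_pt X) a f : Q \notin (y : prime_idealr R) ->
  cfracP y a f -> form_stalk (cgerm y a f) = ogerm y (p a) (Q * f).
Proof.
move=> Qy h; rewrite /form_stalk; case: pselect => [h'|[]]; last by exists (a, f).
by case: cid => -[b g] /= [hb e']; apply: form_germ_eq.
Qed.

End FormMorphism.
End ConormalSections.

Section FormMorphisms.

Variables (K : fieldType) (n : nat) (X : subscheme K n).
Local Notation R := {mpoly K[n.+1]}.
Local Notation I := (X : idealr R).
Local Notation C := (conormal_sheaf X).
Local Notation O := (structure_sheaf X).
Local Notation csections := (gsec (conormal_germs X)).
Variables (F : min_free_res X) (e : nat) (p : R -> R) (Q : R).
Hypotheses (hp : conormal_form X e p) (Qe : Q \is e.-homog).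

Lemma form_stalk_linear (y : sub_pt X) (c : local_ring y) (s t : conormal (stalk_idealr y)) :
  Q \notin (y : prime_idealr R) ->
  form_stalk p Q (c *: s + t) = c * form_stalk p Q s + form_stalk p Q t.
Proof.
move=> Qy; have [u [v [huv ->]]] := ogerm_surj c.
have [a [f [ha aI ->]]] := cgerm_surj s; have [b [g [hb bI ->]]] := cgerm_surj t.
have hua := sfracMP huv ha; have uaI : u * a \in I by exact: idealMr.
rewrite (cgermZ huv ha aI) (cgermD hua uaI hb bI).
have hS := sfracDP hua hb.
have SI : g * (u * a) + v * f * b \in I by apply: rpredD; exact: idealMr.
rewrite !(form_stalkE F hp Qe Qy) //.
have ka := form_sfracP hp Qe Qy (conj ha aI); have kb := form_sfracP hp Qe Qy (conj hb bI).
have kS := form_sfracP hp Qe Qy (conj hS SI).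
rewrite (ogermM huv ka) (ogermD (sfracMP huv ka) kb).
apply: (ogerm_eq (h := 1) kS (sfracDP (sfracMP huv ka) kb)).
- by exists 0%N; exact: dhomog1.
- by rewrite idealr1.
have := form_comb hp (g * u) (- (v * f)) aI bI.
have -> : g * u * a - - (v * f) * b = g * (u * a) + v * f * b by ring.
set t' := p _ => hI.
have -> : 1 * (v * (Q * f) * (Q * g) * t' -
     Q * (v * f * g) * (Q * g * (u * p a) + v * (Q * f) * p b)) =
   (v * Q * f * Q * g) * (t' - (g * u * p a - - (v * f) * p b)) by ring.
exact: idealMr.
Qed.

Section OnOpen.

Variables (V : opens X).
Hypothesis QV : forall y, V y -> Q \notin (y : prime_idealr R).

Fact form_sec_subproof W (h : osub W V) (s : csections W) :
  is_osec (fun y : opt W => form_stalk p Q (s y)).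
Proof.
move=> [x Wx]; have [W' [k [a [f [H [W'x es]]]]]] := csec_local (s : C W) Wx.
exists W', (p a), (Q * f); split=> // -[y Wy] /= W'y.
have Qy := QV (h _ Wy); have hy := H _ W'y.
split; first exact: (form_sfracP hp Qe Qy hy).
have := congr1 (fun s' : csections W' => s' (exist _ y W'y)) es.
rewrite /= /opt_incl /= (Prop_irrelevance (k _ _) Wy) => ->.
exact: (form_stalkE F hp Qe Qy hy).
Qed.

Definition form_sec W (h : osub W V) (s : C W) : O W := OSec (form_sec_subproof h s).

Fact form_sec_linear W (h : osub W V) a s t :
  form_sec h (a *: s + t) = a *: form_sec h s + form_sec h t.
Proof.
apply: osec_ext => y; rewrite [RHS]osecDE.
rewrite -[LHS]/(form_stalk p Q ((a *: (s : csections W) + t) y)) gsecDE gsecZE.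
exact: (form_stalk_linear _ _ _ (QV (h _ (svalP y)))).
Qed.

Fact form_sec_natural W W' (h : osub W V) (k : osub W' W) (l : osub W' V) (s : C W) :
  res k (form_sec h s) = form_sec l (res k s).
Proof. exact: osec_ext. Qed.

Definition form_hom : hom_on C O V :=
  @HomOn K n X C O V form_sec form_sec_linear form_sec_natural.

End OnOpen.

End FormMorphisms.

Section FrameDualBasis.

Variables (K : fieldType) (n : nat) (X : subscheme K n) (F : min_free_res X).
Local Notation R := {mpoly K[n.+1]}.
Local Notation I := (X : idealr R).
Local Notation C := (conormal_sheaf X).
Local Notation O := (structure_sheaf X).
Local Notation csections := (gsec (conormal_germs X)).

(** Divide the congruence of Q q a with the sum of the p_j(a) sg_j by Q q f: this expresses a / f
    through the sections sg_j / q wherever Q and q are nonzero. *)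
Lemma frame_dual_basis (x : sub_pt X) r Q q e d (sg : 'I_r -> R) p (U : opens X) :
  is_frame x Q q e d sg p -> U x ->
  exists (V : opens X) (k : osub V U) (ej : 'I_r -> C V) (pj : 'I_r -> hom_on C O V),
    V x /\ forall W (h : osub W V) (s : C W),
      s = \sum_j (pj j W h s : osec W) *: res h (ej j).
Proof.
move=> [[Qe Qx] [qd qx] hsg hp hQq] Ux.
pose V := openI U (openI (basic_open X (homog_formI Qe)) (basic_open X (homog_formI qd))).
have QV y : V y -> Q \notin (y : prime_idealr R) by move=> [_ []].
have qV y : V y -> q \notin (y : prime_idealr R) by move=> [_ []].
have hV j y : V y -> cfracP y (sg j) q.
  by move=> /qV qy; have [sI sd] := hsg j; split=> //; exact: sfracPI sd qd qy.
exists V, (@osubIl _ _ _ _ _), (fun j => csec (hV j)), (fun j => form_hom F (hp j) Qe QV).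
split=> // W h s; apply: gsec_ext => -[y Wy].
rewrite gsec_sumE; have Vy := h _ Wy; have Qy := QV y Vy; have qy := qV y Vy.
have [a [f [ha aI sy]]] := cgerm_surj ((s : csections W) (exist _ y Wy)).
have hj j : cfracP y (sg j) q := hV j y Vy.
transitivity (\sum_j cgerm y (p j a * sg j) (Q * f * q)).
  have hpj j := form_sfracP (hp j) Qe Qy (conj ha aI).
  have [k [ak fk fy]] := ha.
  have Dh : Q * f * q \is (e + k + d).-homog by do 2!apply: dhomogM => //.
  have Dy : Q * f * q \notin (y : prime_idealr R) by rewrite !notin_ptM Qy fy.
  rewrite (cgerm_sum _ _ _ Dy (homog_formI Dh)); last 2 first.
  - by move=> j; exact: sfracMP (hpj j) (hj j).1.
  - by move=> j; rewrite idealMr // (hsg j).1.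
  have hSj j : sfracP y (p j a * sg j) (Q * f * q) := sfracMP (hpj j) (hj j).1.
  have [hS _] := sfrac_sum (index_enum _) hSj Dy (homog_formI Dh).
  have SI : \sum_j p j a * sg j \in I.
    by apply: rpred_sum => j _; rewrite idealMr // (hsg j).1.
  rewrite [LHS]sy; apply/(cgerm_eq F ha aI hS SI); exists f; split=> //; first by exists k.
  have -> : f * (Q * f * q * a - f * \sum_j p j a * sg j) =
    f * f * (Q * q * a - \sum_j p j a * sg j) by ring.
  by apply: sq_idealMl; exact: hQq.
apply: eq_bigr => j _; rewrite gsecZE [RHS]/=.
have -> : form_stalk (p j) Q ((s : csections W) (exist _ y Wy)) = ogerm y (p j a) (Q * f).
  by rewrite sy (form_stalkE F (hp j) Qe Qy).
have := cgermZ (form_sfracP (hp j) Qe Qy (conj ha aI)) (hj j).1 (hj j).2.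
by move=> <-.
Qed.

End FrameDualBasis.

(** * Local vanishing, and torsion in the sheaf of L *)

Section Vanishing.

Variables (K : fieldType) (n : nat) (X : subscheme K n).
Local Notation R := {mpoly K[n.+1]}.
Local Notation I := (X : idealr R).

(** The Nullstellensatz for the colon ideal (I^2 : b), which contains I because b lies in I, trades
    one multiplier per point for a single power of g. *)
Lemma germs_vanish_sq (b g : R) d : b \in I -> b \is d.-homog -> g@_0%MM = 0 ->
  (forall y : sub_pt X, g \notin (y : prime_idealr R) ->
     exists h, h \notin (y : prime_idealr R) /\ sq_ideal X (h * b)) ->
  exists N, sq_ideal X (g ^+ N * b).
Proof.
move=> bI bd g0 hb; have [J0 JD JM Jh] := sq_ideal_graded X.
apply: (@projective_nullstellensatz _ _ X (fun a => sq_ideal X (a * b))) => //.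
- split.
  + by rewrite mul0r.
  + by move=> a c ha hc; rewrite mulrDl; exact: JD.
  + by move=> c a ha; rewrite -mulrA; exact: JM.
  + move=> a i ha; rewrite mulrC -(pihomogMl _ _ bd) mulrC; exact: Jh.
- by move=> a aI; exact: sq_idealM.
move=> y hy; apply: contrapT => /negP /hb[h [hy' /hy hin]].
by rewrite hin in hy'.
Qed.

Variables (L : lmodType (coord_ring X)) (gL : grading (rscal (coord_pi X) L)).
Local Notation LR := (rscal (coord_pi X) L).

Lemma frac_eq0 (y : sub_pt X) (u : LR) f : is_frac gL y u f ->
  Defs.frac gL y u f = 0 -> exists h, h \notin (y : prime_idealr R) /\ h *: u = 0.
Proof.
move=> hu; rewrite (fracE hu) => /hloc_piP/asboolP[h [_ [hy /= e]]].
by exists h; split=> //; move: e; rewrite !scaler0 scale1r.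
Qed.

Lemma annihilator_graded d (u : LR) : gL d u -> graded_ideal (fun a : R => a *: u = 0).
Proof.
move=> ud; split=> [|a b ha hb|c a ha|a i ha].
- by rewrite scale0r.
- by rewrite scalerDl ha hb addr0.
- by rewrite -scalerA ha scaler0.
pose k := mmeasure mdeg a.
have [ki|ik] := leqP k i.
  rewrite (_ : pihomog mdeg i a = 0) ?scale0r //.
  rewrite [a in LHS](@pihomog_partitionE _ _ mdeg k a (leqnn _)) raddf_sum big1 // => j _ /=.
  rewrite (pihomog_ne0 _ (pihomogP mdeg j a)) // ltn_eqF // (leq_trans (ltn_ord j)) //.
(* The component of [a *: u] in degree [z], so that directness of the grading applies. *)
pose c (z : int) : LR := if (z - d) is Posz j then pihomog mdeg j a *: u else 0.
have hc z : gL z (c z).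
  rewrite /c; case e : (z - d) => [j|j]; last exact: gcomp0.
  have -> : z = d + j by rewrite -e addrC subrK.
  exact: gcompZ (pihomogP _ _ _) ud.
have cE j : c (d + j%:Z) = pihomog mdeg j a *: u by rewrite /c addrC addKr.
have us : uniq [seq d + j%:Z | j <- iota 0 k].
  by rewrite map_inj_uniq ?iota_uniq // => i1 i2 /addrI [].
have sum0 : \sum_(z <- [seq d + j%:Z | j <- iota 0 k]) c z = 0.
  rewrite big_map; under eq_bigr => j _ do rewrite cE.
  have -> : iota 0 k = index_iota 0 k by rewrite /index_iota subn0.
  rewrite big_mkord -scaler_suml.
  by rewrite -(@pihomog_partitionE _ _ mdeg k a (leqnn _)).
rewrite -cE; apply: (gcomp_direct us hc sum0).
by apply/mapP; exists i => //; rewrite mem_iota.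
Qed.

Definition tilde_germs : germs X :=
  Germs (g_stalk := tilde_stalk gL) (@tilde_zero K n X L gL)
    (fun x m f m' f' => @fracB K n _ gL x m f m' f') (@tilde_scale K n X L gL).

(** Locally m is u / f on the locus of a form g. Some (r g)^N kills u, by the Nullstellensatz for
    its annihilator; r^N cancels by regularity, and g is invertible there. *)
Lemma tilde_torsion (r : R) (W : opens X) (m : tilde gL W) :
  r@_0%MM = 0 -> (forall v : LR, r *: v = 0 -> v = 0) ->
  (forall y : opt W, r \notin (sval y : prime_idealr R) ->
     (m : gsec tilde_germs W) y = 0) -> m = 0.
Proof.
move=> r0 rreg hm; apply: gsec_cover => x Wx.
have [V [h [u [f [H [Vx e]]]]]] := gsec_local (m : gsec tilde_germs W) Wx.
have [g [[k gk] g0 gx gV]] := open_basic Vx.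
have Dsub : osub (basic_open X (homog_formI gk)) V by move=> y /gV.
exists (basic_open X (homog_formI gk)), (osub_trans Dsub h); split=> //.
have hz (z : sub_pt X) (Vz : V z) :
    (m : gsec tilde_germs W) (exist _ z (h _ Vz)) = Defs.frac gL z u f.
  have := congr1 (fun s : gsec tilde_germs V => s (exist _ z Vz)) e.
  by rewrite /= /opt_incl /= (Prop_irrelevance (h z _) (h z Vz)).
have [du [ud fd _]] := H x Vx.
have [N hN] : exists N, (r * g) ^+ N *: (u : LR) = 0.
  apply: (projective_nullstellensatz (X := X) (annihilator_graded ud)).
  - move=> a aI; rewrite -[LHS]/(coord_pi X a *: (u : L)).
    suff -> : coord_pi X a = 0 by rewrite scale0r.
    rewrite -(rmorph0 (coord_pi X)); apply/eqP; rewrite /= -Quotient.idealrBE.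
    by rewrite subr0.
  - by rewrite (mcoeff0_is_multiplicative _ _).1 r0 mul0r.
  move=> y hy; apply: contrapT => /negP; rewrite notin_ptM => /andP[ry gy].
  have Vy := gV _ gy; have := hm (exist _ y (h _ Vy)) ry.
  rewrite hz => /(frac_eq0 (H _ Vy))[t [ty /hy tin]].
  by rewrite tin in ty.
have gN0 : g ^+ N *: (u : LR) = 0.
  apply: (regular_pow0 (k := N) rreg); move: hN.
  by rewrite exprMn scalerA.
apply: gsec_ext => -[y gy]; rewrite /=.
have Vy := gV _ gy; have hy := H _ Vy.
transitivity (Defs.frac gL y u f).
  by rewrite -(hz y Vy); rewrite /opt_incl /= (Prop_irrelevance (osub_trans Dsub h _) (h y Vy)).
rewrite -(frac0 gL y) (fracE hy) (fracE (hfrac0_subproof gL y)).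
apply/hloc_piP/asboolP; exists (g ^+ N); split; first by exists (k * N)%N; exact: dhomogMn.
split; first exact: notin_ptX.
by rewrite /= !scaler0 scale1r.
Qed.

End Vanishing.

(** * Globalization *)

Section GeneratedIdeals.

Variables (K : fieldType) (n : nat) (X : subscheme K n).
Local Notation R := {mpoly K[n.+1]}.
Local Notation I := (X : idealr R).

(** The ideal generated by I and S. A derivation uses finitely many elements of S, which takes the
    place of quasi-compactness. *)
Inductive ideal_gen (S : R -> Prop) : R -> Prop :=
| ideal_gen_base u : S u -> ideal_gen S u
| ideal_gen_in u : u \in I -> ideal_gen S u
| ideal_gen_add u v : ideal_gen S u -> ideal_gen S v -> ideal_gen S (u + v)
| ideal_gen_mul c u : ideal_gen S u -> ideal_gen S (c * u).

Lemma ideal_gen0 S : ideal_gen S 0.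
Proof. exact/ideal_gen_in/idealr0. Qed.

Lemma ideal_gen_graded S : (forall u, S u -> homog_form u) -> graded_ideal (ideal_gen S).
Proof.
move=> Sh; split; [exact: ideal_gen0|exact: ideal_gen_add|exact: ideal_gen_mul|].
suff H a : ideal_gen S a -> forall c d, ideal_gen S (pihomog mdeg d (c * a)).
  by move=> a d /H/(_ 1 d); rewrite mul1r.
elim=> {a} [u Su|u uI|u v _ IHu _ IHv|e u _ IHu] c d.
- have [k uk] := Sh _ Su; rewrite mulrC; have [dk|kd] := ltnP d k.
    by rewrite (pihomogMl_lt _ uk) //; exact: ideal_gen0.
  rewrite -(subnKC kd) (pihomogMl _ _ uk) mulrC.
  exact/ideal_gen_mul/ideal_gen_base.
- by apply: ideal_gen_in; exact: (sub_homog (idealMr c uI)).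
- by rewrite mulrDr raddfD; apply: ideal_gen_add; [exact: IHu|exact: IHv].
- by rewrite mulrA.
Qed.

Lemma ideal_gen_mono (S T : R -> Prop) u :
  (forall v, S v -> T v) -> ideal_gen S u -> ideal_gen T u.
Proof.
move=> ST; elim=> {u} [u /ST|u|u v _ hu _ hv|c u _]; [exact: ideal_gen_base|exact: ideal_gen_in|
  exact: ideal_gen_add|exact: ideal_gen_mul].
Qed.

Lemma ideal_gen_finite S u : ideal_gen S u ->
  exists l : seq R, (forall g, g \in l -> S g) /\ ideal_gen (fun g => g \in l) u.
Proof.
elim=> {u} [u Su|u uI|u v _ [l [lS lu]] _ [l' [lS' lv]]|c u _ [l [lS lu]]].
- exists [:: u]; split=> [g|]; first by rewrite inE => /eqP->.
  by apply: ideal_gen_base; rewrite inE.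
- by exists [::]; split=> //; exact: ideal_gen_in.
- exists (l ++ l'); split=> [g|]; first by rewrite mem_cat => /orP[/lS|/lS'].
  by apply: ideal_gen_add; [move: lu|move: lv]; apply: ideal_gen_mono => g gl;
    rewrite mem_cat gl ?orbT.
- by exists l; split=> //; exact: ideal_gen_mul.
Qed.

Lemma ideal_gen_coeffs (l : seq R) u : ideal_gen (fun g => g \in l) u ->
  exists c : 'I_(size l) -> R, u - \sum_i c i * l`_i \in I.
Proof.
elim=> {u} [u ul|u uI|u v _ [c hu] _ [d hv]|e u _ [c hu]].
- have ui : (index u l < size l)%N by rewrite index_mem.
  exists (fun i => (i == Ordinal ui)%:R).
  rewrite (bigD1 (Ordinal ui)) //= eqxx mul1r nth_index // big1 => [|i /negPf->].
    by rewrite addr0 subrr idealr0.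
  by rewrite mul0r.
- by exists (fun=> 0); rewrite big1 ?subr0 // => i _; rewrite mul0r.
- exists (fun i => c i + d i); under eq_bigr => i _ do rewrite mulrDl.
  by rewrite big_split opprD addrACA; exact: rpredD.
- exists (fun i => e * c i); under eq_bigr => i _ do rewrite -mulrA.
  by rewrite -mulr_sumr -mulrBr; exact: idealMr.
Qed.

(** It allows denominators to be replaced by powers of themselves without losing the covering. *)
Lemma ideal_gen_radical (S J : R -> Prop) u : graded_ideal J ->
  (forall a, a \in I -> J a) -> (forall g, S g -> exists k, J (g ^+ k)) ->
  ideal_gen S u -> exists k, J (u ^+ k).
Proof.
move=> [J0 JD JM Jh] IJ SJ; elim=> {u} [u /SJ //|u uI|u v _ [k hu] _ [l hv]|c u _ [k hu]].
- by exists 1%N; rewrite expr1; exact: IJ.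
(* Each term of the binomial expansion contains [u ^+ k] or [v ^+ l]. *)
- exists (k + l)%N; rewrite exprDn; elim/big_rec: _ => // i a _ ha.
  apply: (JD) => //; rewrite -mulr_natl; apply: (JM).
  have [il|li] := leqP k (k + l - i)%N.
    by rewrite mulrC -(subnK il) exprD mulrA; exact: JM.
  have le_li : (l <= i)%N by have := ltn_ord i; lia.
  by rewrite -(subnK le_li) exprD mulrA; exact: JM.
- by exists k; rewrite exprMn; exact: JM.
Qed.

Lemma ideal_gen_pt S u (x : sub_pt X) : (forall g, S g -> g \in (x : prime_idealr R)) ->
  ideal_gen S u -> u \in (x : prime_idealr R).
Proof.
move=> Sx; elim=> {u} [u /Sx //|u /sub_ptP //|u v _ hu _ hv|c u _ hu]; first exact: rpredD.
exact: idealMr.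
Qed.

End GeneratedIdeals.

Section CsecRules.

Variables (K : fieldType) (n : nat) (X : subscheme K n).
Local Notation R := {mpoly K[n.+1]}.
Local Notation I := (X : idealr R).

Lemma cgerm_congr (y : sub_pt X) a f b g : sfracP y a f -> sfracP y b g ->
  g * a = f * b -> cgerm y a f = cgerm y b g.
Proof. by move=> h h' e; rewrite /cgerm; congr conormal_class; apply/(sfrac_eq h h'). Qed.

Lemma csec0 (U : opens X) f (h : forall y, U y -> cfracP y 0 f) : csec h = 0.
Proof.
apply: gsec_ext => -[y Uy]; rewrite csecE; have [hy _] := h y Uy.
rewrite /cgerm (_ : sfrac y 0 f = 0) ?conormal_class0 // -(sfrac0 y).
by apply/(sfrac_eq hy (sfrac0P y)); ring.
Qed.

Lemma csec_scale (U : opens X) u v a f b g (k : forall y, U y -> sfracP y u v)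
  (h : forall y, U y -> cfracP y a f) (h' : forall y, U y -> cfracP y b g) :
  g * (u * a) = v * f * b -> ofrac k *: csec h = csec h'.
Proof.
move=> e; apply: gsec_ext => -[y Uy]; rewrite gsecZE !csecE.
have [ha aI] := h y Uy; have [hb bI] := h' y Uy; have hk := k y Uy.
rewrite [LHS](cgermZ hk ha aI); apply: cgerm_congr => //; exact: sfracMP.
Qed.

Lemma csec_sq_eq (F : min_free_res X) (U : opens X) t a f b g
  (h : forall y, U y -> cfracP y a f) (h' : forall y, U y -> cfracP y b g) :
  homog_form t -> (forall y, U y -> t \notin (y : prime_idealr R)) ->
  sq_ideal X (t * (g * a - f * b)) -> csec h = csec h'.
Proof.
move=> th tU hsq; apply: gsec_ext => -[y Uy]; rewrite !csecE.
have [ha aI] := h y Uy; have [hb bI] := h' y Uy.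
by apply/(cgerm_eq F ha aI hb bI); exists t; split=> //; exact: tU.
Qed.

Lemma csec_sum (U : opens X) (J : finType) (a : J -> R) f b
  (h : forall i y, U y -> cfracP y (a i) f) (h' : forall y, U y -> cfracP y b f) :
  b = \sum_i a i -> \sum_i csec (h i) = csec h'.
Proof.
move=> e; apply: gsec_ext => -[y Uy]; rewrite gsec_sumE.
under eq_bigr => i _ do rewrite csecE.
have [hb bI] := h' y Uy; have [d [_ fd fy]] := hb.
rewrite csecE [in RHS]e; apply: (cgerm_sum _ _ _ fy (homog_formI fd)) => i.
- by have [] := h i y Uy.
- by have [] := h i y Uy.
Qed.

End CsecRules.

(** * One-dimensional vector spaces *)

Section FreeRankOne.

Variable K : fieldType.

Definition free_rank1 (V : lmodType K) (v : V) : Prop :=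
  (forall u, exists c : K, u = c *: v) /\ (forall c : K, c *: v = 0 -> c = 0).

Lemma free_rank1_iso (V W : lmodType K) (v : V) (w : W) :
  free_rank1 v -> free_rank1 w -> lmod_iso V W.
Proof.
move=> [/choice[k hk] v0] [/choice[l hl] w0].
have uniq (U : lmodType K) (u : U) (c d : K) : (forall c : K, c *: u = 0 -> c = 0) ->
    c *: u = d *: u -> c = d.
  by move=> u0 e; apply/eqP; rewrite -subr_eq0; apply/eqP/u0; rewrite scalerBl e subrr.
have flin : linear (fun u => k u *: w).
  move=> c u1 u2; rewrite scalerA -scalerDl; congr (_ *: _); apply: uniq v0 _.
  by rewrite -hk scalerDl -scalerA -!hk.
pose f : {linear V -> W} := HB.pack (fun u => k u *: w) (GRing.isLinear.Build K V W _ _ flin).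
exists f; exists (fun u => l u *: v) => u /=.
- by rewrite [RHS]hk; congr (_ *: _); apply: uniq w0 _; rewrite -hl.
- by rewrite [RHS]hl; congr (_ *: _); apply: uniq v0 _; rewrite -hk.
Qed.

Lemma free_rank1_regular : free_rank1 (1 : K^o).
Proof.
split=> [u|c]; first by exists u; rewrite -[RHS]/(u * 1) mulr1.
by rewrite -[LHS]/(c * 1) mulr1.
Qed.

End FreeRankOne.

Section ZeroPoint.

Variables (K : fieldType) (n c : nat) (X : subscheme K n) (F : min_free_res X).
Local Notation R := {mpoly K[n.+1]}.

(* Otherwise the generic point of projective space lies on [X]. *)
Lemma codim_rank_gt0 : (0 < c)%N -> codim_is X c -> exists i : 'I_(fr_rank F 0), True.
Proof.
case: c => // c' _ [hc _]; apply: contrapT => noi.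
have I0 (a : R) : a \in (X : idealr R) -> a = 0.
  by move=> /(gen_span F)[d ->]; rewrite big1 // => i; case: noi; exists i.
pose S (a : R) : bool := a == 0.
have S1 : idealr_closed S.
  split; [exact: eqxx|exact: oner_neq0|].
  by move=> a u v /eqP-> /eqP->; rewrite mulr0 addr0; exact: eqxx.
have S2 : prime_idealr_closed S.
  by move=> u v; rewrite -[_ \in _]/(u * v == 0) mulf_eq0.
have S3 : homogeneous_ideal S.
  by move=> a /eqP-> d; rewrite pihomog0; exact: eqxx.
have S4 : exists i : 'I_n.+1, ~~ S 'X_i.
  exists ord0; rewrite /S; apply/eqP => /(congr1 (mcoeff U_(ord0))).
  by rewrite mcoeffX eqxx mcoeff0 => /eqP; rewrite oner_eq0.
have SX a : a \in (X : idealr R) -> a \in (ProjPt S1 S2 S3 S4 : prime_idealr R).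
  by move=> /I0->; exact: idealr0.
(* A chain of positive length ending at the zero ideal would need a prime strictly inside it. *)
have [q [qc hq]] := hc (SubPt SX).
have [_ [a /andP[]]] := hq c' (leqnn _).
rewrite qc /= => /eqP-> /negP[].
exact: (idealr0 (q c' : prime_idealr R)).
Qed.

End ZeroPoint.

(** * Extension across Z and endomorphisms of the twisted normal sheaf *)

Section Gluing.

Variables (K : closedFieldType) (n : nat) (X : subscheme K n) (F : min_free_res X).
Local Notation R := {mpoly K[n.+1]}.
Local Notation I := (X : idealr R).
Local Notation C := (conormal_sheaf X).
Local Notation CR := (rscal (coord_pi X) (conormal X)).
Variables (Z : sub_pt X -> Prop) (L : lmodType (coord_ring X)).
Variable gL : grading (rscal (coord_pi X) L).
Local Notation LR := (rscal (coord_pi X) L).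
Local Notation G := (tilde gL).
Local Notation N := (sheaf_hom C G).
Local Notation dual := dual_image.
Local Notation gen := (@gen K n X F).
Local Notation gdeg := (@gdeg K n X F).
Local Notation syz := (@syz K n X F).

Hypotheses (lciZ : lci_off Z) (invZ : invertible_off Z G).
Variables (s0 s1 r : R).
Hypotheses (s0Z : ideal_of Z s0) (s1Z : ideal_of Z s1) (rZ : ideal_of Z r).
Hypothesis reg0 : forall v : CR, s0 *: v = 0 -> v = 0.
Hypothesis reg1 : forall v w : CR, s1 *: v = s0 *: w -> exists u, v = s0 *: u.
Hypothesis regL : forall v : LR, r *: v = 0 -> v = 0.
Hypothesis shift_lt : forall (l : 'I_(fr_rank F 1)) (i : 'I_(fr_rank F 0)),
  fr_shift l < 2 * fr_shift i.
Variable i0 : 'I_(fr_rank F 0).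

Section OneEndomorphism.

Variable psi : hom_on N N (openT X).

Lemma dual_local (x : sub_pt X) : ~ Z x -> exists V : opens X, V x /\
  forall W, osub W V ->
    (forall s : C W, dual psi 0 s -> s = 0) /\ (forall s : C W, exists s', dual psi s s').
Proof.
move=> Zx; have [s [reg sJ]] := lciZ Zx.
have [m [Q [q [e [d [sg [p hframe]]]]]]] := lci_frame F reg sJ.
have [U [Ux _ [al [be albe]]]] := invZ Zx.
have [V [k [ej [pj [Vx basis]]]]] := frame_dual_basis F hframe Ux.
exists V; split=> // W h.
have albe' : forall W (h : osub W V), cancel ((hom_res k al) W h) ((hom_res k be) W h) /\
    cancel ((hom_res k be) W h) ((hom_res k al) W h) by move=> W' h'; exact: albe.
split; first exact: (dual_image_unique basis albe').
exact: (dual_image_exists psi basis albe').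
Qed.

(** Both sides of the relation are sections of L~, hence determined where r is nonzero. Since r lies
    in I(Z), this carries statements proved outside Z over to open sets that meet Z. *)
Lemma dual_dense (W : opens X) (e e' : C W) :
  (forall x, W x -> r \notin (x : prime_idealr R) ->
    exists (V : opens X) (h : osub V W), V x /\ dual psi (res h e) (res h e')) ->
  dual psi e e'.
Proof.
move=> he W' h eps; apply/eqP; rewrite -subr_eq0; apply/eqP.
apply: (tilde_torsion (proj1 rZ) regL) => y ry.
have [V [k [Vy hV]]] := he (sval y) (h _ (svalP y)) ry.
pose W2 := openI W' V.
have k1 : osub W2 W' := @osubIl _ _ _ _ _; have k2 : osub W2 V := @osubIr _ _ _ _ _.
have hr (f : hom_on C G W') t : (hom_res k1 f) W2 (@osub_refl _ _ _ W2) t = f W2 k1 t.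
  exact: (@hom_irr _ _ _ _ _ _ f).
have k3 : osub W2 W := osub_trans k1 h.
have := hV W2 k2 (hom_res k1 eps).
rewrite !(res_comp k k2 k3) -!(res_comp h k1 k3).
rewrite -[X in (X : hom_on C G W2) W2]/(psi W2 (osubT W2) (res k1 (eps : N W'))).
rewrite -(hom_natural psi (osubT W') k1 (osubT W2)).
rewrite [LHS]hr [RHS]hr -!(hom_natural _ (@osub_refl _ _ _ W') k1 k1).
move=> /(congr1 (fun t : gsec (tilde_germs gL) W2 => t (exist _ (sval y) (conj (svalP y) Vy)))).
have hk (t : G W') :
    (res k1 t : gsec (tilde_germs gL) W2) (exist _ (sval y) (conj (svalP y) Vy)) =
    (t : gsec (tilde_germs gL) W') y.
  case: y {ry Vy} (conj _ _) => y W'y c; rewrite /= /opt_incl /=.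
  by rewrite (Prop_irrelevance (k1 _ _) W'y).
rewrite !hk => e0; rewrite gsecBE e0; exact: subrr.
Qed.

Lemma dual0_vanish (b g : R) d : b \in I -> b \is d.-homog -> g@_0%MM = 0 ->
  (forall y : sub_pt X, g \notin (y : prime_idealr R) ->
     exists (W : opens X) f (H : forall z, W z -> cfracP z b f),
       [/\ W y, forall s : C W, dual psi 0 s -> s = 0 & dual psi 0 (csec H)]) ->
  exists M, sq_ideal X (g ^+ M * b).
Proof.
move=> bI bd g0 hy; apply: (germs_vanish_sq bI bd g0) => y gy.
have [W [f [H [Wy uniq0 /uniq0 e]]]] := hy y gy.
have [hf _] := H y Wy.
have /(cgerm_eq0 F hf bI)[h [_ hy' hsq]] : cgerm y b f = 0.
  exact: (congr1 (fun s : gsec (conormal_germs X) W => s (exist _ y Wy)) e).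
by exists h.
Qed.

(* On the locus where [g] is a unit, the image of [a] under the endomorphism of the
   conormal sheaf dual to [psi] is [h / g]. *)
Definition local_image (a : R) (d : nat) (g h : R) : Prop := exists e : nat,
  [/\ g \is e.-homog, g@_0%MM = 0, h \in I, h \is (d + e).-homog &
    forall W : opens X, (forall y, W y -> g \notin (y : prime_idealr R)) ->
      (forall s : C W, dual psi 0 s -> s = 0) /\
      forall f (Ha : forall y, W y -> cfracP y a f) (Hh : forall y, W y -> cfracP y h (g * f)),
        f \is d.-homog -> dual psi (csec Ha) (csec Hh)].

Lemma local_image_exists (x : sub_pt X) (a : R) d : ~ Z x -> a \in I -> a \is d.-homog ->
  exists g h, local_image a d g h /\ g \notin (x : prime_idealr R).
Proof.
move=> Zx aI ad; have [V [Vx hV]] := dual_local Zx.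
have [l l1 lx] := pt_linear_form x.
have ld : l ^+ d \is d.-homog by exact: linear_form_homogX.
pose U := openI V (basic_open X (homog_formI ld)).
have Ux : U x by split=> //; exact: notin_ptX.
have HU y : U y -> cfracP y a (l ^+ d) by move=> [_ ly]; split=> //; exact: sfracPI ad ld ly.
have [_ /(_ (csec HU))[s' hs']] := hV U (@osubIl _ _ _ _ _).
have [V' [k [b [q [Hb [V'x es']]]]]] := csec_local s' Ux.
have [w [[m wm] w0 wx wV]] := open_basic V'x.
have [[e [be qe qx]] bI] := Hb x V'x.
(* Near [x] the section a / l^d goes to b / q, hence a / f to l^d b / (q f); the factor [w] confines
   the locus to [V']. *)
exists (w * q), (w * (l ^+ d * b)); split; last by rewrite notin_ptM wx.
exists (m + e)%N; split.
- exact: dhomogM.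
- by rewrite (mcoeff0_is_multiplicative _ _).1 w0 mul0r.
- by rewrite !idealMr.
- by rewrite addnCA; apply: dhomogM => //; exact: dhomogM.
move=> W gW.
have WV' : osub W V' by move=> y /gW; rewrite notin_ptM => /andP[/wV].
have WU : osub W U := osub_trans WV' k.
split; first by move=> s; apply: (hV W _).1 => y /WU[].
move=> f Ha Hh fd.
have Hl y : W y -> sfracP y (l ^+ d) f.
  by move=> Wy; have [[c [_ _ fy]] _] := Ha y Wy; exact: sfracPI ld fd fy.
have HW y : W y -> cfracP y a (l ^+ d) by move=> /WU/HU.
have HW' y : W y -> cfracP y b q by move=> /WV'/Hb.
have := dual_imageZ (ofrac Hl) (dual_image_res WU hs').
rewrite (csec_res WU HU HW) -(res_comp k WV' WU) es' (csec_res WV' Hb HW').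
rewrite (@csec_scale _ _ _ _ _ _ _ _ _ _ Hl HW Ha); last by ring.
rewrite (@csec_scale _ _ _ _ _ _ _ _ _ _ Hl HW' Hh) //; ring.
Qed.

(** Both h / (g f) and h' / (g' f) are images of a / f, so their difference is an image of 0 and
    vanishes by uniqueness wherever g g' is nonzero. *)
Lemma local_image_compat (a : R) d g h g' h' : a \in I -> a \is d.-homog ->
  local_image a d g h -> local_image a d g' h' ->
  exists M, sq_ideal X ((g * g') ^+ M * (g' * h - g * h')).
Proof.
move=> aI ad [e [ge g0 hI hh hgh]] [e' [ge' g0' hI' hh' hgh']].
have bI : g' * h - g * h' \in I by apply: rpredB; exact: idealMr.
have bh : g' * h - g * h' \is (d + e + e').-homog.
  apply: rpredB; first by rewrite addnC; exact: dhomogM.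
  by rewrite addnAC addnC; exact: dhomogM.
apply: (dual0_vanish bI bh); first by rewrite (mcoeff0_is_multiplicative _ _).1 g0 mul0r.
move=> y; rewrite notin_ptM => /andP[gy gy'].
have [l l1 ly] := pt_linear_form y.
have ld : l ^+ d \is d.-homog by exact: linear_form_homogX.
pose W := openI (basic_open X (homog_formI ld))
  (openI (basic_open X (homog_formI ge)) (basic_open X (homog_formI ge'))).
have [uniq0 hW] := hgh W (fun z Wz => proj1 (proj2 Wz)).
have [_ hW'] := hgh' W (fun z Wz => proj2 (proj2 Wz)).
have Ha z : W z -> cfracP z a (l ^+ d).
  by move=> [lz _]; split=> //; exact: sfracPI ad ld lz.
have Hh z : W z -> cfracP z h (g * l ^+ d).
  move=> [lz [gz _]]; split=> //; apply: sfracPI hh _ _; last by rewrite notin_ptM gz.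
  by rewrite addnC; exact: dhomogM.
have Hh' z : W z -> cfracP z h' (g' * l ^+ d).
  move=> [lz [_ gz]]; split=> //; apply: sfracPI hh' _ _; last by rewrite notin_ptM gz.
  by rewrite addnC; exact: dhomogM.
have Hb z : W z -> cfracP z (g' * h - g * h') (g * g' * l ^+ d).
  move=> [lz [gz gz']]; split=> //; apply: sfracPI bh _ _; last by rewrite !notin_ptM gz gz'.
  by rewrite -addnA addnC; apply: dhomogM => //; exact: dhomogM.
exists W, (g * g' * l ^+ d), Hb; split=> //; first by split=> //; exact: notin_ptX.
have := dual_image_linear (-1) (hW' _ Ha Hh' ld) (hW _ Ha Hh ld).
rewrite scaleN1r addNr scaleN1r addrC.
suff -> : csec Hh - csec Hh' = csec Hb by [].
apply: gsec_ext => -[z Wz]; rewrite gsecBE !csecE.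
have [k kI] := Hh z Wz; have [k' kI'] := Hh' z Wz; have [kb _] := Hb z Wz.
rewrite (cgermB k kI k' kI'); apply: cgerm_congr => //; first exact: sfracBP.
ring.
Qed.

(** The denominators g of local images cover the complement of Z, so the ideal they generate with I
    contains powers of s0, s1 and r. The powers of s0 and s1 let [cech_glue] join finitely many of
    the fractions; that of r allows the result to be tested on the loci of these g. *)
Lemma dual_image_global (a : R) d : a \in I -> a \is d.-homog ->
  exists b, [/\ b \in I, b \is d.-homog &
    forall (W : opens X) f (Ha : forall y, W y -> cfracP y a f)
      (Hb : forall y, W y -> cfracP y b f), f \is d.-homog -> dual psi (csec Ha) (csec Hb)].
Proof.
move=> aI ad; pose S g := exists h, local_image a d g h.
have Sh g : S g -> homog_form g by move=> [h [e [ge _ _ _ _]]]; exists e.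
have inS t : ideal_of Z t -> exists k, ideal_gen X S (t ^+ k).
  move=> [t0 tZ]; apply: (@projective_nullstellensatz _ _ X (ideal_gen X S) t) => //.
  - exact: ideal_gen_graded.
  - exact: ideal_gen_in.
  move=> y hy; apply: contrapT => /negP ty.
  have [|g [h [gh gy]]] := @local_image_exists y a d _ aI ad.
    by move=> /tZ; rewrite (negPf ty).
  by rewrite hy in gy => //; apply: ideal_gen_base; exists h.
have [l [lS [k0 hk0] [k1 hk1] [k2 hk2]]] : exists l : seq R, [/\ forall g, g \in l -> S g,
    exists k, ideal_gen X (fun g => g \in l) (s0 ^+ k),
    exists k, ideal_gen X (fun g => g \in l) (s1 ^+ k) &
    exists k, ideal_gen X (fun g => g \in l) (r ^+ k)].
  have [k0 /ideal_gen_finite[l0 [lS0 h0]]] := inS _ s0Z.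
  have [k1 /ideal_gen_finite[l1 [lS1 h1]]] := inS _ s1Z.
  have [k2 /ideal_gen_finite[l2 [lS2 h2]]] := inS _ rZ.
  exists (l0 ++ l1 ++ l2); split.
  - by move=> g; rewrite !mem_cat => /or3P[/lS0|/lS1|/lS2].
  - by exists k0; apply: ideal_gen_mono h0 => g gl; rewrite !mem_cat gl.
  - by exists k1; apply: ideal_gen_mono h1 => g gl; rewrite !mem_cat gl orbT.
  - by exists k2; apply: ideal_gen_mono h2 => g gl; rewrite !mem_cat gl !orbT.
have /choice[h hl] : forall g, exists h, g \in l -> local_image a d g h.
  move=> g; have [/lS[h gh]|/negP gl] := boolP (g \in l); first by exists h.
  by exists 0.
have /choice[Ef hEf] : forall t : R * R, exists M, t.1 \in l -> t.2 \in l ->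
    sq_ideal X ((t.1 * t.2) ^+ M * (t.2 * h t.1 - t.1 * h t.2)).
  move=> [g g'] /=; have [gl|gl] := boolP (g \in l); last by exists 0%N.
  have [gl'|gl'] := boolP (g' \in l); last by exists 0%N.
  by have [M hM] := local_image_compat aI ad (hl _ gl) (hl _ gl'); exists M.
(* One exponent for all pairs of denominators. *)
pose E := \max_(t <- [seq (g, g') | g <- l, g' <- l]) Ef t.
have hE g g' : g \in l -> g' \in l -> sq_ideal X ((g * g') ^+ E * (g' * h g - g * h g')).
  move=> gl gl'; have le : (Ef (g, g') <= E)%N.
    by apply: leq_bigmax_seq => //; apply: allpairs_f.
  by rewrite -(subnK le) exprD -mulrA; apply: sq_idealMl; exact: (hEf (g, g')).
(* Passing from h / g to (g^E h) / g^(E+1) absorbs the multiplier (g g')^E, so that the cocycle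
   condition holds modulo I^2 itself. *)
pose l' := [seq g ^+ E.+1 | g <- l].
have inl' u : ideal_gen X (fun g => g \in l) u ->
    exists k, ideal_gen X (fun g => g \in l') (u ^+ k).
  apply: ideal_gen_radical.
  - apply: ideal_gen_graded => g' /mapP[g gl ->]; have [e ge] := Sh _ (lS _ gl).
    by exists (e * E.+1)%N; exact: dhomogMn.
  - exact: ideal_gen_in.
  - by move=> g gl; exists E.+1; apply: ideal_gen_base; exact: map_f.
have [j0] := inl' _ hk0; rewrite -exprM => /ideal_gen_coeffs[u hu].
have [j1] := inl' _ hk1; rewrite -exprM => /ideal_gen_coeffs[v hv].
have il (i : 'I_(size l')) : (i < size l)%N by rewrite -(size_map (fun g => g ^+ E.+1) l).
have lE (i : 'I_(size l')) : l'`_i = l`_i ^+ E.+1 by rewrite (nth_map 0).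
have lin (i : 'I_(size l')) : l`_i \in l by rewrite mem_nth.
have [||b bI hb] := @cech_glue _ _ X s0 s1 _ (fun i => l'`_i)
  (fun i => l`_i ^+ E * h l`_i) u v _ _ reg0 reg1 _ _ hu hv.
- by move=> i; have [e [_ _ hI _ _]] := hl _ (lin i); exact: idealMr.
- move=> i j; rewrite !lE.
  have -> : l`_j ^+ E.+1 * (l`_i ^+ E * h l`_i) - l`_i ^+ E.+1 * (l`_j ^+ E * h l`_j) =
     (l`_i * l`_j) ^+ E * (l`_j * h l`_i - l`_i * h l`_j) by rewrite exprMn !exprS; ring.
  exact: hE.
(* The glued element need not be a form; its component of degree [d] satisfies the same
   congruences. *)
have {}hb g : g \in l -> sq_ideal X (g ^+ E * (g * pihomog mdeg d b - h g)).
  move=> gl; have [e [ge _ _ hh _]] := hl _ gl.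
  have hgh : g ^+ E * h g \is (e * E.+1 + d).-homog.
    have -> : (e * E.+1 + d = e * E + (d + e))%N by rewrite mulnS; lia.
    by apply: dhomogM => //; exact: dhomogMn.
  have gi : (index g l < size l')%N by rewrite size_map index_mem.
  have := hb (Ordinal gi); rewrite lE /= nth_index // => /(sq_ideal_homog (e * E.+1 + d)).
  rewrite raddfB /= (pihomogMl _ _ (dhomogMn _ ge)) (pihomog_dE hgh).
  by rewrite exprSr -mulrA -mulrBr.
exists (pihomog mdeg d b); split; [exact: (sub_homog bI)|exact: pihomogP|].
move=> W f Ha Hb fd; apply: dual_dense => x Wx rx.
(* A power of [r] lies in the ideal generated by the denominators, so one of them is nonzero at
   [x]. *)
have [g [gl gx]] : exists g, g \in l /\ g \notin (x : prime_idealr R).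
  apply: contrapT => /forallNP no; have := notin_ptX k2 rx.
  rewrite (ideal_gen_pt _ hk2) // => g gl; apply: contrapT => /negP gx.
  by apply: (no g).
have [e [ge _ hI hh hW]] := hl _ gl.
pose V := openI W (basic_open X (homog_formI ge)).
have VW : osub V W := @osubIl _ _ _ _ _.
have gV y : V y -> g \notin (y : prime_idealr R) by case.
have HaV y : V y -> cfracP y a f by move=> /VW/Ha.
have HbV y : V y -> cfracP y (pihomog mdeg d b) f by move=> /VW/Hb.
have Hh y : V y -> cfracP y (h g) (g * f).
  move=> [Wy gy]; have [[c [_ _ fy]] _] := Ha y Wy.
  split=> //; apply: sfracPI hh _ _; last by rewrite notin_ptM gy.
  by rewrite addnC; exact: dhomogM.
exists V, VW; split=> //; rewrite (csec_res VW Ha HaV) (csec_res VW Hb HbV).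
have [_ /(_ f HaV Hh fd)] := hW V gV.
suff -> : csec Hh = csec HbV by [].
apply: esym; apply: (csec_sq_eq F (t := g ^+ E)) => [|y Vy|].
- by exists (e * E)%N; exact: dhomogMn.
- exact/notin_ptX/gV.
have -> : g ^+ E * (g * f * pihomog mdeg d b - f * h g) =
  f * (g ^+ E * (g * pihomog mdeg d b - h g)) by ring.
by apply: sq_idealMl; exact: hb.
Qed.

Definition global_image (d : nat) (a b : R) : Prop :=
  forall (W : opens X) f (Ha : forall y, W y -> cfracP y a f)
    (Hb : forall y, W y -> cfracP y b f), f \is d.-homog -> dual psi (csec Ha) (csec Hb).

(** With m = dg i, split c_i a_i / f as c_i l^m / f times a_i / l^m, so that linearity over the
    structure sheaf applies. A nonvanishing linear form l exists only locally, whence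
    [dual_dense]. *)
Lemma global_image_comb (J : finType) (dg : J -> nat) (a b c : J -> R) d :
  (forall i, a i \in I /\ a i \is (dg i).-homog) ->
  (forall i, b i \in I /\ b i \is (dg i).-homog) ->
  (forall i, global_image (dg i) (a i) (b i)) ->
  (forall i, c i \is (d - dg i).-homog /\ ((d < dg i)%N -> c i = 0)) ->
  global_image d (\sum_i c i * a i) (\sum_i c i * b i).
Proof.
move=> ha hb hab hc W f HA HB fd; apply: dual_dense => x Wx _.
have [l l1 lx] := pt_linear_form x.
pose V := openI W (basic_open X (homog_formI l1)).
have VW : osub V W := @osubIl _ _ _ _ _.
have fV y : V y -> f \notin (y : prime_idealr R).
  by move=> /VW/HA[[k []]].
have ld k : l ^+ k \is k.-homog by exact: linear_form_homogX.
have lV k y : V y -> l ^+ k \notin (y : prime_idealr R) by move=> [_ ly]; exact: notin_ptX.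
have hcd i k t : t \is (dg i + k).-homog -> c i * t \is (d + k).-homog.
  have [ci c0] := hc i; have [di|id] := ltnP d (dg i).
    by rewrite c0 // mul0r dhomog0.
  by move=> ht; rewrite -(subnK id) -addnA; exact: dhomogM.
have hcd0 i t : t \is (dg i).-homog -> c i * t \is d.-homog.
  by move=> ht; rewrite -[d]addn0; apply: hcd; rewrite addn0.
have Hk i y : V y -> sfracP y (c i * l ^+ dg i) f.
  by move=> Vy; apply: sfracPI _ fd (fV y Vy); apply: hcd0.
have key (a' : J -> R) (ha' : forall i, a' i \in I /\ a' i \is (dg i).-homog)
    (HA' : forall y, W y -> cfracP y (\sum_i c i * a' i) f)
    (Ha : forall i y, V y -> cfracP y (a' i) (l ^+ dg i)) :
    res VW (csec HA') = \sum_i ofrac (Hk i) *: csec (Ha i).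
  have H1 i y : V y -> cfracP y (c i * a' i) f.
    move=> Vy; have [aI ad] := ha' i; split; last exact: idealMr.
    by apply: sfracPI _ fd (fV y Vy); apply: hcd0.
  have H2 y : V y -> cfracP y (\sum_i c i * a' i) f by move=> /VW/HA'.
  rewrite (csec_res VW HA' H2) -(csec_sum (J := J) H1 H2) //.
  apply: eq_bigr => i _; apply: esym; apply: csec_scale; ring.
have HV (a' : J -> R) (ha' : forall i, a' i \in I /\ a' i \is (dg i).-homog) i y :
    V y -> cfracP y (a' i) (l ^+ dg i).
  by move=> Vy; have [aI ad] := ha' i; split=> //; apply: sfracPI ad (ld _) (lV _ _ Vy).
exists V, VW; split=> //.
rewrite (key a ha HA (HV a ha)) (key b hb HB (HV b hb)).
by apply: dual_image_sum => i; apply: dual_imageZ; apply: hab.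
Qed.

(** Where s0 is nonzero the point is outside Z and uniqueness applies; the resulting power of s0
    cancels on I / I^2. It serves both for the syzygies and to see that the identity is nonzero. *)
Lemma global_image0_sq b d : b \in I -> b \is d.-homog -> global_image d 0 b -> sq_ideal X b.
Proof.
move=> bI bd hb.
have [M hM] : exists M, sq_ideal X (s0 ^+ M * b).
  apply: (dual0_vanish bI bd (proj1 s0Z)) => y ys0.
  have Zy : ~ Z y by move=> /(proj2 s0Z); rewrite (negPf ys0).
  have [V [Vy hV]] := dual_local Zy.
  have [l l1 ly] := pt_linear_form y.
  have ld : l ^+ d \is d.-homog by exact: linear_form_homogX.
  pose W := openI V (basic_open X (homog_formI ld)).
  have Hb z : W z -> cfracP z b (l ^+ d) by move=> [_ lz]; split=> //; exact: sfracPI bd ld lz.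
  have H0 z : W z -> cfracP z 0 (l ^+ d).
    by move=> [_ lz]; split; [exact: sfracPI (dhomog0 _ _ d) ld lz|exact: idealr0].
  exists W, (l ^+ d), Hb; split.
  - by split=> //; exact: notin_ptX.
  - exact: (hV W (@osubIl _ _ _ _ _)).1.
  - by rewrite -(csec0 H0); exact: hb.
apply/conormal_class_eq0 => //; apply: (@regular_pow0 _ CR s0 M reg0).
by rewrite rscal_conormalZ //; apply/conormal_class_eq0; rewrite ?idealMr.
Qed.

Lemma endomorphism_dual_scalar :
  exists k : K, forall (W : opens X) (s : C W), dual psi s (osec_const W k *: s).
Proof.
have /choice[h hh] : forall i : 'I_(fr_rank F 0), exists b, [/\ b \in I, b \is (gdeg i).-homog &
    global_image (gdeg i) (gen i) b].
  move=> i; exact: (dual_image_global (gen_in i) (gen_homog i)).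
have hI i : h i \in I by have [] := hh i.
have hd i : h i \is (gdeg i).-homog by have [] := hh i.
have hg i : global_image (gdeg i) (gen i) (h i) by have [] := hh i.
have [k hk] : exists k : K, forall i, h i = k *: gen i.
  apply: (graded_endo_scalar shift_lt) => // l; case le : (fr_shift l) => [m|m]; last first.
    rewrite big1 => [|i _]; first exact: sq_ideal0.
    by rewrite (syz_neg i le) mul0r.
  apply: (@global_image0_sq _ m).
  - by apply: rpred_sum => i _; exact: idealMr.
  - apply: rpred_sum => i _; have [sh s_0] := syz_homog i le.
    have [mi|im] := ltnP m (gdeg i); first by rewrite s_0 // mul0r dhomog0.
    by rewrite -(subnK im); exact: dhomogM.
  (* A syzygy sends the generators to 0, so the same combination of the [h i] is an image of 0. *)
  have := @global_image_comb _ gdeg gen h (syz l) m; rewrite syz_gen; apply=> // i.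
  - by split; [exact: gen_in|exact: gen_homog].
  - exact: syz_homog.
(* An arbitrary section is locally a / f, with a a combination of generators. *)
exists k => W s; apply: dual_dense => x Wx _.
have [V [VW [a [f [H [Vx es]]]]]] := csec_local s Wx.
have [[d [ad fd fx]] aI] := H x Vx.
have H' y : V y -> cfracP y (k *: a) f.
  move=> Vy; have [[_ [_ _ fy]] _] := H y Vy.
  split; first exact: sfracPI (dhomogZ k ad) fd fy.
  by rewrite -mul_mpolyC idealMr.
exists V, VW; split=> //; rewrite resZ es.
have -> : osec_res VW (osec_const W k) *: csec H = csec H'.
  apply: gsec_ext => -[y Vy]; rewrite gsecZE !csecE.
  have [h1 _] := H y Vy; have [h2 _] := H' y Vy.
  have hk1 := const_frac (y : prime_idealr R) k.
  rewrite [LHS](cgermZ hk1 h1 aI); apply: cgerm_congr => //; first exact: sfracMP hk1 h1.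
  by rewrite -mul_mpolyC; ring.
have [c [ac hc]] := gen_span_homog F aI ad.
have kac : k *: a = \sum_i c i * h i.
  by rewrite ac scaler_sumr; apply: eq_bigr => i _; rewrite hk scalerAr.
move: H' => H'; have := @global_image_comb _ gdeg gen h c d _ _ hg hc V f.
rewrite -ac -kac; apply=> // i.
- by split; [exact: gen_in|exact: gen_homog].
Qed.

End OneEndomorphism.

(** Duality undone: psi(eps)(s) = eps(k s) = k eps(s) for all local eps and s determines psi. *)
Lemma endomorphism_scalar (psi : hom_on N N (openT X)) :
  exists k : K, psi = (k *: (hom_id N (openT X) : Hom_OX N N)).
Proof.
have [k hk] := endomorphism_dual_scalar psi.
exists k; apply: hom_ext => V h eps.
apply: hom_ext => W l s.
have := hk W s W (@osub_refl _ _ _ W) (hom_res l eps).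
rewrite -[X in (X : hom_on C G W) W]/(psi W (osubT W) (res l (eps : N V))).
rewrite -(hom_natural psi h l (osubT W)).
have hr (f : hom_on C G V) t : (hom_res l f) W (@osub_refl _ _ _ W) t = f W l t.
  exact: (@hom_irr _ _ _ _ _ _ f).
rewrite [LHS]hr [RHS]hr !res_id homZ => e; rewrite [LHS]e.
rewrite -[RHS]/(osec_res l (osec_res h (osec_const (openT X) k)) *: eps W l s).
by congr (_ *: _); apply: osec_ext.
Qed.

(** If the identity were 0, all local morphisms from C to L~ would vanish, and every section would
    be an image of 0, even a generator of least degree, which is not in I^2. *)
Lemma hom_id_neq0 (k : K) : k *: (hom_id N (openT X) : Hom_OX N N) = 0 -> k = 0.
Proof.
move=> e; apply: contrapT => /eqP k0.
have id0 : (hom_id N (openT X) : Hom_OX N N) = 0.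
  have := congr1 (fun f : Hom_OX N N => k^-1 *: f) e.
  by rewrite /= scalerA mulVf // scale1r scaler0.
have eps0 (W : opens X) (eps : hom_on C G W) : eps = 0.
  exact: (congr1 (fun f : hom_on N N (openT X) => f W (osubT W) eps) id0).
have [i hi] := min_gdeg i0.
apply: (gen_notin_sq hi).
apply: (global_image0_sq (psi := hom_id N (openT X)) (gen_in i) (gen_homog i)).
move=> W f H0 Hb _ W' h eps; by rewrite (eps0 W' eps).
Qed.

Lemma hom_OX_free : free_rank1 (hom_id N (openT X) : Hom_OX N N).
Proof. by split; [exact: endomorphism_scalar|exact: hom_id_neq0]. Qed.

End Gluing.

(** * Graded endomorphisms of the conormal module *)

Section GradedEndomorphisms.

Variables (K : closedFieldType) (n : nat) (X : subscheme K n) (F : min_free_res X).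
Local Notation R := {mpoly K[n.+1]}.
Local Notation I := (X : idealr R).
Local Notation gX := (conormal_grading X).
Local Notation gen := (@gen K n X F).
Local Notation gdeg := (@gdeg K n X F).
Local Notation syz := (@syz K n X F).

Hypothesis shift_lt : forall (l : 'I_(fr_rank F 1)) (i : 'I_(fr_rank F 0)),
  fr_shift l < 2 * fr_shift i.
Variable i0 : 'I_(fr_rank F 0).

Definition ghom_id : ghom0 gX gX := @GHom0 K n X _ _ gX gX id (fun _ _ _ => erefl) (fun _ _ h => h).

Lemma ghom_sum (phi : ghom0 gX gX) (J : Type) (s : seq J) (c : J -> R) (q : J -> conormal X) :
  phi (\sum_(i <- s) coord_pi X (c i) *: q i) = \sum_(i <- s) coord_pi X (c i) *: phi (q i).
Proof.
have phi0 : phi 0 = 0.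
  have := ghom_linear phi (-1) 0 0.
  by rewrite !scaleN1r oppr0 addr0 addNr.
elim: s => [|i s IH]; first by rewrite !big_nil.
by rewrite !big_cons ghom_linear IH.
Qed.

Lemma conormal_class_comb (c a : 'I_(fr_rank F 0) -> R) : (forall i, a i \in I) ->
  conormal_class X (\sum_i c i * a i) = \sum_i coord_pi X (c i) *: conormal_class X (a i).
Proof.
move=> aI; rewrite conormal_class_sum => [|i]; last exact: idealMr.
by apply: eq_bigr => i _; rewrite -conormal_classZ.
Qed.

Lemma ghom_scalar (phi : ghom0 gX gX) : exists k : K, phi = k *: ghom_id.
Proof.
have /choice[h hh] : forall i, exists b : R, [/\ b \in I, b \is (gdeg i).-homog &
    phi (conormal_class X (gen i)) = conormal_class X b].
  move=> i; have [b [bI bd e]] : gX (gdeg i)%:Z (phi (conormal_class X (gen i))).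
    apply: ghom_degree; exists (gen i); split=> //; first exact: gen_in.
    exact: gen_homog.
  by exists b.
have hI i : h i \in I by have [] := hh i.
have hd i : h i \is (gdeg i).-homog by have [] := hh i.
have hE i : phi (conormal_class X (gen i)) = conormal_class X (h i) by have [] := hh i.
have phiE (c : 'I_(fr_rank F 0) -> R) :
    phi (conormal_class X (\sum_i c i * gen i)) = conormal_class X (\sum_i c i * h i).
  rewrite !conormal_class_comb // => [|i]; last exact: gen_in.
  by rewrite ghom_sum; apply: eq_bigr => i _; rewrite hE.
have [k hk] : exists k : K, forall i, h i = k *: gen i.
  apply: (graded_endo_scalar shift_lt) => // l.
  apply/conormal_class_eq0; first by apply: rpred_sum => i _; exact: idealMr.
  rewrite -phiE syz_gen conormal_class0.
  by have := ghom_sum phi (Nil unit) (fun=> 0) (fun=> 0); rewrite !big_nil.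
exists k; apply: ghom_ext => u; have [a aI ->] := conormal_class_surj (u : conormal X).
rewrite -[RHS]/(coord_pi X k%:MP *: conormal_class X a) [RHS]conormal_classZ //.
have [c ->] := (gen_span F a).1 aI; rewrite phiE mulr_sumr.
by congr conormal_class; apply: eq_bigr => i _; rewrite hk -mul_mpolyC mulrCA.
Qed.

Lemma ghom_id_neq0 (k : K) : k *: ghom_id = 0 -> k = 0.
Proof.
move=> e; apply: contrapT => /eqP k0; have [i hi] := min_gdeg i0.
apply: (gen_notin_sq hi).
have : coord_pi X k%:MP *: conormal_class X (gen i) = 0.
  exact: (congr1 (fun f : ghom0 gX gX => f (conormal_class X (gen i))) e).
rewrite conormal_classZ ?gen_in // => /conormal_class_eq0 h.
have := sq_idealMl (k^-1)%:MP (h (idealMr _ (gen_in i))).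
by rewrite mulrA -mpolyCM mulVf // mpolyC1 mul1r.
Qed.

Lemma ghom_free : free_rank1 ghom_id.
Proof. by split; [exact: ghom_scalar|exact: ghom_id_neq0]. Qed.

End GradedEndomorphisms.

Theorem theorem4p7 (K : closedFieldType) (n c : nat) (X : subscheme K n)
    (F : min_free_res X) (Z : sub_pt X -> Prop)
    (L : lmodType (coord_ring X)) (gL : grading (rscal (coord_pi X) L)) :
  [pchar K] =i pred0 ->
  (2 <= c)%N ->
  codim_is X c ->
  is_closed Z ->
  lci_off Z ->
  fin_gen L ->
  invertible_off Z (tilde gL) ->
  depth_ge (ideal_of Z) L 2 ->
  depth_ge (ideal_of Z) (conormal X) 2 ->
  (forall (j : 'I_(fr_rank F 1)) (i : 'I_(fr_rank F 0)),
     fr_shift j < 2 * fr_shift i) ->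
  lmod_iso (Hom_OX (twisted_normal_sheaf gL) (twisted_normal_sheaf gL))
           (ghom0 (conormal_grading X) (conormal_grading X))
  /\ lmod_iso (ghom0 (conormal_grading X) (conormal_grading X)) K^o.
Proof.
move=> _ c2 codimX _ lciZ _ invZ [dL [depthL dL2]] [dC [depthC dC2]] shift_lt.
have [i0 _] := codim_rank_gt0 F (ltnW c2) codimX.
(* The depth of L provides the element [r] that tests sections of L~, the depth of I / I^2 the pair
   for the Cech argument. *)
have [r [_ [rZ _ regL _]]] := regular_pair depthL dL2.
have [s0 [s1 [s0Z s1Z reg0 reg1]]] := regular_pair depthC dC2.
have gfree := ghom_free shift_lt i0; split.
  apply: free_rank1_iso gfree.
  exact: (hom_OX_free lciZ invZ s0Z s1Z rZ reg0 reg1 regL shift_lt i0).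
exact: free_rank1_iso gfree (free_rank1_regular K).
Qed.
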